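(* Let $(M,\tilde g)$ be a transverse, signature-type changing, $n$-dimensional ($n\ge 2$) manifold with a transverse radical, and let $\mathcal{H}\subset M$ be its hypersurface of signature change. Then for every point $q\in\mathcal{H}$ and every neighborhood $V$ of $q$ in $M$ there exists a pseudo-timelike loop in $V$ (i.e. with image contained in $V$).
   Context: Manifolds are smooth, connected, second countable, Hausdorff, without boundary. Setting: $M$ is such a manifold of dimension $n\geq 2$ and $g$ (denoted $\tilde g$ in the claim) is a smooth symmetric $(0,2)$-tensor field on $M$; $\mathcal{H}:=\{q\in M : g|_q \text{ is degenerate}\}$ is assumed non-empty. One connected component of $M\setminus\mathcal{H}$, denoted $M_R$, is Riemannian (signature $(+,\dots,+)$); all other connected components are Lorentzian (signature $(-,+,\dots,+)$), and $M_L$ denotes their union. $(M,g)$ is a transverse, signature-type changing manifold if $d(\det[g_{\mu\nu}])_q\neq 0$ for every $q\in\mathcal{H}$ and every local coordinate system around $q$. Then $\mathcal{H}$ is a smoothly embedded hypersurface and the radical $\mathrm{Rad}_q:=\{w\in T_qM : g(w,\cdot)=0\}$ is one-dimensional for each $q\in\mathcal{H}$. The radical is transverse if $\mathrm{Rad}_q+T_q\mathcal{H}=T_qM$ for every $q\in\mathcal{H}$. Generalized affine parameter: let $\gamma\colon J\to M_L$ be a $C^1$ curve, $t_0\in J$, $\{e_1,\dots,e_n\}$ a basis of $T_{\gamma(t_0)}M$, and $E_i$ the parallel field along $\gamma$ (for the Levi-Civita connection of $g|_{M_L}$) with $E_i(t_0)=e_i$. Write $\dot\gamma(t)=\sum_i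 V^i(t)E_i(t)$. The generalized affine parameter of $\gamma$ associated with this basis is $\mu(t)=\int_{t_0}^t\sqrt{\sum_{i}(V^i(s))^2}\,ds$. A generalized affine parametrization of $\gamma$ is its reparametrization by such a $\mu$. Pseudo-timelike curve: a continuous and differentiable curve $\gamma\colon[a,b]\to M$ ($-\infty<a<b<\infty$) such that (1) $\mathrm{Im}(\gamma)\cap M_L\neq\varnothing$, and (2) for every generalized affine parametrization of $\gamma$ in $M_L$ there exists $\varepsilon>0$ such that $g(\gamma',\gamma')<-\varepsilon$ in $M_L$ (the prime denoting the derivative with respect to that parameter). No condition is imposed on $\gamma$ in $M_R$. Pseudo-timelike loop: a smooth pseudo-timelike curve $\gamma\colon I\to M$ whose image contains a subset homeomorphic to $S^1$ and which intersects itself, i.e. there are parameters $s_1\neq s_2$ in $I$ with $\gamma(s_1)=\gamma(s_2)$, where the tangent vectors $\gamma'(s_1),\gamma'(s_2)$ are timelike but are not required to be positively proportional. *)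

(* Defs.v *)
(* Vectors are rows, and matrices act on them on the right. *)
From mathcomp Require Import all_boot all_order all_algebra.
From mathcomp Require Import all_classical all_reals all_analysis.

Set Implicit Arguments.
Unset Strict Implicit.
Unset Printing Implicit Defensive.

Import Order.TTheory GRing.Theory Num.Theory.
Import numFieldTopology.Exports numFieldNormedType.Exports.

Local Open Scope classical_set_scope.
Local Open Scope ring_scope.

(** * Differentiability classes *)

(* Intended for open U.  For V finite-dimensional, all directional derivatives
   being C^k is equivalent to all partial derivatives being C^k. *)
Fixpoint Ck_on {R : realType} {V W : normedModType R} (k : nat) (U : set V)
    (f : V -> W) : Prop :=
  (forall x, U x -> {for x, continuous f}) /\
  (if k is k'.+1 then
     forall v, (forall x, U x -> derivable f x v) /\ Ck_on k' U ('D_v f)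
   else True).

Definition smooth_on {R : realType} {V W : normedModType R} (U : set V)
    (f : V -> W) : Prop := forall k, Ck_on k U f.

(* Derivative of a function of one real variable relative to J; it is one-sided
   at an endpoint of an interval J. *)
Definition diff_quot {R : realType} {W : normedModType R} (f : R -> W) (t : R) :
    R -> W := fun s => (s - t)^-1 *: (f s - f t).

Definition wderivable {R : realType} {W : normedModType R} (J : set R)
    (f : R -> W) (t : R) : Prop := cvg (diff_quot f t @ within J t^').

Definition wderive {R : realType} {W : normedModType R} (J : set R)
    (f : R -> W) (t : R) : W := lim (diff_quot f t @ within J t^').

(* Intended for sets J without isolated points. *)
Fixpoint Ck_within {R : realType} {W : normedModType R} (k : nat) (J : set R)
    (f : R -> W) : Prop :=
  {within J, continuous f} /\
  (if k is k'.+1 then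
     (forall t, J t -> wderivable J f t) /\ Ck_within k' J (wderive J f)
   else True).

(** * Smooth manifolds *)

(* Outside [cdom] (resp. outside the image of [cdom]) the values of [coord]
   (resp. [cinv]) are irrelevant. *)
Record chart (R : realType) (n : nat) (T : topologicalType) := Chart {
  cdom : set T;
  coord : T -> 'rV[R]_n;
  cinv : 'rV[R]_n -> T;
  cdom_open : open cdom;
  cimg_open : open (coord @` cdom);
  coord_cont : {within cdom, continuous coord};
  cinv_cont : {within coord @` cdom, continuous cinv};
  coordK : forall p, cdom p -> cinv (coord p) = p
}.

Definition transition {R : realType} {n : nat} {T : topologicalType}
    (c c' : chart R n T) : 'rV[R]_n -> 'rV[R]_n := coord c' \o cinv c.

Definition compatible {R : realType} {n : nat} {T : topologicalType}
    (c c' : chart R n T) : Prop :=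
  smooth_on (coord c @` (cdom c `&` cdom c')) (transition c c') /\
  smooth_on (coord c' @` (cdom c `&` cdom c')) (transition c' c).

(* The atlas is maximal, so "chart in the atlas" means "local coordinate
   system". *)
Record smoothManifold (R : realType) (n : nat) := SmoothManifold {
  carrier :> topologicalType;
  atlas : set (chart R n carrier);
  mfd_hausdorff : hausdorff_space carrier;
  mfd_second_countable : @second_countable carrier;
  mfd_connected : connected [set: carrier];
  atlas_cover : forall p, exists2 c, atlas c & cdom c p;
  atlas_compatible : forall c c', atlas c -> atlas c' -> compatible c c';
  atlas_maximal :
    forall c, (forall c', atlas c' -> compatible c c') -> atlas c
}.

Definition charts_at {R : realType} {n : nat} (M : smoothManifold R n) (p : M) :
  set (chart R n M) := [set c | atlas c /\ cdom c p].

(* Tangent vectors at p are given by their components in the charts around p: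
   v' = v *m trans_jac c c' p is the change of components from c to c'. *)
Definition trans_jac {R : realType} {n : nat} {M : smoothManifold R n}
    (c c' : chart R n M) (p : M) : 'M[R]_n :=
  jacobian (transition c c') (coord c p).

(** * Curves *)

Section CurvesInManifold.
Context {R : realType} {n : nat} {M : smoothManifold R n}.
Implicit Types (c : chart R n M) (J : set R) (gamma : R -> M).

(* The parameter set of the curve is J; values of gamma off J are irrelevant. *)
Definition differentiable_curve J gamma : Prop :=
  {within J, continuous gamma} /\
  forall t c, J t -> charts_at (gamma t) c -> wderivable J (coord c \o gamma) t.

Definition Ck_curve (k : nat) J gamma : Prop :=
  {within J, continuous gamma} /\
  forall c, atlas c ->
    Ck_within k (J `&` gamma @^-1` cdom c) (coord c \o gamma).

Definition smooth_curve J gamma : Prop := forall k, Ck_curve k J gamma.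

(* Components of the tangent vector of gamma at t in the chart c. *)
Definition velocity c J gamma (t : R) : 'rV[R]_n := wderive J (coord c \o gamma) t.

(* The tangent space at q of a (smoothly embedded) submanifold S, as a subspace
   of the tangent space of M: velocities at q of smooth curves of M lying in S. *)
Definition tangent_space (S : set M) (q : M) c : set 'rV[R]_n :=
  [set v | exists delta : R, exists sigma : R -> M,
     [/\ 0 < delta, smooth_curve `]- delta, delta[ sigma, sigma 0 = q,
         sigma @` `]- delta, delta[ `<=` S
       & velocity c `]- delta, delta[ sigma 0 = v]].

End CurvesInManifold.

(** * Symmetric (0,2)-tensor fields *)

(* [gcomp c p] is the matrix of components at p in the chart c. *)
Record symTensor {R : realType} {n : nat} (M : smoothManifold R n) := SymTensor {
  gcomp : chart R n M -> M -> 'M[R]_n;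
  gcomp_sym : forall p c, charts_at p c -> (gcomp c p)^T = gcomp c p;
  gcomp_trans : forall p c c', charts_at p c -> charts_at p c' ->
    gcomp c p = trans_jac c c' p *m gcomp c' p *m (trans_jac c c' p)^T;
  gcomp_smooth : forall c, atlas c ->
    smooth_on (coord c @` cdom c) (gcomp c \o cinv c)
}.

Section SignatureChange.
Context {R : realType} {n : nat} {M : smoothManifold R n}.
Implicit Types (g : symTensor M) (c : chart R n M) (p q : M) (ML MR : set M).

(* g_p(v, w), for v and w given by their components in c. *)
Definition gval g c p (v w : 'rV[R]_n) : R := (v *m gcomp g c p *m w^T) 0 0.

Definition radical g c p : set 'rV[R]_n :=
  [set w | forall v, gval g c p w v = 0].

Definition degenerate_at g p : Prop :=
  forall c, charts_at p c -> exists2 w, w != 0 & radical g c p w.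

Definition hypersurface g : set M := [set p | degenerate_at g p].

(* In a suitable basis, g_p is diag(-1,..,-1,1,..,1) with k entries -1. *)
Definition signature_at g (k : nat) p : Prop :=
  forall c, charts_at p c -> exists2 P : 'M[R]_n, P \in unitmx &
    P *m gcomp g c p *m P^T = diag_mx (\row_(i < n) (if (i < k)%N then -1 else 1)).

Definition riemannian_at g p := signature_at g 0 p.
Definition lorentzian_at g p := signature_at g 1 p.

Definition signature_type_changing g MR : Prop :=
  [/\ hypersurface g !=set0,
      exists2 p, ~ hypersurface g p &
        MR = connected_component (~` hypersurface g) p,
      forall p, MR p -> riemannian_at g p
    & forall p, ~ hypersurface g p -> ~ MR p -> lorentzian_at g p].

Definition lorentzian_part g MR : set M := ~` hypersurface g `\` MR.

(* The differential of det [g_{mu nu}] is nonzero along the hypersurface, in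
   every local coordinate system. *)
Definition transverse_type_change g : Prop :=
  forall q c, hypersurface g q -> charts_at q c ->
    exists v, 'd (fun x => \det (gcomp g c (cinv c x))) (coord c q) v != 0.

Definition transverse_radical g : Prop :=
  forall q c, hypersurface g q -> charts_at q c ->
    forall v, exists w u,
      [/\ radical g c q w, tangent_space (hypersurface g) q c u & v = w + u].

(** * Levi-Civita connection and generalized affine parameters *)

(* d g_{ij} / d x^l at the point p, in the chart c. *)
Definition gpartial g c (l i j : 'I_n) p : R :=
  'D_(delta_mx 0 l) (fun x => gcomp g c (cinv c x) i j) (coord c p).

(* Gamma^k_{ij}. *)
Definition christoffel g c (k i j : 'I_n) p : R :=
  2^-1 * \sum_l invmx (gcomp g c p) k l *
    (gpartial g c i l j p + gpartial g c j l i p - gpartial g c l i j p).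

(* [E c t] lists the components in the chart c of the vector E(t), tangent to M
   at gamma t. *)
Definition field_along (J : set R) (gamma : R -> M)
    (E : chart R n M -> R -> 'rV[R]_n) : Prop :=
  forall t c c', J t -> charts_at (gamma t) c -> charts_at (gamma t) c' ->
    E c' t = E c t *m trans_jac c c' (gamma t).

Definition cov_derive g (J : set R) (gamma : R -> M)
    (E : chart R n M -> R -> 'rV[R]_n) c (t : R) : 'rV[R]_n :=
  wderive J (E c) t +
  \row_k \sum_i \sum_j
    christoffel g c k i j (gamma t) * velocity c J gamma t 0 i * E c t 0 j.

Definition parallel g (J : set R) (gamma : R -> M)
    (E : chart R n M -> R -> 'rV[R]_n) : Prop :=
  field_along J gamma E /\
  forall t c, J t -> charts_at (gamma t) c ->
    wderivable J (E c) t /\ cov_derive g J gamma E c t = 0.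

Definition oriented_integral (f : R -> R) (a b : R) : R :=
  if a <= b then \int[lebesgue_measure]_(s in `[a, b]) f s
  else - \int[lebesgue_measure]_(s in `[b, a]) f s.

(* mu is a generalized affine parameter of the curve gamma, defined on the
   interval J and contained in the part of M where g is Lorentzian; the basis is
   (E_0(t0), ..., E_{n-1}(t0)). *)
Definition gen_affine_parameter g (J : set R) (gamma : R -> M)
    (mu : R -> R) : Prop :=
  exists (t0 : R) (E : 'I_n -> chart R n M -> R -> 'rV[R]_n) (V : 'I_n -> R -> R),
    [/\ Ck_curve 1 J gamma /\ J t0,
        forall i, parallel g J gamma (E i),
        forall c, charts_at (gamma t0) c -> \matrix_(i < n) E i c t0 \in unitmx,
        forall t c, J t -> charts_at (gamma t) c ->
          velocity c J gamma t = \sum_i V i t *: E i c t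
      & forall t, J t ->
          mu t = oriented_integral (fun s => Num.sqrt (\sum_i V i s ^+ 2)) t0 t].

(* gamma' = gamma \o mu^-1, defined on mu(J). *)
Definition reparametrization (J : set R) (gamma : R -> M) (mu : R -> R)
    (gamma' : R -> M) : Prop :=
  set_inj J mu /\ forall t, J t -> gamma' (mu t) = gamma t.

(** * Pseudo-timelike curves and loops *)

(* A generalized affine parametrization lives on an interval, hence the maximal
   intervals J of parameters on which gamma stays in ML.  The reparametrization
   by mu is required to exist: a curve that comes to rest in ML does not satisfy
   the condition vacuously. *)
Definition pseudo_timelike g ML (a b : R) (gamma : R -> M) : Prop :=
  [/\ a < b,
      differentiable_curve `[a, b] gamma,
      (gamma @` `[a, b]) `&` ML !=set0
    & forall t J mu,
        (`[a, b] `&` gamma @^-1` ML) t ->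
        J = connected_component (`[a, b] `&` gamma @^-1` ML) t ->
        gen_affine_parameter g J gamma mu ->
        exists2 gamma', reparametrization J gamma mu gamma' &
          differentiable_curve (mu @` J) gamma' /\
          exists2 eps, 0 < eps &
            forall u c, (mu @` J) u -> charts_at (gamma' u) c ->
              gval g c (gamma' u) (velocity c (mu @` J) gamma' u)
                                  (velocity c (mu @` J) gamma' u) < - eps].

Definition timelike_velocity g (J : set R) (gamma : R -> M) (s : R) : Prop :=
  forall c, charts_at (gamma s) c ->
    gval g c (gamma s) (velocity c J gamma s) (velocity c J gamma s) < 0.

End SignatureChange.

Definition circle (R : realType) : set (R * R) :=
  [set x | x.1 ^+ 2 + x.2 ^+ 2 = 1].

Definition homeomorphic_sets {S T : topologicalType} (A : set S) (B : set T) :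
    Prop :=
  exists (f : S -> T) (f' : T -> S),
    [/\ {within A, continuous f} /\ {within B, continuous f'},
        f @` A `<=` B, f' @` B `<=` A,
        forall x, A x -> f' (f x) = x & forall y, B y -> f (f' y) = y].

Definition pseudo_timelike_loop {R : realType} {n : nat} {M : smoothManifold R n}
    (g : symTensor M) (ML : set M) (a b : R) (gamma : R -> M) : Prop :=
  [/\ pseudo_timelike g ML a b gamma,
      smooth_curve `[a, b] gamma,
      exists2 S : set M, S `<=` gamma @` `[a, b] &
        homeomorphic_sets S (@circle R)
    & exists s1 s2 : R,
        [/\ s1 \in `[a, b] /\ s2 \in `[a, b], s1 != s2, gamma s1 = gamma s2,
            timelike_velocity g `[a, b] gamma s1
          & timelike_velocity g `[a, b] gamma s2]].

(* Main.v *)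
From HB Require Import structures.
From mathcomp Require Import all_boot all_order all_algebra.
From mathcomp Require Import ring lra.
From mathcomp Require Import all_classical all_reals all_analysis.
(* Imported last, so that [coord] is the coordinate map of a chart. *)
Require Import Defs.
Import Order.TTheory GRing.Theory Num.Theory.
Import numFieldTopology.Exports numFieldNormedType.Exports.
Local Open Scope classical_set_scope.
Local Open Scope ring_scope.

(** Near a point [q] of the hypersurface [H] of signature change, the loop
    starts in the Lorentzian part, runs to [q] along a coordinate line in the
    radical direction, crosses [H], goes round a small circle in the
    Riemannian part, and then retraces its path.  The circle is the required
    topological circle, and the two end points of the parameter interval are
    mapped to the same point, where the two velocities are opposite timelike
    vectors.

    Let [w] be the radical direction at [q], with coordinates [x0].  Since
    [det g] vanishes on [H], its differential kills the tangent space of [H];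
    as the radical is transverse, it does not kill [w], and after a change of
    sign [det g] decreases along [w] ([radical_direction]).  So the line
    [x0 + t w] is Lorentzian for small [t > 0] and Riemannian for small [t < 0].

    The delicate point is that [g(gamma', gamma')] stays away from zero for a
    generalized affine parameter, although [N = - g(w, w)] tends to zero like [t]
    at [q].  If [E] is parallel along the line and [f = g(w, E)], then
    [f' = alpha(E)], where [alpha = g(D_w w, _)] is smooth up to [q].  Subtracting
    from [alpha] its multiple of [g(w, _)] with the same value on [w] gives a
    covector [beta], bounded up to [q] and zero on [w], such that
    [(f^2 / N)' = 2 f beta(E) / N].  The form [g], augmented by the square of the
    covector [m = g(w, _) / t], is uniformly positive definite up to [q]; as [m]
    vanishes on the [g]-orthogonal complement of [w], this gives
    [beta(u)^2 <= C (g(u, u) + g(w, u)^2 / N)] ([accel_estimate]).  Because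
    [g(E, E)] is constant, [y = f^2 / N] satisfies [|y'| <= D (1 + y) / sqrt t];
    the weight [1 / sqrt t] is integrable, so [y] is bounded
    ([quotient_bounded]).  Hence the components of the velocity in a
    parallel frame are bounded by a multiple of [sqrt N]
    ([frame_speed_bound]), which is the claim: after reparametrization
    [g(gamma', gamma')] is [- N] divided by the sum of the squares of these
    components.

    The curve is [x0 + a w + b e] in a chart, with [a] and [b] smooth functions
    built from the flat function [exp (-1/s)].  Its smoothness in the other
    charts rests on the fact that a map with continuous directional derivatives
    is differentiable ([C1_differentiable]). *)

Set Implicit Arguments.
Unset Strict Implicit.
Unset Printing Implicit Defensive.

(** * Continuously differentiable functions are differentiable *)

Section StrictPartial.
Context {R : realType} {V : normedModType R}.

Lemma is_derive_line (F : V -> R) (y v : V) (t : R) :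
  derivable F (y + t *: v) v ->
  is_derive t (1:R) (fun s : R => F (y + s *: v)) ('D_v F (y + t *: v)).
Proof.
move=> dF; have := derivableP dF.
have E : (fun h : R => h^-1 *: (F (y + (h *: 1 + t) *: v) - F (y + t *: v)))
   = (fun h : R => h^-1 *: (F (h *: v + (y + t *: v)) - F (y + t *: v))).
  apply/funext => h; congr (_ *: (F _ - _)).
  by rewrite [h *: 1]mulr1 scalerDl addrCA.
case=> ex dv; apply: DeriveDef.
  by rewrite /derivable/= E.
by rewrite /derive/= E.
Qed.

(** If the directional derivative along [v] is continuous at [x], the increments
    of [F] along [v] are controlled uniformly in the base point near [x]. *)
Lemma strict_partial (F : V -> R) (x v : V) :
  (\forall y \near x, derivable F y v) -> {for x, continuous ('D_v F)} ->
  forall e, 0 < e -> exists2 d, 0 < d & forall y a, `|y - x| < d -> `|a| < d ->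
    `|F (y + a *: v) - F y - a * 'D_v F x| <= e * `|a|.
Proof.
move=> dF cF e e0.
move/cvgrPdist_le : cF => /(_ _ e0) cF.
have [d /= d0 dP] : exists2 d, 0 < d & forall y, `|y - x| < d ->
    derivable F y v /\ `|'D_v F x - 'D_v F y| <= e.
  have : \forall y \near x, derivable F y v /\ `|'D_v F x - 'D_v F y| <= e.
    by near=> y; split; near: y.
  move=> /nbhs_ballP[d /= d0 dP]; exists d => // y yd; apply: dP.
  by rewrite -ball_normE /= distrC.
have v1 : 0 < 1 + `|v| by rewrite ltr_pwDl.
have d'0 : 0 < d / 2 / (1 + `|v|) by rewrite !divr_gt0.
have d'd : d / 2 / (1 + `|v|) <= d / 2.
  by rewrite ler_pdivrMr// ler_peMr ?lerDl// divr_ge0// ltW.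
exists (d / 2 / (1 + `|v|)) => // y a yx a_d.
have near_d (s : R) : `|s| <= `|a| -> `|y + s *: v - x| < d.
  move=> sa; rewrite addrAC (le_lt_trans (ler_normD _ _))// [d]splitr.
  rewrite ltr_leD ?(lt_le_trans yx)// normrZ.
  have /ltW := le_lt_trans sa a_d; rewrite ler_pdivlMr// mulrDr mulr1.
  by have := normr_ge0 s; lra.
have dL (s : R) : `|s| <= `|a| ->
    is_derive s (1:R) (fun s : R => F (y + s *: v)) ('D_v F (y + s *: v)).
  by move=> sa; apply: is_derive_line; have [] := dP _ (near_d _ sa).
have key (lo hi : R) : lo < hi -> (forall s, lo <= s <= hi -> `|s| <= `|a|) ->
    `|F (y + hi *: v) - F (y + lo *: v) - (hi - lo) * 'D_v F x| <= e * (hi - lo).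
  move=> lohi lh.
  have [||c] := @MVT _ (fun s : R => F (y + s *: v))
    (fun s : R => 'D_v F (y + s *: v)) lo hi lohi.
  - by move=> s; rewrite in_itv/= => /andP[s0 s1]; apply/dL/lh; rewrite !ltW.
  - apply: derivable_within_continuous => s; rewrite in_itv/= => sI.
    by have [] := dL _ (lh _ sI).
  rewrite in_itv/= => /andP[c0 c1] ->.
  rewrite [X in X - _]mulrC -mulrBr normrM mulrC (gtr0_norm (_ : 0 < hi - lo)) ?subr_gt0//.
  rewrite ler_pM2r ?subr_gt0// distrC.
  by have [] := dP _ (near_d c _) => //; apply: lh; rewrite !ltW.
have [a0|a0|->] := ltgtP a 0.
- have := key a 0 a0; rewrite scale0r addr0 sub0r.
  have -> : F y - F (y + a *: v) - - a * 'D_v F x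
     = - (F (y + a *: v) - F y - a * 'D_v F x) by ring.
  rewrite normrN (ltr0_norm a0); apply.
  by move=> s /andP[s0 s1]; rewrite ler0_norm// lerN2.
- have := key 0 a a0; rewrite scale0r addr0 subr0 (gtr0_norm a0); apply.
  by move=> s /andP[s0 s1]; rewrite ger0_norm.
- by rewrite scale0r addr0 subrr mul0r subr0 normr0 mulr0.
Unshelve. all: by end_near. Qed.

End StrictPartial.

Lemma near_eq_continuous {S T : topologicalType} (f g : S -> T) x :
  (\forall y \near x, f y = g y) -> {for x, continuous f} -> {for x, continuous g}.
Proof.
move=> fg cf; have fgx := nbhs_singleton fg.
rewrite /prop_for/continuous_at -fgx; apply: cvg_trans cf.
exact: near_eq_cvg.
Qed.

Section C1Differentiable.
Context {R : realType} {n : nat}.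

Lemma le_coord_norm (h : 'rV[R]_n) i : `|h 0 i| <= `|h|.
Proof.
by rewrite [leRHS]/Num.Def.normr/= mx_normrE (le_bigmax _ _ (0, i)).
Qed.

Lemma differentiable_partials (F : 'rV[R]_n -> R) (x : 'rV[R]_n) :
  (forall i, \forall y \near x, derivable F y 'e_i) ->
  (forall i, {for x, continuous ('D_'e_i F)}) -> differentiable F x.
Proof.
move=> dF cF.
pose L (h : 'rV[R]_n) : R := (h *m \col_i 'D_'e_i F x) 0 0.
have Lsum h : L h = \sum_i h 0 i * 'D_'e_i F x.
  by rewrite /L mxE; apply: eq_bigr => i _; rewrite mxE.
have Llin : linear L by move=> a u w; rewrite /L mulmxDl -scalemxAl !mxE.
pose LM := GRing.isLinear.Build _ _ _ _ L Llin.
pose Lf : {linear 'rV[R]_n -> R} := HB.pack L LM.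
have Lc : continuous Lf.
  move=> u; apply: differentiable_continuous.
  rewrite (_ : (Lf : _ -> _) =
      \sum_(i < n) (fun h : 'rV[R]_n => h 0 i * 'D_'e_i F x)); last first.
    by apply/funext => h; rewrite /Lf/= Lsum fct_sumE.
  apply: differentiable_sum => i.
  apply: differentiableM; last exact: differentiable_cst.
  exact: differentiable_coord.
(* the increments along the axes of s are made one after the other *)
have tele (s : seq 'I_n) e : 0 < e -> exists2 d, 0 < d & forall h : 'rV[R]_n,
    `|h| < d -> `|F (x + \sum_(i <- s) h 0 i *: 'e_i) - F x
               - \sum_(i <- s) h 0 i * 'D_'e_i F x| <= e * `|h|.
  elim: s e => [|i s IH] e e0.
    exists 1 => // h _; rewrite !big_nil addr0 subrr subr0 normr0.
    by rewrite mulr_ge0// ltW.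
  have e2 : 0 < e / 2 by rewrite divr_gt0.
  have [d1 d10 P1] := IH _ e2.
  have [d2 d20 P2] := strict_partial (dF i) (cF i) e2.
  pose C := 1 + \sum_(i <- s) `|'e_i : 'rV[R]_n|.
  have C0 : 0 < C by rewrite ltr_pwDl// sumr_ge0.
  exists (Num.min d1 (Num.min d2 (d2 / C))).
    by rewrite !lt_min d10 d20 divr_gt0.
  move=> h; rewrite !lt_min => /and3P[hd1 hd2]; rewrite ltr_pdivlMr// => hd3.
  rewrite !big_cons.
  set S := \sum_(j <- s) _ *: _; set T := \sum_(j <- s) _.
  have Sx : `|x + S - x| < d2.
    rewrite addrAC subrr add0r; apply: le_lt_trans hd3.
    apply: le_trans (ler_norm_sum _ _ _) _.
    rewrite /C mulrDr mulr1 mulr_sumr ler_wpDl//.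
    by apply: ler_sum => j _; rewrite normrZ ler_wpM2r// le_coord_norm.
  have hi := le_coord_norm h i.
  have := P2 (x + S) (h 0 i) Sx (le_lt_trans hi hd2).
  have := P1 h hd1; rewrite -/S -/T => Q1 Q2.
  rewrite [h 0 i *: _ + S]addrC [x + (_ + _)]addrA.
  set a := h 0 i * _ in Q2 *.
  set F2 := F (x + S + _) in Q2 *.
  rewrite (_ : _ - _ = (F2 - F (x + S) - a) + (F (x + S) - F x - T)); last first.
    by ring.
  rewrite (le_trans (ler_normD _ _))// [e]splitr mulrDl lerD//.
  by rewrite (le_trans Q2)// ler_wpM2l// ltW.
have Lo : (F : _ -> R^o) \o shift x = cst (F x : R^o) + (Lf : _ -> R^o) +o_ (0 : 'rV[R]_n) id.
  apply/eqaddoP => e e0.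
  have [d d0 P] := tele (index_enum 'I_n) e e0.
  apply/nbhs_ballP; exists d => //= h; rewrite -ball_normE /= sub0r normrN => hd.
  have := P h hd; rewrite -Lsum -row_sum_delta [x + _]addrC.
  by rewrite !fctE /cst /Lf /= opprD addrA.
have dE := diff_unique Lc Lo.
by apply/diff_locallyP; split; rewrite dE.
Qed.

Lemma differentiable_mx {V : normedModType R} {p q : nat} (F : V -> 'M[R]_(p, q)) x :
  (forall i j, differentiable (fun y => F y i j) x) -> differentiable F x.
Proof.
move=> dF.
rewrite (_ : F = \sum_(i < p) \sum_(j < q) (fun y => F y i j *: delta_mx i j)).
  apply: differentiable_sum => i; apply: differentiable_sum => j.
  exact: differentiableZl.
apply/funext => y; rewrite {1}(matrix_sum_delta (F y)) fct_sumE.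
by apply: eq_bigr => i _; rewrite fct_sumE.
Qed.

Lemma derive_entry {V : normedModType R} {p q : nat} (F : V -> 'M[R]_(p, q)) x v i j :
  derivable F x v -> 'D_v (fun y => F y i j) x = 'D_v F x i j.
Proof. by move=> dF; rewrite derive_mx// mxE. Qed.

Lemma continuous_entry {T : topologicalType} {p q : nat} (F : T -> 'M[R]_(p, q)) x i j :
  {for x, continuous F} -> {for x, continuous (fun y => F y i j)}.
Proof.
move=> cF; apply: (@continuous_comp _ _ _ F (fun N : 'M[R]_(p, q) => N i j)) => //.
exact: coord_continuous.
Qed.

(** Maps with continuous directional derivatives are differentiable; applied to
    the metric and to the transition maps. *)
Lemma C1_differentiable {p q : nat} (U : set 'rV[R]_n) (F : 'rV[R]_n -> 'M[R]_(p, q)) x :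
  open U -> U x -> Ck_on 1 U F -> differentiable F x.
Proof.
move=> oU Ux [_ dF]; apply: differentiable_mx => i j.
have Unear : \forall y \near x, U y by apply: open_nbhs_nbhs.
apply: differentiable_partials => k.
  apply: filterS Unear => y Uy.
  by have [/(_ y Uy) /derivable_mxP D _] := dF 'e_k; exact: D.
have [dk [ck _]] := dF 'e_k.
have cD := @continuous_entry _ _ _ _ _ i j (ck x Ux).
apply: near_eq_continuous cD.
by apply: filterS Unear => y Uy; rewrite (derive_entry _ _ (dk y Uy)).
Qed.

End C1Differentiable.

(** * Derivatives relative to a set of parameters *)

Section WithinDerivative.
Context {R : realType}.
Implicit Types (K J : set R) (t s : R).

(** [f] has derivative [l] at [t] relative to [K]. *)
Definition has_wderiv {W : normedModType R} K (f : R -> W) t (l : W) : Prop :=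
  diff_quot f t @ within K t^' --> l.

(** Every point of [K] is a limit of other points of [K]. *)
Definition no_isolated K : Prop := forall t, K t -> ProperFilter (within K t^').

Lemma within_dnbhsP K t (P : set R) : within K t^' P <->
  exists2 d, 0 < d & forall s, `|s - t| < d -> K s -> s != t -> P s.
Proof.
split.
  move=> /nbhs_ballP[d /= d0 dP]; exists d => // s sd Ks st.
  by apply: dP => //; rewrite -ball_normE /= distrC.
move=> [d d0 dP]; apply/nbhs_ballP; exists d => //= s.
by rewrite -ball_normE /= distrC => sd st Ks; exact: dP.
Qed.

Lemma within_nbhsP K t (P : set R) : within K (nbhs t) P <->
  exists2 d, 0 < d & forall s, `|s - t| < d -> K s -> P s.
Proof.
split.
  move=> /nbhs_ballP[d /= d0 dP]; exists d => // s sd Ks.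
  by apply: dP => //; rewrite -ball_normE /= distrC.
move=> [d d0 dP]; apply/nbhs_ballP; exists d => //= s.
by rewrite -ball_normE /= distrC => sd Ks; exact: dP.
Qed.

Lemma no_isolatedP K : no_isolated K <->
  forall t d, K t -> 0 < d -> exists s, [/\ `|s - t| < d, K s & s != t].
Proof.
split=> [H t d Kt d0|H t Kt].
  have FF := H t Kt.
  have : within K t^' [set s | [/\ `|s - t| < d, K s & s != t]].
    by apply/within_dnbhsP; exists d.
  by move=> /filter_ex[s]; exists s.
apply: Build_ProperFilter_ex => P /within_dnbhsP[d d0 dP].
by have [s [sd Ks st]] := H t d Kt d0; exists s; exact: dP.
Qed.

Section Normed.
Context {W : normedModType R}.
Implicit Types (f g : R -> W).

Lemma has_wderivP K f t l : has_wderiv K f t l <->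
  forall e, 0 < e -> exists2 d, 0 < d & forall s, `|s - t| < d -> K s -> s != t ->
    `|l - (s - t)^-1 *: (f s - f t)| <= e.
Proof.
split=> [/cvgrPdist_le H e /H /within_dnbhsP//|H].
by apply/cvgrPdist_le => e /H He; apply/within_dnbhsP.
Qed.

Lemma is_derive_has_wderiv K f t l : is_derive t (1 : R) f l -> has_wderiv K f t l.
Proof.
move=> [df <-]; apply/has_wderivP => e e0.
have /cvgrPdist_le /(_ e e0) /nbhs_ballP[d /= d0 dP] := df.
exists d => // s sd _ st.
have /= := dP (s - t); rewrite -ball_normE /= sub0r normrN subr_eq0 => /(_ sd st).
by rewrite [(s - t) *: _]mulr1 subrK.
Qed.

Lemma has_wderiv_is_derive K f t l : nbhs t K -> has_wderiv K f t l ->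
  is_derive t (1 : R) f l.
Proof.
move=> /nbhs_ballP[r /= r0 rK] /has_wderivP H.
have dcv : (fun h : R => h^-1 *: ((f \o shift t) (h *: 1) - f t)) @ 0^' --> l.
  apply/cvgrPdist_le => e e0; have [d d0 dP] := H e e0.
  apply/nbhs_ballP; exists (Num.min d r); first by rewrite /= lt_min d0.
  move=> h; rewrite -ball_normE /= sub0r normrN lt_min => /andP[hd hr] h0.
  have := dP (h + t); rewrite addrK => /(_ hd).
  rewrite [h *: 1]mulr1; apply.
    by apply: rK; rewrite -ball_normE /= opprD addrCA subrr addr0 normrN.
  by rewrite -subr_eq0 addrK.
apply: DeriveDef; first by apply/cvg_ex; exists l.
exact: cvg_lim dcv.
Qed.

Lemma eq_has_wderiv K f g t l : (forall s, K s -> f s = g s) -> K t ->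
  has_wderiv K f t l -> has_wderiv K g t l.
Proof.
move=> fg Kt /has_wderivP H; apply/has_wderivP => e /H[d d0 dP].
by exists d => // s sd Ks st; rewrite -!fg//; exact: dP.
Qed.

Lemma has_wderiv_wderivable K f t l : has_wderiv K f t l -> wderivable K f t.
Proof. by move=> H; apply/cvg_ex; exists l. Qed.

Lemma has_wderiv_wderive K f t l : no_isolated K -> K t -> has_wderiv K f t l ->
  wderive K f t = l.
Proof. by move=> nK Kt H; have FF := nK t Kt; exact: cvg_lim H. Qed.

Lemma wderivable_has_wderiv K f t : wderivable K f t ->
  has_wderiv K f t (wderive K f t).
Proof. by []. Qed.

Lemma has_wderiv_cvg K f t l : has_wderiv K f t l -> f @ within K (nbhs t) --> f t.
Proof.
move=> /has_wderivP H; apply/cvgrPdist_le => e e0.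
have [d d0 dP] := H 1 ltr01.
have C0 : 0 < `|l| + 1 by rewrite ltr_wpDl.
apply/within_nbhsP; exists (Num.min d (e / (`|l| + 1))).
  by rewrite lt_min d0 divr_gt0.
move=> s; rewrite lt_min => /andP[sd]; rewrite ltr_pdivlMr// => se Ks.
have [->|st] := eqVneq s t; first by rewrite subrr normr0 ltW.
have st0 : s - t != 0 by rewrite subr_eq0.
have := dP s sd Ks st; set D := _ *: _ => lD.
have -> : f t - f s = - ((s - t) *: D).
  by rewrite /D scalerA mulfV// scale1r opprB.
rewrite normrN normrZ (le_trans _ (ltW se))// ler_wpM2l//.
have -> : D = l - (l - D) by rewrite opprB addrC subrK.
by rewrite (le_trans (ler_normB _ _))// lerD2l.
Qed.

Lemma within_continuousP {T : topologicalType} K (f : R -> T) :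
  {within K, continuous f} <-> forall t, K t -> f @ within K (nbhs t) --> f t.
Proof.
by split=> [/subspace_continuousP H|H]; [move=> t /H | apply/subspace_continuousP].
Qed.

Lemma has_wderiv_continuous K f (df : R -> W) :
  (forall t, K t -> has_wderiv K f t (df t)) -> {within K, continuous f}.
Proof. by move=> H; apply/within_continuousP => t /H /has_wderiv_cvg. Qed.

Lemma has_wderivD K f g t l m : has_wderiv K f t l -> has_wderiv K g t m ->
  has_wderiv K (fun s => f s + g s) t (l + m).
Proof.
move=> H1 H2; rewrite /has_wderiv.
have -> : diff_quot (fun s => f s + g s) t =
    (fun s => diff_quot f t s + diff_quot g t s); last exact: cvgD.
apply/funext => s.
by rewrite /diff_quot -scalerDr opprD addrACA.
Qed.

End Normed.

Lemma has_wderivZ {W : normedModType R} K (p : R -> R) (f : R -> W) t a l :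
  has_wderiv K p t a -> has_wderiv K f t l ->
  has_wderiv K (fun s => p s *: f s) t (a *: f t + p t *: l).
Proof.
move=> H1 H2.
have pc : p @ within K t^' --> p t.
  have := has_wderiv_cvg H1; apply: cvg_trans; apply: cvg_app.
  move=> P /within_nbhsP[d d0 dP].
  by apply/within_dnbhsP; exists d => // s sd Ks _; exact: dP.
rewrite /has_wderiv.
have -> : diff_quot (fun s => p s *: f s) t =
    (fun s => diff_quot p t s *: f t + p s *: diff_quot f t s); last first.
  by apply: cvgD; apply: cvgZ => //; exact: cvg_cst.
apply/funext => s.
rewrite /diff_quot [_ *: (p s - p t)]/(_ * _) -scalerA scalerBl.
rewrite [p s *: (_ *: _)]scalerA [p s * _]mulrC -scalerA -scalerDr; congr (_ *: _).
by rewrite scalerBr [RHS]addrC addrA subrK.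
Qed.

Lemma has_wderiv_cst {W : normedModType R} K (c : W) t : has_wderiv K (fun=> c) t 0.
Proof. exact: is_derive_has_wderiv. Qed.

Lemma has_wderivM K (p q : R -> R) t a b :
  has_wderiv K p t a -> has_wderiv K q t b ->
  has_wderiv K (fun s => p s * q s) t (a * q t + p t * b).
Proof. exact: has_wderivZ. Qed.

Lemma has_wderiv_mxP K {m n : nat} (F : R -> 'M[R]_(m, n)) t l :
  has_wderiv K F t l <-> forall i j, has_wderiv K (fun s => F s i j) t (l i j).
Proof.
split=> [/has_wderivP H i j|H].
  apply/has_wderivP => e /H[d d0 dP]; exists d => // s sd Ks st.
  apply: le_trans (dP s sd Ks st); rewrite [leRHS]/Num.Def.normr/= mx_normrE.
  by apply: le_trans (le_bigmax _ _ (i, j)); rewrite /= !mxE.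
apply/cvgrPdist_le => /= e e0; near=> x.
rewrite /Num.Def.normr/= mx_normrE (bigmax_le _ (ltW e0))//= => i _.
rewrite !mxE/=; move: i; near: x; apply: filter_forall => /= i.
exact: ((cvgrPdist_le _ _).1 (H i.1 i.2)).
Unshelve. all: by end_near. Qed.

Lemma has_wderiv_sum K {W : normedModType R} (I : Type) (r : seq I)
    (f : I -> R -> W) t (l : I -> W) :
  (forall i, has_wderiv K (f i) t (l i)) ->
  has_wderiv K (fun s => \sum_(i <- r) f i s) t (\sum_(i <- r) l i).
Proof.
move=> H; elim: r => [|i r IH].
  rewrite big_nil (_ : (fun _ => _) = (fun=> 0)); first exact: has_wderiv_cst.
  by apply/funext => s; rewrite big_nil.
rewrite big_cons (_ : (fun _ => _) = (fun s => f i s + \sum_(j <- r) f j s)).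
  exact: has_wderivD.
by apply/funext => s; rewrite big_cons.
Qed.

Lemma has_wderiv_mulmx K {m n p : nat} (A : R -> 'M[R]_(m, n)) (B : R -> 'M[R]_(n, p))
    t A' B' :
  has_wderiv K A t A' -> has_wderiv K B t B' ->
  has_wderiv K (fun s => A s *m B s) t (A' *m B t + A t *m B').
Proof.
move=> /has_wderiv_mxP HA /has_wderiv_mxP HB; apply/has_wderiv_mxP => i j.
rewrite (_ : (fun _ => _) = (fun s => \sum_k A s i k * B s k j)); last first.
  by apply/funext => s; rewrite mxE.
rewrite !mxE -big_split/=; apply: has_wderiv_sum => k.
exact: has_wderivM.
Qed.

Lemma has_wderiv_tr K {m n : nat} (A : R -> 'M[R]_(m, n)) t A' :
  has_wderiv K A t A' -> has_wderiv K (fun s => (A s)^T) t A'^T.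
Proof.
move=> /has_wderiv_mxP HA; apply/has_wderiv_mxP => i j.
rewrite (_ : (fun _ => _) = (fun s => A s j i)) ?mxE//.
by apply/funext => s; rewrite mxE.
Qed.

(** Chain rule: [F] need only be differentiable at the point. *)
Lemma is_derive_comp_diff {V W : normedModType R} (F : V -> W) (x : R -> V) t v :
  is_derive t (1 : R) x v -> differentiable F (x t) ->
  is_derive t (1 : R) (fun s => F (x s)) ('D_v F (x t)).
Proof.
move=> [dx <-] dF.
have dx' : differentiable x t by apply/derivable1_diffP.
have dc : differentiable (F \o x) t by exact: differentiable_comp.
apply: DeriveDef; first by apply: diff_derivable.
by rewrite deriveE// diff_comp//= -!deriveE.
Qed.

End WithinDerivative.

(** * Smooth real functions and the flat exponential *)

Section SmoothFunctions.
Context {R : realType}.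
Implicit Types (p q : R -> R) (k m : nat).

(** [p] can be differentiated [k] times on the whole real line. *)
Fixpoint times_derivable k p : Prop :=
  if k is k'.+1 then
    exists2 q, (forall s, is_derive s (1 : R) p (q s)) & times_derivable k' q
  else True.

(** Infinitely differentiable functions on the whole real line. *)
Definition smooth_fun p : Prop := forall k, times_derivable k p.

Lemma times_derivableW k p : times_derivable k.+1 p -> times_derivable k p.
Proof.
elim: k p => [//|k IH] p [q pq Hq]; exists q => //; exact: IH.
Qed.

Lemma smooth_fun_derive p : smooth_fun p ->
  exists2 q, (forall s, is_derive s (1 : R) p (q s)) & smooth_fun q.
Proof.
move=> sp; have [q pq _] := sp 1%N; exists q => // k.
have [q' pq' Hq'] := sp k.+1; suff -> : q = q' by [].
by apply/funext => s; rewrite -(@derive_val _ _ _ _ _ _ _ (pq s)) derive_val.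
Qed.

Lemma smooth_fun_cst (c : R) : smooth_fun (fun=> c).
Proof.
move=> k; elim: k c => [//|k IH] c; exists (fun=> 0) => // s.
exact: is_derive_cst.
Qed.

Lemma smooth_fun_id : smooth_fun id.
Proof.
case=> [//|k]; exists (fun=> 1); first by move=> s; exact: is_derive_id.
exact: smooth_fun_cst.
Qed.

Lemma times_derivableD k p q : times_derivable k p -> times_derivable k q ->
  times_derivable k (fun s => p s + q s).
Proof.
elim: k p q => [//|k IH] p q [p' pp' Hp] [q' qq' Hq].
by exists (fun s => p' s + q' s); [move=> s; exact: is_deriveD|exact: IH].
Qed.

Lemma smooth_funD p q : smooth_fun p -> smooth_fun q ->
  smooth_fun (fun s => p s + q s).
Proof. by move=> sp sq k; exact: times_derivableD. Qed.

Lemma times_derivableM k p q : times_derivable k p -> times_derivable k q ->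
  times_derivable k (fun s => p s * q s).
Proof.
elim: k p q => [//|k IH] p q Hp Hq.
have [p' pp' Hp'] := Hp; have [q' qq' Hq'] := Hq.
exists (fun s => p s * q' s + q s * p' s).
  by move=> s; exact: is_deriveM.
by apply: times_derivableD; apply: IH => //; exact: times_derivableW.
Qed.

Lemma smooth_funM p q : smooth_fun p -> smooth_fun q ->
  smooth_fun (fun s => p s * q s).
Proof. by move=> sp sq k; exact: times_derivableM. Qed.

Lemma smooth_fun_comp p q : smooth_fun p -> smooth_fun q ->
  smooth_fun (fun s => p (q s)).
Proof.
move=> sp sq k; elim: k p sp => [//|k IH] p sp.
have [p' pp' sp'] := smooth_fun_derive sp.
have [q' qq' sq'] := smooth_fun_derive sq.
exists (fun s => p' (q s) * q' s).
  by move=> s; exact: (@is_derive1_comp _ p q).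
by apply: times_derivableM => //; exact: IH.
Qed.

Lemma smooth_fun_cos_sin : smooth_fun (@cos R) /\ smooth_fun (@sin R).
Proof.
suff H k : times_derivable k (@cos R) /\ times_derivable k (@sin R).
  by split=> k; have [] := H k.
elim: k => [//|k [IHc IHs]]; split.
  exists (fun s => -1 * sin s).
    by move=> s; rewrite mulN1r; exact: is_derive_cos.
  by apply: times_derivableM => //; exact: smooth_fun_cst.
by exists cos => // s; exact: is_derive_sin.
Qed.

(** [flat m] is [s^-m * exp (-1/s)] for positive [s], and [0] elsewhere. *)
Definition flat m (s : R) : R := if 0 < s then s^-1 ^+ m * expR (- s^-1) else 0.

(** The exponential beats the powers of [1/s]; this makes all derivatives of
    [flat m] vanish at [0]. *)
Lemma flat_le m s : `|flat m s| <= m.+1`!%:R * `|s|.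
Proof.
rewrite /flat; case: ifPn => [s0|_]; last by rewrite normr0 mulr_ge0.
have y0 : 0 < s^-1 by rewrite invr_gt0.
rewrite ger0_norm; last by rewrite mulr_ge0 ?exprn_ge0 ?expR_ge0 ?ltW.
rewrite (gtr0_norm s0) expRN ler_pdivrMr ?expR_gt0//.
have f0 : 0 < m.+1`!%:R :> R by rewrite ltr0n fact_gt0.
have H : s^-1 ^+ m.+1 / m.+1`!%:R <= expR s^-1.
  by apply: le_trans (@expR_ge1Dxn R s^-1 m (ltW y0)); rewrite lerDr.
apply: le_trans (ler_wpM2l (ltW (mulr_gt0 f0 s0)) H).
rewrite le_eqVlt; apply/orP; left; apply/eqP; rewrite exprS; field.
by rewrite !gt_eqF.
Qed.

Lemma flat_derive m s :
  is_derive s (1 : R) (flat m) (- m%:R * flat m.+1 s + flat m.+2 s).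
Proof.
have [s0|s0|->] := ltgtP s 0.
- apply: (@near_eq_is_derive _ _ _ (fun=> 0)).
    near=> t; rewrite /flat ltNge ltW//; near: t; exact: lt_nbhsl.
  by rewrite /flat !ltNge !(ltW s0)/= mulr0 addr0; exact: is_derive_cst.
- apply: (@near_eq_is_derive _ R R (fun t : R => t^-1 ^+ m * expR (- t^-1))).
    by near=> t; rewrite /flat ifT//; near: t; exact: lt_nbhsr.
  have sn0 : s != 0 by rewrite gt_eqF.
  have dV : is_derive s (1 : R) (fun t : R => t^-1) (- s^-1 ^+ 2).
    have := @is_deriveV R (fun t => t) s 1 1 sn0 (is_derive_id _ _).
    by rewrite [_ *: 1]mulr1 exprVn.
  have dE : is_derive s (1 : R) (fun t : R => expR (- t^-1))
      (expR (- s^-1) * s^-1 ^+ 2).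
    apply: (@is_derive1_comp _ expR (fun t => - t^-1)).
    by rewrite -[X in is_derive _ _ _ X]opprK; exact: is_deriveN.
  have dX : is_derive s (1 : R) (fun t : R => t^-1 ^+ m)
      (m%:R * s^-1 ^+ m.-1 * - s^-1 ^+ 2).
    have := is_deriveX m dV.
    by rewrite (_ : (fun t : R => t^-1) ^+ m = (fun t : R => t^-1 ^+ m))// exprfctE.
  have D := is_deriveM dX dE; apply: (is_derive_eq D).
  have scE (a b : R) : a *: b = a * b by [].
  rewrite /flat s0 !scE.
  case: m {dX D} => [|m]; first by rewrite !exprS expr0; ring.
  by rewrite [m.+1.-1]/= !exprS; ring.
- apply: (@has_wderiv_is_derive _ _ setT); first exact: filterT.
  rewrite {2 3}/flat ltxx mulr0 addr0.
  apply/has_wderivP => e e0.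
  have f0 : 0 < m.+2`!%:R :> R by rewrite ltr0n fact_gt0.
  exists (e / m.+2`!%:R); first by rewrite divr_gt0.
  move=> t; rewrite subr0 sub0r {2}/flat ltxx subr0 normrN => te _ t0.
  have -> : t^-1 *: flat m t = flat m.+1 t.
    rewrite /flat; case: ifP => _; last by rewrite scaler0.
    by rewrite [_ *: _]mulrA exprS.
  rewrite (le_trans (flat_le _ _))//.
  by move: te; rewrite ltr_pdivlMr// mulrC => /ltW.
Unshelve. all: by end_near. Qed.

Lemma smooth_flat m : smooth_fun (flat m).
Proof.
move=> k; elim: k m => [//|k IH] m.
exists (fun s => - m%:R * flat m.+1 s + flat m.+2 s); first exact: flat_derive.
by apply: times_derivableD => //; apply: times_derivableM => //; exact: smooth_fun_cst.
Qed.

Lemma smooth_fun_continuous p : smooth_fun p -> continuous p.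
Proof.
move=> /smooth_fun_derive[q pq _] s.
by apply: differentiable_continuous; apply/derivable1_diffP; exact: ex_derive.
Qed.

End SmoothFunctions.

(** * Smoothness of a map along a smooth planar curve *)

Section SmoothAlongCurve.
Context {R : realType}.
Implicit Types (K : set R).

Lemma eq_Ck_within {W : normedModType R} k K (f g : R -> W) :
  no_isolated K -> (forall s, K s -> f s = g s) ->
  Ck_within k K f -> Ck_within k K g.
Proof.
move=> nK; elim: k f g => [|k IH] f g fg [cf Hf].
  split=> //; apply: subspace_eq_continuous cf => s; rewrite inE; exact: fg.
split; first by apply: subspace_eq_continuous cf => s; rewrite inE; exact: fg.
have [df Cf] := Hf.
have dg s : K s -> has_wderiv K g s (wderive K f s).
  by move=> Ks; apply: (eq_has_wderiv fg) => //; exact/wderivable_has_wderiv/df.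
split; first by move=> s /dg /has_wderiv_wderivable.
by apply: IH Cf => s Ks; rewrite (has_wderiv_wderive nK Ks (dg s Ks)).
Qed.

Lemma Ck_within_add {W : normedModType R} k K (f g : R -> W) :
  no_isolated K -> Ck_within k K f -> Ck_within k K g ->
  Ck_within k K (fun s => f s + g s).
Proof.
move=> nK; elim: k f g => [|k IH] f g [cf Hf] [cg Hg].
  by split=> // s; apply: continuousD; [exact: cf|exact: cg].
split; first by move=> s; apply: continuousD; [exact: cf|exact: cg].
have [df Cf] := Hf; have [dg Cg] := Hg.
have dfg s : K s -> has_wderiv K (fun s => f s + g s) s
    (wderive K f s + wderive K g s).
  by move=> Ks; apply: has_wderivD; apply/wderivable_has_wderiv; [exact: df|exact: dg].
split; first by move=> s /dfg /has_wderiv_wderivable.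
apply: eq_Ck_within (IH _ _ Cf Cg) => // s Ks.
by rewrite (has_wderiv_wderive nK Ks (dfg s Ks)).
Qed.

Lemma Ck_onW {V W : normedModType R} k (U : set V) (f : V -> W) :
  Ck_on k.+1 U f -> Ck_on k U f.
Proof.
elim: k f => [|k IH] f [cf Hf]; split=> // v.
by have [dv Cv] := Hf v; split=> //; exact: IH.
Qed.

Lemma Ck_on1 {V W : normedModType R} k (U : set V) (f : V -> W) :
  Ck_on k.+1 U f -> Ck_on 1 U f.
Proof. by elim: k f => [//|k IH] f /Ck_onW /IH. Qed.

Context {n p q : nat}.
Variables (x0 w e : 'rV[R]_n) (a b : R -> R).
Hypotheses (sa : smooth_fun a) (sb : smooth_fun b).

Let x (s : R) : 'rV[R]_n := x0 + a s *: w + b s *: e.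

Lemma is_derive_planar (a' b' : R) s :
  is_derive s (1 : R) a a' -> is_derive s (1 : R) b b' ->
  is_derive s (1 : R) x (a' *: w + b' *: e).
Proof.
move=> da db; apply: (@has_wderiv_is_derive _ _ setT); first exact: filterT.
have lin (c : R -> R) c' (v : 'rV[R]_n) : is_derive s (1 : R) c c' ->
    has_wderiv setT (fun t => c t *: v) s (c' *: v).
  move=> dc; rewrite -[c' *: v]addr0 -(scaler0 _ (c s)).
  by apply: has_wderivZ; [exact: is_derive_has_wderiv|exact: has_wderiv_cst].
rewrite -[a' *: w]add0r.
by apply: has_wderivD; [apply: has_wderivD; [exact: has_wderiv_cst|exact: lin]|exact: lin].
Qed.

Lemma planar_continuous : continuous x.
Proof.
move=> s; have [a' da _] := smooth_fun_derive sa.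
have [b' db _] := smooth_fun_derive sb.
apply: differentiable_continuous; apply/derivable1_diffP.
by have [] := is_derive_planar (da s) (db s).
Qed.

(** The composite of a [C^k] map with the curve [x0 + a w + b e].  The induction
    is carried out for its product with an arbitrary smooth function, a class
    that is stable under differentiation. *)
Lemma Ck_within_planar k K (U : set 'rV[R]_n) (F : 'rV[R]_n -> 'M[R]_(p, q)) :
  open U -> no_isolated K -> (forall s, K s -> U (x s)) -> Ck_on k U F ->
  Ck_within k K (fun s => F (x s)).
Proof.
move=> oU nK KU CF.
suff H (r : R -> R) : smooth_fun r -> Ck_within k K (fun s => r s *: F (x s)).
  by apply: eq_Ck_within (H _ (smooth_fun_cst 1)) => // s _; rewrite scale1r.
elim: k F CF r => [|k IH] F CF r sr.
all: have cont : {within K, continuous (fun s => r s *: F (x s))}.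
1,3: by apply/within_continuousP => s Ks; apply: cvg_within_filter;
  apply: cvgZ; [exact: smooth_fun_continuous|];
  apply: (@continuous_comp _ _ _ x F); [exact: planar_continuous|exact: (proj1 CF) (KU s Ks)].
  by split.
split=> //.
have [r' dr sr'] := smooth_fun_derive sr.
have [a' da sa'] := smooth_fun_derive sa.
have [b' db sb'] := smooth_fun_derive sb.
have dd s : K s -> has_wderiv K (fun s => r s *: F (x s)) s
  (r' s *: F (x s) + ((r s * a' s) *: 'D_w F (x s) + (r s * b' s) *: 'D_e F (x s))).
  move=> Ks; have dF := C1_differentiable oU (KU s Ks) (Ck_on1 CF).
  have := is_derive_comp_diff (is_derive_planar (da s) (db s)) dF.
  rewrite deriveE// linearD !linearZ/= -!deriveE// => /(is_derive_has_wderiv K) D.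
  have := has_wderivZ (is_derive_has_wderiv K (dr s)) D.
  by rewrite scalerDr !scalerA.
split; first by move=> s /dd /has_wderiv_wderivable.
have [_ HD] := CF; have [_ Cw] := HD w; have [_ Ce] := HD e.
apply: (@eq_Ck_within _ _ _ (fun s => r' s *: F (x s) +
   ((r s * a' s) *: 'D_w F (x s) + (r s * b' s) *: 'D_e F (x s)))) => //.
  by move=> s Ks; rewrite (has_wderiv_wderive nK Ks (dd s Ks)).
apply: Ck_within_add => //; first exact: (IH _ (Ck_onW CF) _ sr').
apply: Ck_within_add => //.
  exact: (IH _ Cw _ (smooth_funM sr sa')).
exact: (IH _ Ce _ (smooth_funM sr sb')).
Qed.

End SmoothAlongCurve.

(** * Bilinear forms, determinants and limits of matrices *)

Section BilinearForms.
Context {R : realType} {n : nat}.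
Implicit Types (M : 'M[R]_n) (u v : 'rV[R]_n).

(** The bilinear form with matrix [M]. *)
Definition bil M u v : R := (u *m M *m v^T) 0 0.

Lemma bilDl M u u' v : bil M (u + u') v = bil M u v + bil M u' v.
Proof. by rewrite /bil !mulmxDl mxE. Qed.

Lemma bilZl M a u v : bil M (a *: u) v = a * bil M u v.
Proof. by rewrite /bil -!scalemxAl mxE. Qed.

Lemma bilDr M u v v' : bil M u (v + v') = bil M u v + bil M u v'.
Proof. by rewrite /bil linearD/= mulmxDr mxE. Qed.

Lemma bilZr M a u v : bil M u (a *: v) = a * bil M u v.
Proof. by rewrite /bil linearZ/= -scalemxAr mxE. Qed.

Lemma bilNr M u v : bil M u (- v) = - bil M u v.
Proof. by rewrite -scaleN1r bilZr mulN1r. Qed.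

Lemma bilC M u v : M^T = M -> bil M u v = bil M v u.
Proof.
move=> sM; rewrite /bil -[u *m M *m v^T]trmxK [in LHS]mxE.
by rewrite !trmx_mul trmxK sM mulmxA.
Qed.

Lemma bilE M u v : bil M u v = \sum_i \sum_j u 0 i * M i j * v 0 j.
Proof.
rewrite /bil mxE exchange_big/=; apply: eq_bigr => j _.
rewrite !mxE mulr_suml; apply: eq_bigr => i _.
by rewrite mulrC.
Qed.

Lemma norm_bil_le M u v : `|bil M u v| <= n%:R ^+ 2 * `|M| * (`|u| * `|v|).
Proof.
have entM i j : `|M i j| <= `|M|.
  by rewrite [leRHS]/Num.Def.normr/= mx_normrE (le_bigmax _ _ (i, j)).
rewrite bilE (le_trans (ler_norm_sum _ _ _))//.
have : \sum_(i < n) \sum_(j < n) `|M| * (`|u| * `|v|) =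
   n%:R ^+ 2 * `|M| * (`|u| * `|v|).
  have sc (c : R) : \sum_(i < n) c = n%:R * c.
    by rewrite sumr_const card_ord mulr_natl.
  by rewrite (eq_bigr (fun=> n%:R * (`|M| * (`|u| * `|v|)))) ?sc ?expr2 ?mulrA.
move=> <-; apply: ler_sum => i _; rewrite (le_trans (ler_norm_sum _ _ _))//.
apply: ler_sum => j _; rewrite !normrM mulrAC mulrC ler_pM ?mulr_ge0//.
by rewrite ler_pM// le_coord_norm.
Qed.

Lemma norm_row_mul_le (r u : 'rV[R]_n) : `|(r *m u^T) 0 0| <= n%:R * `|r| * `|u|.
Proof.
rewrite mxE (le_trans (ler_norm_sum _ _ _))//.
have -> : n%:R * `|r| * `|u| = \sum_(i < n) `|r| * `|u|.
  by rewrite sumr_const card_ord -mulrA mulr_natl.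
by apply: ler_sum => i _; rewrite mxE normrM ler_pM// le_coord_norm.
Qed.

Lemma continuous_quad M : continuous (fun u => bil M u u).
Proof.
move=> u; apply: differentiable_continuous.
rewrite (_ : (fun u => _) =
  \sum_(i < n) \sum_(j < n) (fun u : 'rV[R]_n => u 0 i * M i j * u 0 j)).
  apply: differentiable_sum => i; apply: differentiable_sum => j.
  apply: differentiableM; last exact: differentiable_coord.
  by apply: differentiableM; [exact: differentiable_coord|exact: differentiable_cst].
apply/funext => v; rewrite bilE fct_sumE; apply: eq_bigr => i _.
by rewrite fct_sumE.
Qed.

(** By compactness of the unit sphere. *)
Lemma posdef_coercive M : (forall u, u != 0 -> 0 < bil M u u) ->
  exists2 c, 0 < c & forall u, c * `|u| ^+ 2 <= bil M u u.
Proof.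
move=> Mpos.
pose S : set 'rV[R]_n := [set u | `|u| = 1].
have [S0|/set0P/negP] := pselect (S !=set0); last first.
  rewrite negbK => /eqP S0; exists 1 => // u.
  have [->|u0] := eqVneq u 0.
    by rewrite normr0 expr0n mulr0 /bil !mul0mx mxE.
  suff : S (`|u|^-1 *: u) by rewrite S0.
  by rewrite /S/= normrZ ger0_norm ?invr_ge0// mulVf// normr_eq0.
have cS : compact S.
  apply: bounded_closed_compact.
    by exists 1; split=> // r r1 u /= ->; exact: ltW.
  apply: (@closed_comp _ _ (fun u : 'rV[R]_n => `|u|) [set 1]).
    by move=> u _; exact: norm_continuous.
  exact: closed_eq.
have [u /[!inE] uS umin] := EVT_min_rV S0 cS
  (continuous_subspaceT (@continuous_quad M)).
exists (bil M u u).
  by apply: Mpos; rewrite -normr_eq0 uS oner_neq0.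
move=> v; have [->|v0] := eqVneq v 0.
  by rewrite normr0 expr0n mulr0 /bil !mul0mx mxE.
have nv0 : 0 < `|v| by rewrite normr_gt0.
have := umin (`|v|^-1 *: v); rewrite inE /S/= normrZ gtr0_norm ?invr_gt0//.
rewrite mulVf ?gt_eqF// => /(_ erefl).
rewrite bilZl bilZr mulrA -expr2 exprVn mulrC ler_pdivlMr ?exprn_gt0//.
Qed.

Lemma bil_congr M (P : 'M[R]_n) u v :
  bil (P *m M *m P^T) u v = bil M (u *m P) (v *m P).
Proof. by rewrite /bil trmx_mul !mulmxA. Qed.

End BilinearForms.

Section Determinant.
Context {R : realType} {V : normedModType R}.

Lemma differentiable_prod (I : Type) (r : seq I) (f : I -> V -> R) x :
  (forall i, differentiable (f i) x) ->
  differentiable (fun y => \prod_(i <- r) f i y) x.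
Proof.
move=> df; elim: r => [|i r IH].
  rewrite (_ : (fun _ => _) = cst 1); first exact: differentiable_cst.
  by apply/funext => y; rewrite big_nil.
rewrite (_ : (fun _ => _) = (f i) * (fun y => \prod_(j <- r) f j y)).
  exact: differentiableM.
by apply/funext => y; rewrite big_cons.
Qed.

Lemma differentiable_big_sum (I : Type) (r : seq I) (f : I -> V -> R) x :
  (forall i, differentiable (f i) x) ->
  differentiable (fun y => \sum_(i <- r) f i y) x.
Proof.
move=> df; elim: r => [|i r IH].
  rewrite (_ : (fun _ => _) = cst 0); first exact: differentiable_cst.
  by apply/funext => y; rewrite big_nil.
rewrite (_ : (fun _ => _) = (f i) + (fun y => \sum_(j <- r) f j y)).
  exact: differentiableD.
by apply/funext => y; rewrite big_cons.
Qed.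

Lemma differentiable_det {m : nat} (A : V -> 'M[R]_m) x :
  (forall i j, differentiable (fun y => A y i j) x) ->
  differentiable (fun y => \det (A y)) x.
Proof.
move=> dA; rewrite /determinant; apply: differentiable_big_sum => s.
apply: differentiableM; first exact: differentiable_cst.
exact: differentiable_prod.
Qed.

Lemma differentiable_adjugate {m : nat} (A : V -> 'M[R]_m) x i j :
  (forall i j, differentiable (fun y => A y i j) x) ->
  differentiable (fun y => (\adj (A y)) i j) x.
Proof.
move=> dA.
rewrite (_ : (fun y => _) =
   cst ((-1) ^+ (j + i)) * (fun y => \det (row' j (col' i (A y))))).
  apply: differentiableM; first exact: differentiable_cst.
  apply: differentiable_det => k l.
  by rewrite (_ : (fun y => _) = (fun y => A y (lift j k) (lift i l)))//;
    apply/funext => y; rewrite !mxE.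
by apply/funext => y; rewrite mxE.
Qed.

(** Expansion along row [i0], after that row of [A] is replaced by [r]. *)
Lemma det_replace_row {m : nat} (A : 'M[R]_m) (r : 'rV[R]_m) (i0 : 'I_m) :
  \det (\matrix_(i, j) if i == i0 then r 0 j else A i j) = (r *m \adj A) 0 i0.
Proof.
rewrite (expand_det_row _ i0) mxE; apply: eq_bigr => j _.
rewrite !mxE eqxx; congr (_ * _); rewrite /cofactor; congr (_ * \det _).
by apply/matrixP => k l; rewrite !mxE eq_sym (negbTE (neq_lift _ _)).
Qed.

End Determinant.

Section MatrixLimits.
Context {R : realType} {T : Type} (F : set_system T) {FF : Filter F}.

Lemma cvg_mxP {p q : nat} (A : T -> 'M[R]_(p, q)) (l : 'M[R]_(p, q)) :
  A @ F --> l <-> forall i j, (fun t => A t i j) @ F --> l i j.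
Proof.
split=> [Al i j|Al].
  apply: (cvg_comp A (fun N : 'M[R]_(p, q) => N i j) Al).
  exact: coord_continuous.
apply/cvgrPdist_le => /= e e0; near=> x.
rewrite /Num.Def.normr/= mx_normrE (bigmax_le _ (ltW e0))//= => i _.
rewrite !mxE/=; move: i; near: x; apply: filter_forall => /= i.
exact: ((cvgrPdist_le _ _).1 (Al i.1 i.2)).
Unshelve. all: by end_near. Qed.

Lemma cvg_big_sum (I : Type) (r : seq I) (f : I -> T -> R) (l : I -> R) :
  (forall i, f i @ F --> l i) ->
  (fun t => \sum_(i <- r) f i t) @ F --> \sum_(i <- r) l i.
Proof.
move=> fl; elim: r => [|i r IH].
  rewrite big_nil (_ : (fun _ => _) = cst 0); first exact: cvg_cst.
  by apply/funext => t; rewrite big_nil.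
rewrite big_cons (_ : (fun _ => _) = (fun t => f i t + \sum_(j <- r) f j t)).
  by apply: cvgD.
by apply/funext => t; rewrite big_cons.
Qed.

Lemma cvg_mulmx {p q r : nat} (A : T -> 'M[R]_(p, q)) (B : T -> 'M[R]_(q, r))
    (a : 'M[R]_(p, q)) (b : 'M[R]_(q, r)) :
  A @ F --> a -> B @ F --> b -> (fun t => A t *m B t) @ F --> a *m b.
Proof.
move=> /cvg_mxP Aa /cvg_mxP Bb; apply/cvg_mxP => i j; rewrite mxE.
rewrite (_ : (fun _ => _) = (fun t => \sum_k A t i k * B t k j)); last first.
  by apply/funext => t; rewrite mxE.
by apply: cvg_big_sum => k; apply: cvgM.
Qed.

Lemma cvg_trmx {p q : nat} (A : T -> 'M[R]_(p, q)) (a : 'M[R]_(p, q)) :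
  A @ F --> a -> (fun t => (A t)^T) @ F --> a^T.
Proof.
move=> /cvg_mxP Aa; apply/cvg_mxP => i j; rewrite mxE.
by rewrite (_ : (fun _ => _) = (fun t => A t j i))//; apply/funext => t; rewrite mxE.
Qed.

Lemma cvg_bil {n : nat} (A : T -> 'M[R]_n) (a : 'M[R]_n) (u v : 'rV[R]_n) :
  A @ F --> a -> (fun t => bil (A t) u v) @ F --> bil a u v.
Proof.
move=> Aa; have H : (fun t => u *m A t *m v^T) @ F --> u *m a *m v^T.
  exact: cvg_mulmx (cvg_mulmx (cvg_cst u) Aa) (cvg_cst v^T).
by have := iffLR (cvg_mxP _ _) H 0 0.
Qed.

End MatrixLimits.

Lemma subZ_entry {R : realType} {p q : nat} (A B : 'M[R]_(p, q)) c i j :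
  (A - c *: B) i j = A i j - c * B i j.
Proof. by rewrite !mxE. Qed.

Lemma bil_addmx {R : realType} {n : nat} (A B : 'M[R]_n) u v :
  bil (A + B) u v = bil A u v + bil B u v.
Proof. by rewrite /bil mulmxDr mulmxDl mxE. Qed.

Lemma bil_submx {R : realType} {n : nat} (A B : 'M[R]_n) u v :
  bil (A - B) u v = bil A u v - bil B u v.
Proof. by rewrite /bil mulmxBr mulmxBl mxE; congr (_ + _); rewrite mxE. Qed.

Lemma bil_outer {R : realType} {n : nat} (r u : 'rV[R]_n) :
  bil (r^T *m r) u u = ((r *m u^T) 0 0) ^+ 2.
Proof.
rewrite /bil mulmxA -mulmxA -{1}[u]trmxK -trmx_mul mxE big_ord1 expr2.
by rewrite [X in X * _]mxE.
Qed.

Lemma bil_delta {R : realType} {n : nat} (M : 'M[R]_n) (u : 'rV[R]_n) i :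
  bil M 'e_i u = (M *m u^T) i 0.
Proof. by rewrite /bil -mulmxA -rowE mxE. Qed.

Lemma psd_kernel {R : realType} {n : nat} (M : 'M[R]_n) (u : 'rV[R]_n) :
  M^T = M -> (forall v, 0 <= bil M v v) -> bil M u u = 0 -> M *m u^T = 0.
Proof.
move=> sM psd uu.
suff H v : bil M v u = 0.
  by apply/colP => i; rewrite -bil_delta H mxE.
set b := bil M v u; set c := bil M v v.
have c0 : 0 <= c by exact: psd.
have c1 : 0 < c + 1 by rewrite ltr_wpDl.
(* the nonnegative quadratic polynomial 2ab + a^2c, evaluated at a = -b/(c+1) *)
have := psd (u + (- b / (c + 1)) *: v).
rewrite bilDl !bilDr !bilZl !bilZr uu (bilC _ _ sM) -/b -/c add0r.
have -> : - b / (c + 1) * b + (- b / (c + 1) * b + - b / (c + 1) * (- b / (c + 1) * c))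
   = - (b ^+ 2 * ((c + 2) / (c + 1) ^+ 2)) by field; rewrite gt_eqF.
have c2 : 0 < (c + 2) / (c + 1) ^+ 2.
  by rewrite divr_gt0 ?exprn_gt0// ltr_wpDl.
rewrite oppr_ge0 pmulr_lle0// => b0.
by apply/eqP; rewrite -sqrf_eq0 eq_le b0 sqr_ge0.
Qed.

Lemma dnbhs_at_left {R : realType} (a : R) (P : R -> Prop) :
  (\forall t \near a^', P t) -> \forall t \near a^'-, P t.
Proof.
rewrite !nearE /dnbhs /at_left /within/=.
by apply: filterS => s Ps sa; apply: Ps; rewrite lt_eqF.
Qed.

Lemma dnbhs_at_right {R : realType} (a : R) (P : R -> Prop) :
  (\forall t \near a^', P t) -> \forall t \near a^'+, P t.
Proof.
rewrite !nearE /dnbhs /at_right /within/=.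
by apply: filterS => s Ps sa; apply: Ps; rewrite gt_eqF.
Qed.

(** * The metric along the radical line *)

(** [G] is the matrix of the metric in a chart with image [U], [x0] a point where
    it degenerates and [w] the radical direction, along which the determinant
    decreases. *)
Section RadicalLine.
Context {R : realType} {n : nat}.
Variables (U : set 'rV[R]_n) (G : 'rV[R]_n -> 'M[R]_n) (x0 w : 'rV[R]_n).
Hypotheses (oU : open U) (CG : Ck_on 1 U G) (Ux0 : U x0).
Hypothesis symG : forall x, U x -> (G x)^T = G x.
Hypothesis radw : w *m G x0 = 0.
Hypothesis detw : 'D_w (fun x => \det (G x)) x0 < 0.
Hypothesis psdG : forall x, U x -> 0 < \det (G x) -> forall u, 0 <= bil (G x) u u.

Let L (t : R) : 'rV[R]_n := x0 + t *: w.

Lemma differentiable_metric x : U x -> differentiable G x.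
Proof. by move=> Ux; exact: C1_differentiable oU Ux CG. Qed.

Lemma differentiable_metric_entry x i j : U x -> differentiable (fun y => G y i j) x.
Proof.
move=> Ux; apply: (@differentiable_comp _ _ _ _ G (fun N : 'M[R]_n => N i j)).
  exact: differentiable_metric.
exact: differentiable_coord.
Qed.

Lemma line_is_derive (t : R) : is_derive t (1 : R) L w.
Proof.
apply: (@has_wderiv_is_derive _ _ setT); first exact: filterT.
rewrite -[w in X in has_wderiv _ _ _ X]add0r; apply: has_wderivD.
  exact: has_wderiv_cst.
rewrite -[w in X in has_wderiv _ _ _ X]scale1r -[X in has_wderiv _ _ _ X]addr0.
rewrite -(scaler0 _ t); apply: has_wderivZ; last exact: has_wderiv_cst.
exact: (is_derive_has_wderiv _ (is_derive_id _ _)).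
Qed.

Lemma line_continuous : continuous L.
Proof.
move=> t; apply: differentiable_continuous; apply/derivable1_diffP.
by have [] := line_is_derive t.
Qed.

Let L0 : L 0 = x0. Proof. by rewrite /L scale0r addr0. Qed.

Lemma line_near : \forall t \near (0 : R), U (L t).
Proof.
have UL : nbhs (L 0) U by rewrite L0; exact: open_nbhs_nbhs.
exact: line_continuous UL.
Qed.

Lemma radical_dir_neq0 : w != 0.
Proof. by apply: contraTneq detw => ->; rewrite derive0 ltxx. Qed.

Lemma det_metric0 : \det (G x0) = 0.
Proof.
apply/eqP/det0P; exists w => //; exact: radical_dir_neq0.
Qed.

(** The limit [w *m G (L t) / t]; at [t = 0] the numerator vanishes. *)
Let m0 : 'rV[R]_n := w *m 'D_w G x0.
Let m (t : R) : 'rV[R]_n := t^-1 *: (w *m G (L t)).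

Lemma metric_is_derive t : U (L t) ->
  is_derive t (1 : R) (fun s => G (L s)) ('D_w G (L t)).
Proof.
move=> ULt; apply: is_derive_comp_diff; first exact: line_is_derive.
exact: differentiable_metric.
Qed.

Lemma dnbhs_within_setT (t : R) : within setT t^' = t^'.
Proof.
apply/funext => P; rewrite /within/=; congr (t^' _).
by apply/funext => s; apply/propext; split=> [|Ps _//]; apply.
Qed.

Lemma cvg_slope : m t @[t --> 0^'] --> m0.
Proof.
have /(is_derive_has_wderiv setT) D := metric_is_derive (t := 0) (nbhs_singleton line_near).
have := has_wderiv_mulmx (has_wderiv_cst setT w 0) D.
rewrite mul0mx add0r L0 /has_wderiv dnbhs_within_setT.
rewrite (_ : diff_quot _ 0 = m)//; apply/funext => t.
by rewrite /diff_quot /m subr0 L0 radw subr0.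
Qed.

Lemma cvg_det_slope : t^-1 * \det (G (L t)) @[t --> 0^'] -->
  'D_w (fun x => \det (G x)) x0.
Proof.
have D : is_derive (0 : R) (1 : R) (fun t => \det (G (L t)))
    ('D_w (fun x => \det (G x)) x0).
  have := is_derive_comp_diff (F := fun x => \det (G x)) (line_is_derive 0).
  rewrite L0; apply; apply: differentiable_det => i j.
  exact: differentiable_metric_entry.
have := is_derive_has_wderiv setT D; rewrite /has_wderiv dnbhs_within_setT.
rewrite (_ : diff_quot _ 0 = (fun t => t^-1 * \det (G (L t))))//.
by apply/funext => t; rewrite /diff_quot subr0 L0 det_metric0 subr0.
Qed.

Lemma cvg_metric : G (L t) @[t --> 0^'] --> G x0.
Proof.
have : {for (0 : R), continuous (fun t => G (L t))}.
  apply: (@continuous_comp _ _ _ L G); first exact: line_continuous.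
  by apply: differentiable_continuous; apply: differentiable_metric; rewrite L0.
by rewrite /prop_for/continuous_at L0; exact: cvg_within_filter.
Qed.


(** Obtained from [A *m \adj A = (\det A)%:M] at the points of the line, by
    division by [t] and passage to the limit. *)
Lemma radical_dir_adj : 'D_w (fun x => \det (G x)) x0 *: w = m0 *m \adj (G x0).
Proof.
have FF : ProperFilter (0 : R)^' by exact: Proper_dnbhs_numFieldType.
apply/rowP => i; rewrite mxE.
have cadj : (fun t => \adj (G (L t))) @ (0 : R)^' --> \adj (G x0).
  apply/cvg_mxP => k l.
  have : {for (0 : R), continuous (fun t => (\adj (G (L t))) k l)}.
    apply: (@continuous_comp _ _ _ L (fun x => (\adj (G x)) k l)).
      exact: line_continuous.
    apply: differentiable_continuous; rewrite L0; apply: differentiable_adjugate.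
    by move=> ? ?; exact: differentiable_metric_entry.
  by rewrite /prop_for/continuous_at L0; exact: cvg_within_filter.
have C1 : (fun t => (m t *m \adj (G (L t))) 0 i) @ (0 : R)^' -->
    (m0 *m \adj (G x0)) 0 i.
  exact: (iffLR (cvg_mxP _ _) (cvg_mulmx cvg_slope cadj) 0 i).
have C2 : (fun t => t^-1 * \det (G (L t)) * w 0 i) @ (0 : R)^' -->
    'D_w (fun x => \det (G x)) x0 * w 0 i.
  by apply: cvgM; [exact: cvg_det_slope|exact: cvg_cst].
apply: (cvg_unique _ C2 (cvg_trans _ C1)) => //.
apply: near_eq_cvg; near=> t.
rewrite /m -scalemxAl -mulmxA mul_mx_adj mul_mx_scalar !mxE.
by rewrite mulrA.
Unshelve. all: by end_near. Qed.

(** This uses the nonvanishing of the derivative of the determinant: when a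
    suitable row of [G x0] is replaced by [m0], the resulting matrix is
    invertible. *)
Lemma radical_slope_trivial (u : 'rV[R]_n) : G x0 *m u^T = 0 -> m0 *m u^T = 0 -> u = 0.
Proof.
move=> Gu mu.
have /rV0Pn[i0 wi0] := radical_dir_neq0.
pose Q : 'M[R]_n := \matrix_(i < n, j < n) (if i == i0 then m0 0 j else G x0 i j).
have Qu : Q \in unitmx.
  rewrite unitmxE unitfE det_replace_row -radical_dir_adj mxE.
  by rewrite mulf_neq0// lt_eqF.
have Q0 : Q *m u^T = 0.
  apply/colP => i; rewrite !mxE.
  have [->|ii0] := eqVneq i i0.
    move/colP : mu => /(_ 0); rewrite !mxE => E; rewrite -[RHS]E.
    by apply: eq_bigr => j _; rewrite !mxE eqxx.
  move/colP : Gu => /(_ i); rewrite !mxE => E; rewrite -[RHS]E.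
  by apply: eq_bigr => j _; rewrite !mxE (negbTE ii0).
by apply: trmx_inj; rewrite trmx0 -[LHS](mulKmx Qu) Q0 mulmx0.
Qed.

Lemma near_det_slope : \forall t \near (0 : R)^', U (L t) /\ t^-1 * \det (G (L t)) < 0.
Proof.
near=> t; split; first by near: t; apply: cvg_within; exact: line_near.
by near: t; exact: (cvgr_lt _ cvg_det_slope).
Unshelve. all: by end_near. Qed.

Lemma near_det_left : \forall t \near (0 : R)^'-, U (L t) /\ 0 < \det (G (L t)).
Proof.
near=> t; have t0 : t < 0 by [].
have [UL] : U (L t) /\ t^-1 * \det (G (L t)) < 0.
  by near: t; exact: (dnbhs_at_left near_det_slope).
by rewrite nmulr_rlt0// invr_lt0.
Unshelve. all: by end_near. Qed.

Lemma near_det_right : \forall t \near (0 : R)^'+, U (L t) /\ \det (G (L t)) < 0.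
Proof.
near=> t; have t0 : 0 < t by [].
have [UL] : U (L t) /\ t^-1 * \det (G (L t)) < 0.
  by near: t; exact: (dnbhs_at_right near_det_slope).
by rewrite pmulr_rlt0// invr_gt0.
Unshelve. all: by end_near. Qed.

(** The limit of the Riemannian metrics on the negative half of the line. *)
Lemma metric_psd u : 0 <= bil (G x0) u u.
Proof.
have C : (fun t => bil (G (L t)) u u) @ (0 : R)^'- --> bil (G x0) u u.
  by apply: cvg_dnbhs_at_left; apply: cvg_bil; exact: cvg_metric.
apply: (cvgr_to_ge C); apply: filterS near_det_left => t [UL dL].
exact: psdG.
Qed.

Lemma slope_radical_lt0 : (m0 *m w^T) 0 0 < 0.
Proof.
rewrite lt_neqAle; apply/andP; split.
  apply: contra radical_dir_neq0 => /eqP mw.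
  apply/eqP/radical_slope_trivial.
    by rewrite -{1}(symG Ux0) -trmx_mul radw trmx0.
  by apply/rowP => i; rewrite !ord1 mw mxE.
have C : (fun t => (m t *m w^T) 0 0) @ (0 : R)^'- --> (m0 *m w^T) 0 0.
  apply: cvg_dnbhs_at_left.
  exact: (iffLR (cvg_mxP _ _) (cvg_mulmx cvg_slope (cvg_cst w^T)) 0 0).
apply: (cvgr_to_le C); near=> t; have t0 : t < 0 by [].
have [UL dL] : U (L t) /\ 0 < \det (G (L t)) by near: t; exact: near_det_left.
rewrite /m -scalemxAl mxE nmulr_rle0 ?invr_lt0//; exact: psdG.
Unshelve. all: by end_near. Qed.

Lemma slope_posdef u : u != 0 -> 0 < bil (G x0 + m0^T *m m0) u u.
Proof.
move=> u0; rewrite bil_addmx bil_outer lt_neqAle addr_ge0 ?metric_psd ?sqr_ge0// andbT eq_sym.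
apply: contra u0; rewrite paddr_eq0 ?metric_psd ?sqr_ge0// sqrf_eq0.
move=> /andP[/eqP Gu /eqP mu]; apply/eqP/radical_slope_trivial.
  by apply: psd_kernel Gu; [exact: symG|exact: metric_psd].
by apply/rowP => i; rewrite !ord1 mu mxE.
Qed.


(** The covector [g(D_w w, _)] of the acceleration of the line [L]. *)
Let accel (t : R) : 'rV[R]_n :=
  w *m 'D_w G (L t) - 2^-1 *: \row_l bil ('D_'e_l G (L t)) w w.

Lemma accelE t u : U (L t) ->
  (accel t *m u^T) 0 0 = bil ('D_w G (L t)) w u - 2^-1 * bil ('D_u G (L t)) w w.
Proof.
move=> UL; have dG := differentiable_metric UL.
rewrite /accel mulmxBl -scalemxAl subZ_entry.
congr (_ - _ * _); rewrite mxE.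
have -> : 'D_u G (L t) = \sum_l u 0 l *: 'D_'e_l G (L t).
  rewrite deriveE// {1}[u]row_sum_delta linear_sum/=; apply: eq_bigr => l _.
  by rewrite linearZ/= -deriveE.
rewrite /bil mulmx_sumr mulmx_suml summxE; apply: eq_bigr => l _.
by rewrite -scalemxAr -scalemxAl [RHS]mxE mulrC; congr (_ * _); rewrite mxE.
Qed.

Lemma cvg_accel : accel t @[t --> 0^'] --> accel 0.
Proof.
have cD v : 'D_v G (L t) @[t --> 0^'] --> 'D_v G (L 0).
  have : {for (0 : R), continuous (fun t => 'D_v G (L t))}.
    apply: (@continuous_comp _ _ _ L ('D_v G)); first exact: line_continuous.
    by rewrite L0; have [_ /(_ v)[_ [c _]]] := CG; exact: c.
  by rewrite /prop_for/continuous_at; exact: cvg_within_filter.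
pose r t : 'rV[R]_n := \row_l bil ('D_'e_l G (L t)) w w.
have cr : r t @[t --> 0^'] --> r 0.
  apply: (iffRL (cvg_mxP _ _)) => i j.
  have rE t : r t i j = bil ('D_'e_j G (L t)) w w by rewrite [LHS]mxE.
  have -> : (fun t => r t i j) = (fun t => bil ('D_'e_j G (L t)) w w).
    by apply/funext => t; exact: rE.
  by rewrite rE; apply: cvg_bil; exact: cD.
have cw : w *m 'D_w G (L t) @[t --> 0^'] --> w *m 'D_w G (L 0).
  by apply: cvg_mulmx; [exact: cvg_cst|exact: cD].
have c2 : (2^-1 : R) *: r t @[t --> 0^'] --> (2^-1 : R) *: r 0.
  exact: cvgZ (cvg_cst _) cr.
exact: cvgB cw c2.
Qed.

(** With [alpha] the covector [accel], the covector on the left-hand side is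
    [alpha + alpha(w) / N g(w, _)], which vanishes on [w]. *)
Lemma accel_estimate : exists d k C : R, [/\ 0 < d, 0 < k, 0 <= C &
  forall t, 0 < t < d -> let g := G (L t) in let N := - bil g w w in
    [/\ U (L t), \det g < 0, k * t <= N & forall u,
      (bil ('D_w G (L t)) w u - 2^-1 * bil ('D_u G (L t)) w w
         + 2^-1 * bil ('D_w G (L t)) w w / N * bil g w u) ^+ 2
      <= C * (bil g u u + bil g w u ^+ 2 / N)]].
Proof.
set m0w := (m0 *m w^T) 0 0; have m0w0 : m0w < 0 by exact: slope_radical_lt0.
pose mw t := (m t *m w^T) 0 0.
have cmw : mw t @[t --> 0^'] --> m0w.
  exact: (iffLR (cvg_mxP _ _) (cvg_mulmx cvg_slope (cvg_cst w^T)) 0 0).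
pose aw t := (accel t *m w^T) 0 0.
have caw : aw t @[t --> 0^'] --> aw 0.
  exact: (iffLR (cvg_mxP _ _) (cvg_mulmx cvg_accel (cvg_cst w^T)) 0 0).
pose b t : 'rV[R]_n := accel t - (aw t / mw t) *: m t.
pose b0 : 'rV[R]_n := accel 0 - (aw 0 / m0w) *: m0.
have cb : b t @[t --> 0^'] --> b0.
  apply: cvgB; first exact: cvg_accel.
  have cq : aw t / mw t @[t --> 0^'] --> aw 0 / m0w.
    by apply: cvgM => //; apply: cvgV => //; rewrite lt_eqF.
  exact: cvgZ cq cvg_slope.
pose M t := G (L t) + (m t)^T *m m t.
pose M0 := G x0 + m0^T *m m0.
have cM : M t @[t --> 0^'] --> M0.
  by apply: cvgD; [exact: cvg_metric|apply: cvg_mulmx; [apply: cvg_trmx|]; exact: cvg_slope].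
have [c c0 cP] := posdef_coercive slope_posdef.
pose B := n%:R * (`|b0| + 1).
have B0 : 0 <= B by rewrite mulr_ge0// addr_ge0.
pose e := c / 2 / (n%:R ^+ 2 + 1).
have n21 : 0 < n%:R ^+ 2 + 1 :> R by rewrite ltr_wpDl// exprn_ge0.
have e0 : 0 < e by rewrite !divr_gt0.
have : \forall t \near (0 : R)^'+, [/\ U (L t), \det (G (L t)) < 0, mw t <= m0w / 2,
    `|b0 - b t| <= 1 & `|M0 - M t| <= e].
  near=> t; have [UL dL] : U (L t) /\ \det (G (L t)) < 0.
    by near: t; exact: near_det_right.
  split=> //; near: t; apply: dnbhs_at_right.
  - by apply: (cvgr_le _ cmw); lra.
  - exact: (iffLR (cvgrPdist_le _ _) cb).
  - exact: (iffLR (cvgrPdist_le _ _) cM).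
move=> /nbhs_ballP[d /= d0 dP].
exists d, (- m0w / 2), (B ^+ 2 * (2 / c)); split.
- exact: d0.
- by rewrite divr_gt0// oppr_gt0.
- by rewrite mulr_ge0// ?sqr_ge0// divr_ge0// ltW.
move=> t /andP[t0 td]; set g := G (L t); set N := - bil g w w.
have [UL dL mwt bt Mt] : [/\ U (L t), \det (G (L t)) < 0, mw t <= m0w / 2,
    `|b0 - b t| <= 1 & `|M0 - M t| <= e].
  by apply: dP => //; rewrite -ball_normE /= sub0r normrN gtr0_norm.
have gm u : bil g w u = t * (m t *m u^T) 0 0.
  rewrite /m -scalemxAl mxE mulrA mulfV ?gt_eqF// mul1r //.
have NE : N = - (t * mw t) by rewrite /N gm.
have mw0 : mw t < 0 by apply: le_lt_trans mwt _; rewrite pmulr_llt0.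
have N0 : 0 < N by rewrite NE oppr_gt0 pmulr_rlt0.
have tn : t != 0 by rewrite gt_eqF.
have mwn : mw t != 0 by rewrite lt_eqF.
split=> //.
  by rewrite NE mulrC -mulrN ler_pM2l// mulNr lerN2.
move=> u; pose mu := (m t *m u^T) 0 0.
have awE : aw t = 2^-1 * bil ('D_w G (L t)) w w.
  by rewrite /aw accelE//; lra.
(* the covector on the left is b t, which vanishes on w *)
have bE v : (b t *m v^T) 0 0 =
    (accel t *m v^T) 0 0 - aw t / mw t * (m t *m v^T) 0 0.
  by rewrite /b mulmxBl -scalemxAl subZ_entry.
rewrite -accelE// -awE gm -/mu.
have -> : (accel t *m u^T) 0 0 + aw t / N * (t * mu) = (b t *m u^T) 0 0.
  rewrite bE -/mu NE; field.
  by rewrite mwn tn.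
(* u' is the component of u in the g-orthogonal complement of w *)
pose u' := u - (mu / mw t) *: w.
have bw : (b t *m w^T) 0 0 = 0.
  by rewrite bE -/(mw t) -/(aw t) divfK ?subrr// lt_eqF.
have bu' : (b t *m u^T) 0 0 = (b t *m u'^T) 0 0.
  rewrite /u' linearB/= linearZ/= mulmxBr -scalemxAr subZ_entry.
  by rewrite bw mulr0 subr0.
have mu' : (m t *m u'^T) 0 0 = 0.
  rewrite /u' linearB/= linearZ/= mulmxBr -scalemxAr subZ_entry.
  by rewrite -/mu -/(mw t) divfK ?subrr// lt_eqF.
have sg : g^T = g by exact: symG.
have gu' : bil g u' u' = bil g u u + (t * mu) ^+ 2 / N.
  rewrite /u' -scaleN1r scalerA bilDl !bilDr !bilZl !bilZr (bilC u w sg) !gm -/mu -/(mw t) NE.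
  by field; rewrite mwn tn.
rewrite bu' -gu'.
have Mu' : bil (M t) u' u' = bil g u' u'.
  by rewrite /M bil_addmx bil_outer mu' expr0n addr0.
have lo : c / 2 * `|u'| ^+ 2 <= bil g u' u'.
  rewrite -Mu'.
  have D : bil (M t) u' u' = bil M0 u' u' - bil (M0 - M t) u' u'.
    by rewrite -bil_submx subKr.
  have := norm_bil_le (M0 - M t) u' u'; rewrite -expr2 => /(le_trans (ler_norm _)) H1.
  have H2 : n%:R ^+ 2 * `|M0 - M t| * `|u'| ^+ 2 <= c / 2 * `|u'| ^+ 2.
    rewrite ler_wpM2r ?sqr_ge0//.
    rewrite (le_trans (ler_wpM2l _ Mt)) ?exprn_ge0// /e mulrCA ger_pMr ?divr_gt0//.
    by rewrite ler_pdivrMr// mul1r lerDl.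
  have := cP u'; rewrite -/M0 D; lra.
have hi : ((b t *m u'^T) 0 0) ^+ 2 <= B ^+ 2 * `|u'| ^+ 2.
  rewrite -exprMn -[leLHS]real_normK ?num_real// ler_pXn2r ?nnegrE ?mulr_ge0//.
  rewrite (le_trans (norm_row_mul_le _ _))// ler_wpM2r// ler_wpM2l//.
  have -> : b t = b0 - (b0 - b t) by rewrite opprB addrC subrK.
  by rewrite (le_trans (ler_normB _ _))// lerD2l.
rewrite (le_trans hi)// -[leRHS]mulrA ler_wpM2l ?sqr_ge0//.
by rewrite -ler_pdivrMl ?divr_gt0// invf_div.
Unshelve. all: by end_near. Qed.

End RadicalLine.

(** * A differential inequality near a square-root singularity *)

Section DifferentialInequality.
Context {R : realType}.
Implicit Types (J : set R).

Lemma has_wderiv_comp J (h p : R -> R) t h' p' :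
  is_derive (p t) (1 : R) h h' -> has_wderiv J p t p' ->
  has_wderiv J (fun s => h (p s)) t (h' * p').
Proof.
move=> /is_derive1_caratheodory[phi [phiE phic phi0]] dp.
have pc : phi (p s) @[s --> within J t^'] --> h'.
  rewrite -phi0; apply: (@cvg_comp _ _ _ p phi _ (nbhs (p t))) => //.
  have := has_wderiv_cvg dp; apply: cvg_trans; apply: cvg_app.
  move=> P /within_nbhsP[d d0 dP].
  by apply/within_dnbhsP; exists d => // s sd Ks _; exact: dP.
rewrite /has_wderiv.
have -> : diff_quot (fun s => h (p s)) t = (fun s => phi (p s) * diff_quot p t s).
  by apply/funext => s; rewrite /diff_quot phiE -[_ *: (p s - _)]/(_ * _) mulrCA.
exact: cvgM.
Qed.

Lemma has_wderivV J (p : R -> R) t p' : p t != 0 -> has_wderiv J p t p' ->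
  has_wderiv J (fun s => (p s)^-1) t (- (p t)^-1 ^+ 2 * p').
Proof.
move=> pt0; apply: (@has_wderiv_comp _ (fun y => y^-1)).
have := @is_deriveV R (fun y => y) (p t) 1 1 pt0 (is_derive_id _ _).
by rewrite [_ *: 1]mulr1 exprVn.
Qed.

Lemma interval_interior J r s t : is_interval J -> J r -> J s -> r < t < s ->
  nbhs t J.
Proof.
move=> iJ Jr Js /andP[rt ts].
have : t \in `]r, s[ by rewrite in_itv/= rt.
move=> /near_in_itvoo; apply: filterS => u; rewrite in_itv/= => /andP[ru us].
by apply: (iJ r s) => //; rewrite !ltW.
Qed.

Lemma within_MVT J (f df : R -> R) r s : is_interval J ->
  (forall t, J t -> has_wderiv J f t (df t)) -> J r -> J s -> r < s ->
  exists2 c, J c & f s - f r = df c * (s - r).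
Proof.
move=> iJ dJ Jr Js rs; have rsJ t : r <= t <= s -> J t by move=> /iJ; apply.
have [| |c] := @MVT _ f df r s rs.
- move=> t; rewrite in_itv/= => rts.
  apply: (has_wderiv_is_derive (interval_interior iJ Jr Js rts)).
  by apply: dJ; apply: rsJ; case/andP: rts => ? ?; rewrite !ltW.
- apply: continuous_subspaceW (has_wderiv_continuous dJ) => t /=.
  by rewrite in_itv/=; exact: rsJ.
by rewrite in_itv/= => /andP[rc cs] E; exists c => //; apply: rsJ; rewrite !ltW.
Qed.

Lemma within_nondecreasing J (f df : R -> R) r s : is_interval J ->
  (forall t, J t -> has_wderiv J f t (df t)) -> (forall t, J t -> 0 <= df t) ->
  J r -> J s -> r <= s -> f r <= f s.
Proof.
move=> iJ dJ df0 Jr Js; rewrite le_eqVlt => /predU1P[->//|rs].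
have [c Jc E] := within_MVT iJ dJ Jr Js rs.
by rewrite -subr_ge0 E mulr_ge0 ?df0// subr_ge0 ltW.
Qed.

(** Comparison of the variations of two functions whose derivatives are
    comparable. *)
Lemma within_dominated J (z K dz dK : R -> R) r s : is_interval J ->
  (forall t, J t -> has_wderiv J z t (dz t)) ->
  (forall t, J t -> has_wderiv J K t (dK t)) ->
  (forall t, J t -> `|dz t| <= dK t) -> J r -> J s ->
  `|z s - z r| <= `|K s - K r|.
Proof.
move=> iJ hz hK le_dz.
have mono : forall p q, J p -> J q -> p <= q -> `|z q - z p| <= `|K q - K p|.
  move=> p q Jp Jq pq; apply: le_trans (ler_norm _); rewrite ler_norml; apply/andP; split.
    have := @within_nondecreasing J (fun t => K t + z t) (fun t => dK t + dz t)
      p q iJ (fun t Jt => has_wderivD (hK t Jt) (hz t Jt)).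
    move=> /(_ _ Jp Jq pq) H; have := H _.
    suff A t : J t -> 0 <= dK t + dz t by move=> /(_ A); lra.
    by move=> /le_dz; rewrite ler_norml => /andP[]; lra.
  have hzN t : J t -> has_wderiv J (fun t => -1 * z t) t (- dz t).
    move=> Jt; have := has_wderivM (has_wderiv_cst J (-1 : R) t) (hz t Jt).
    by rewrite mul0r add0r mulN1r.
  have := @within_nondecreasing J (fun t => K t + -1 * z t) (fun t => dK t - dz t)
    p q iJ (fun t Jt => has_wderivD (hK t Jt) (hzN t Jt)).
  move=> /(_ _ Jp Jq pq) H; have := H _.
  suff A t : J t -> 0 <= dK t - dz t by move=> /(_ A); lra.
  by move=> /le_dz; rewrite ler_norml => /andP[]; lra.
move=> Jr Js; have [rs|sr] := leP r s; first exact: mono.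
by rewrite distrC [leRHS]distrC; apply: mono => //; exact: ltW.
Qed.

(** A Gronwall estimate with the integrable weight [A' / sqrt A]: the quotient
    [f^2 / N] stays bounded although [N] may tend to zero.  The function
    [ln (1 + f^2 / N)] is compared with a multiple of [sqrt A]. *)
Lemma quotient_bounded J (f N A dA alpha omega : R -> R) (k C kappa d : R) :
  is_interval J -> 0 <= k -> 0 <= C -> 0 < kappa ->
  (forall s, J s -> 0 < A s < d) ->
  (forall s, J s -> kappa * A s <= N s) ->
  (forall s, J s -> has_wderiv J A s (dA s)) ->
  (forall s, J s -> has_wderiv J f s (dA s * alpha s)) ->
  (forall s, J s -> has_wderiv J N s (- (dA s * omega s))) ->
  (forall s, J s -> (alpha s + 2^-1 * omega s / N s * f s) ^+ 2
     <= C * (k + f s ^+ 2 / N s)) ->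
  (forall s, J s -> 0 <= dA s) \/ (forall s, J s -> dA s <= 0) ->
  exists B, forall s, J s -> f s ^+ 2 <= B * N s.
Proof.
move=> iJ k0 C0 kappa0 Ad NA hA hf hN est sgn.
have [[r Jr]|J0] := pselect (exists r, J r); last first.
  by exists 0 => s Js; exfalso; apply: J0; exists s.
have A0 s : J s -> 0 < A s by move=> /Ad /andP[].
have N0 s : J s -> 0 < N s.
  by move=> Js; apply: lt_le_trans (NA s Js); rewrite mulr_gt0// A0.
pose y s := f s ^+ 2 / N s.
have y0 s : J s -> 0 <= y s.
  by move=> Js; rewrite /y divr_ge0 ?sqr_ge0// ltW// N0.
pose beta s := alpha s + 2^-1 * omega s / N s * f s.
have hy s : J s -> has_wderiv J y s (dA s * (2 * f s * beta s / N s)).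
  move=> Js; have Nn : N s != 0 by rewrite gt_eqF// N0.
  have := has_wderivM (has_wderivM (hf s Js) (hf s Js)) (has_wderivV Nn (hN s Js)).
  rewrite (_ : (fun _ => _) = y); last by apply/funext => t; rewrite /y expr2.
  by congr has_wderiv; rewrite /beta; field.
pose z s := ln (1 + y s).
have y1 s : J s -> 0 < 1 + y s by move=> Js; rewrite ltr_wpDr// y0.
have hz s : J s -> has_wderiv J z s ((1 + y s)^-1 * (dA s * (2 * f s * beta s / N s))).
  move=> Js; apply: (@has_wderiv_comp _ (@ln R) (fun s => 1 + y s)).
    exact/is_derive1_ln/y1.
  by rewrite -[X in has_wderiv _ _ _ X]add0r; apply: has_wderivD (has_wderiv_cst _ _ _) (hy s Js).
pose D := Num.sqrt (4 * C * (k + 1) / kappa).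
have D0 : 0 <= D by rewrite sqrtr_ge0.
have D2 : D ^+ 2 = 4 * C * (k + 1) / kappa.
  by rewrite sqr_sqrtr// divr_ge0 ?(ltW kappa0)// mulr_ge0 ?mulr_ge0// addr_ge0.
have bnd s : J s -> `|(1 + y s)^-1 * (2 * f s * beta s / N s)| <= D / Num.sqrt (A s).
  move=> Js; have As := A0 s Js; have Ns := N0 s Js; have ys := y0 s Js.
  have sA : 0 < Num.sqrt (A s) by rewrite sqrtr_gt0.
  rewrite -ler_sqr ?nnegrE ?divr_ge0 ?(ltW sA)// real_normK ?num_real//.
  rewrite [leRHS]expr_div_n D2 sqr_sqrtr ?(ltW As)//.
  have q0 := y1 s Js; set q := 1 + y s in q0 *.
  have -> : (q^-1 * (2 * f s * beta s / N s)) ^+ 2 =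
      4 * y s * (beta s ^+ 2 / N s) / q ^+ 2.
    by rewrite /y; field; rewrite !gt_eqF.
  rewrite ler_pdivrMr ?exprn_gt0// /q.
  have b1 : beta s ^+ 2 / N s <= C * (k + y s) / (kappa * A s).
    rewrite ler_pM ?sqr_ge0 ?invr_ge0 ?(ltW Ns)//; first exact: est.
    by rewrite lef_pV2 ?posrE ?mulr_gt0//; exact: NA.
  apply: (le_trans (ler_wpM2l (mulr_ge0 _ ys) b1)) => //.
  have -> : 4 * C * (k + 1) / kappa / A s * (1 + y s) ^+ 2 =
     (4 * (1 + y s)) * (C * ((k + 1) * (1 + y s)) / (kappa * A s)).
    by field; rewrite !gt_eqF.
  have i0 : 0 <= (kappa * A s)^-1 by rewrite invr_ge0 mulr_ge0 ?ltW.
  apply: ler_pM; [by rewrite mulr_ge0| |by rewrite ler_wpM2l// lerDr|].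
    by rewrite !mulr_ge0// addr_ge0.
  by rewrite ler_wpM2r// ler_wpM2l//; nra.
have hK (e : R) s : J s -> has_wderiv J (fun t => e * (2 * D * Num.sqrt (A t))) s
    (e * (D / Num.sqrt (A s) * dA s)).
  move=> Js; have := has_wderiv_comp (is_derive1_sqrt (A0 s Js)) (hA s Js).
  move=> /(has_wderivM (has_wderiv_cst J (e * (2 * D)) s)); rewrite mul0r add0r.
  rewrite (_ : (fun _ => _) = (fun t => e * (2 * D * Num.sqrt (A t)))).
    congr has_wderiv; rewrite invfM; field.
    by rewrite gt_eqF// sqrtr_gt0 A0.
  by apply/funext => t; rewrite -!mulrA.
have [e [e1 esgn]] : exists e : R, `|e| = 1 /\ forall s, J s -> `|dA s| = e * dA s.
  case: sgn => H; [exists 1|exists (-1)]; rewrite ?normrN normr1; split=> // s Js.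
    by rewrite mul1r ger0_norm// H.
  by rewrite mulN1r ler0_norm// H.
have dom s : J s -> `|z s - z r| <= 2 * D * Num.sqrt d.
  move=> Js.
  have := within_dominated iJ hz (hK e) _ Jr Js.
  have H t : J t -> `|(1 + y t)^-1 * (dA t * (2 * f t * beta t / N t))| <=
      e * (D / Num.sqrt (A t) * dA t).
    move=> Jt; rewrite mulrCA normrM esgn//.
    have -> : e * (D / Num.sqrt (A t) * dA t) = e * dA t * (D / Num.sqrt (A t)).
      by ring.
    by rewrite ler_wpM2l ?bnd// -esgn.
  move=> /(_ H); move/le_trans; apply.
  rewrite -mulrBr normrM e1 mul1r -mulrBr normrM ger0_norm ?mulr_ge0//.
  rewrite ler_wpM2l ?mulr_ge0//.
  have sd t : J t -> 0 <= Num.sqrt (A t) <= Num.sqrt d.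
    by move=> Jt; rewrite sqrtr_ge0 ler_wsqrtr// ltW//; case/andP: (Ad t Jt).
  by have := sd _ Jr; have := sd _ Js; rewrite ler_norml; lra.
exists (expR (z r + 2 * D * Num.sqrt d)) => s Js.
rewrite -ler_pdivrMr ?N0// -/(y s).
have : z s <= z r + 2 * D * Num.sqrt d.
  by have := dom s Js; rewrite ler_norml => /andP[]; lra.
rewrite -ler_expR /z lnK ?posrE ?y1//; apply: le_trans.
by rewrite lerDr.
Qed.

End DifferentialInequality.

(** * Parallel frames along a curve running in the radical direction *)

Section Christoffel.
Context {R : realType} {n : nat} {M : smoothManifold R n} (g : symTensor M).
Variable c : chart R n M.
Hypothesis ac : atlas c.

Let U : set 'rV[R]_n := coord c @` cdom c.
Let G : 'rV[R]_n -> 'M[R]_n := gcomp g c \o cinv c.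

Lemma chart_img_open : open U. Proof. exact: cimg_open. Qed.

Lemma chart_metric_C1 : Ck_on 1 U G. Proof. exact: (gcomp_smooth g ac). Qed.

Lemma chart_metric_sym x : U x -> (G x)^T = G x.
Proof.
move=> [p cp <-]; rewrite /G/= coordK//.
by apply: gcomp_sym; split.
Qed.

Lemma chart_metricE p : cdom c p -> G (coord c p) = gcomp g c p.
Proof. by move=> cp; rewrite /G/= coordK. Qed.

(** The vector [Gamma^k_ij v^i E^j]. *)
Definition christoffel_vec (p : M) (v E : 'rV[R]_n) : 'rV[R]_n :=
  \row_k \sum_i \sum_j christoffel g c k i j p * v 0 i * E 0 j.

Lemma derive_sym x v : U x -> ('D_v G x)^T = 'D_v G x.
Proof.
move=> Ux; apply/matrixP => i j; rewrite mxE.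
have dG : derivable G x v.
  by apply: diff_derivable; exact: C1_differentiable chart_img_open Ux chart_metric_C1.
rewrite -!derive_entry//; apply: near_eq_derive.
have : nbhs x U by apply: open_nbhs_nbhs; split=> //; exact: chart_img_open.
by apply: filterS => y Uy; rewrite -[in LHS](chart_metric_sym Uy) mxE.
Qed.

Lemma bil_derive_sum x (v Y E : 'rV[R]_n) : U x -> bil ('D_v G x) Y E =
  \sum_l \sum_i \sum_j v 0 l * Y 0 i * E 0 j * ('D_'e_l G x) i j.
Proof.
move=> Ux; have dG := C1_differentiable chart_img_open Ux chart_metric_C1.
have -> : 'D_v G x = \sum_l v 0 l *: 'D_'e_l G x.
  rewrite deriveE// {1}[v]row_sum_delta linear_sum/=; apply: eq_bigr => l _.
  by rewrite linearZ/= -deriveE.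
have -> : bil (\sum_l v 0 l *: 'D_'e_l G x) Y E =
    \sum_l v 0 l * bil ('D_'e_l G x) Y E.
  rewrite /bil mulmx_sumr mulmx_suml summxE; apply: eq_bigr => l _.
  by rewrite -scalemxAr -scalemxAl [LHS]mxE.
apply: eq_bigr => l _; rewrite bilE mulr_sumr; apply: eq_bigr => i _.
rewrite mulr_sumr; apply: eq_bigr => j _; ring.
Qed.

Lemma gpartialE p l i j : cdom c p -> gpartial g c l i j p = ('D_'e_l G (coord c p)) i j.
Proof.
move=> cp; rewrite /gpartial; have Ux : U (coord c p) by exists p.
rewrite -derive_entry//; apply: diff_derivable.
exact: C1_differentiable chart_img_open Ux chart_metric_C1.
Qed.

(** The Christoffel symbols with their upper index lowered. *)
Lemma christoffel_lower p (v E Y : 'rV[R]_n) : cdom c p -> gcomp g c p \in unitmx ->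
  bil (gcomp g c p) Y (christoffel_vec p v E) = 2^-1 *
    (bil ('D_v G (coord c p)) Y E + bil ('D_E G (coord c p)) Y v
     - bil ('D_Y G (coord c p)) v E).
Proof.
move=> cp ug; have Ux : U (coord c p) by exists p.
pose T : 'cV[R]_n := \col_l \sum_i \sum_j v 0 i * E 0 j *
  (gpartial g c i l j p + gpartial g c j l i p - gpartial g c l i j p).
have -> : (christoffel_vec p v E) = (2^-1 *: (invmx (gcomp g c p) *m T))^T.
  apply/rowP => k; rewrite !mxE /christoffel.
  under [in RHS]eq_bigr => l _ do rewrite mxE.
  rewrite [RHS]mulr_sumr.
  transitivity (\sum_i \sum_j \sum_l 2^-1 * (invmx (gcomp g c p) k l *
     (v 0 i * E 0 j * (gpartial g c i l j p + gpartial g c j l i p - gpartial g c l i j p)))).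
    apply: eq_bigr => i _; apply: eq_bigr => j _.
    rewrite mulr_sumr -mulrA mulr_suml; apply: eq_bigr => l _; ring.
  under eq_bigr => i _ do rewrite exchange_big/=.
  rewrite exchange_big/=; apply: eq_bigr => l _.
  rewrite !mulr_sumr; apply: eq_bigr => i _; rewrite !mulr_sumr.
  by apply: eq_bigr => j _.
have sE (X : 'M[R]_1) : (2^-1 *: X) 0 0 = 2^-1 * X 0 0 by rewrite mxE.
rewrite [LHS]/bil trmxK -scalemxAr sE -[Y *m _ *m _]mulmxA mulKVmx//; congr (_ * _).
rewrite [X in _ = X + _ - _](bil_derive_sum v Y E Ux).
rewrite [X in _ = _ + X - _](bil_derive_sum E Y v Ux).
rewrite [X in _ = _ + _ - X](bil_derive_sum Y v E Ux).
have -> : \sum_l \sum_i \sum_j E 0 l * Y 0 i * v 0 j * ('D_'e_l G (coord c p)) i j =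
   \sum_i \sum_j \sum_l E 0 l * Y 0 i * v 0 j * ('D_'e_l G (coord c p)) i j.
  by rewrite exchange_big/=; apply: eq_bigr => i _; rewrite exchange_big.
rewrite [X in _ = X + _ - _]exchange_big/= mxE -big_split/= -sumrB.
apply: eq_bigr => l _; rewrite mxE mulr_sumr -big_split/= -sumrB.
apply: eq_bigr => i _; rewrite mulr_sumr -big_split/= -sumrB.
by apply: eq_bigr => j _; rewrite !gpartialE//; ring.
Qed.

End Christoffel.

Lemma has_wderiv_bil {R : realType} {n : nat} (K : set R) (A : R -> 'M[R]_n)
    (X Y : R -> 'rV[R]_n) t A' X' Y' :
  has_wderiv K A t A' -> has_wderiv K X t X' -> has_wderiv K Y t Y' ->
  has_wderiv K (fun s => bil (A s) (X s) (Y s)) t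
    (bil A' (X t) (Y t) + bil (A t) X' (Y t) + bil (A t) (X t) Y').
Proof.
move=> hA hX hY.
have := has_wderiv_mulmx (has_wderiv_mulmx hX hA) (has_wderiv_tr hY).
move=> /has_wderiv_mxP/(_ 0 0); congr has_wderiv.
rewrite mulmxDl !mxE; congr (_ + _); last by rewrite /bil mxE.
by rewrite addrC /bil !mxE.
Qed.

(** In the chart [c] the curve [gamma] runs along the line [x0 + A w]. *)
Section ParallelFrame.
Context {R : realType} {n : nat} {M : smoothManifold R n} (g : symTensor M).
Variable c : chart R n M.
Hypothesis ac : atlas c.

Let U : set 'rV[R]_n := coord c @` cdom c.
Let G : 'rV[R]_n -> 'M[R]_n := gcomp g c \o cinv c.

Variables (J : set R) (gamma : R -> M) (x0 w : 'rV[R]_n) (A dA : R -> R).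
Hypotheses (iJ : is_interval J) (nJ : no_isolated J).
Hypothesis hA : forall s, J s -> is_derive s (1 : R) A (dA s).
Hypothesis gammaJ : forall s, J s -> cdom c (gamma s) /\
  coord c (gamma s) = x0 + A s *: w.
Hypothesis unitG : forall s, J s -> gcomp g c (gamma s) \in unitmx.

Let x (s : R) : 'rV[R]_n := x0 + A s *: w.

Let Ux s : J s -> U (x s).
Proof. by move=> Js; have [cs xs] := gammaJ Js; exists (gamma s). Qed.

Let Gx s : J s -> gcomp g c (gamma s) = G (x s).
Proof.
move=> Js; have [cs xs] := gammaJ Js.
by rewrite -(chart_metricE g cs) xs.
Qed.

Let hx s : J s -> is_derive s (1 : R) x (dA s *: w).
Proof.
move=> Js; apply: (@has_wderiv_is_derive _ _ setT); first exact: filterT.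
rewrite -[X in has_wderiv _ _ _ X]add0r; apply: has_wderivD; first exact: has_wderiv_cst.
rewrite -[X in has_wderiv _ _ _ X]addr0 -(scaler0 _ (A s)).
by apply: has_wderivZ; [apply: is_derive_has_wderiv; exact: hA|exact: has_wderiv_cst].
Qed.

Lemma velocity_line s : J s -> velocity c J gamma s = dA s *: w.
Proof.
move=> Js; apply: has_wderiv_wderive => //.
apply: (@eq_has_wderiv _ _ _ x) => //; last by apply: is_derive_has_wderiv; exact: hx.
by move=> t Jt; rewrite /=; have [_ ->] := gammaJ Jt.
Qed.

Lemma derive_dir_scale y a v : U y -> 'D_(a *: v) G y = a *: 'D_v G y.
Proof.
move=> Uy; have dG := C1_differentiable (@chart_img_open _ _ _ c) Uy (chart_metric_C1 g ac).
by rewrite !deriveE// linearZ.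
Qed.

Lemma metric_along_has_wderiv s : J s ->
  has_wderiv J (fun t => G (x t)) s (dA s *: 'D_w G (x s)).
Proof.
move=> Js; rewrite -derive_dir_scale//; last exact: Ux.
apply: is_derive_has_wderiv; apply: is_derive_comp_diff; first exact: hx.
exact: C1_differentiable (@chart_img_open _ _ _ c) (Ux Js) (chart_metric_C1 g ac).
Qed.

Lemma parallel_has_wderiv E s : parallel g J gamma E -> J s ->
  has_wderiv J (E c) s (- christoffel_vec g c (gamma s) (dA s *: w) (E c s)).
Proof.
move=> [_ pE] Js; have [cs _] := gammaJ Js.
have [dE cE] := pE s c Js (conj ac cs).
have := wderivable_has_wderiv dE; congr has_wderiv.
move/eqP: cE; rewrite /cov_derive addr_eq0 => /eqP ->; congr (- _).
by rewrite velocity_line.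
Qed.

(** Parallel transport preserves inner products. *)
Lemma parallel_gram_const E F s r : parallel g J gamma E -> parallel g J gamma F ->
  J s -> J r -> bil (G (x s)) (E c s) (F c s) = bil (G (x r)) (E c r) (F c r).
Proof.
move=> pE pF Js Jr.
have H t : J t -> has_wderiv J (fun t => bil (G (x t)) (E c t) (F c t)) t 0.
  move=> Jt; have [cs xs] := gammaJ Jt.
  have := has_wderiv_bil (metric_along_has_wderiv Jt) (parallel_has_wderiv pE Jt)
    (parallel_has_wderiv pF Jt).
  congr has_wderiv.
  set v := dA t *: w.
  rewrite -derive_dir_scale//; last exact: Ux.
  rewrite (bilC (- _)); last exact: chart_metric_sym (Ux Jt).
  rewrite !bilNr -Gx//.
  rewrite !christoffel_lower//; try exact: unitG.
  rewrite xs -/(x t) -/v.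
  have sD u : ('D_u G (x t))^T = 'D_u G (x t) by apply: derive_sym => //; exact: Ux.
  move: (sD v) (sD (E c t)) (sD (F c t)).
  move: ('D_v G (x t)) ('D_(E c t) G (x t)) ('D_(F c t) G (x t)) => Dv DE DF sv sE sF.
  rewrite (bilC (F c t) (E c t) sv) (bilC v (E c t) sF) (bilC v (F c t) sE).
  by lra.
have := within_dominated iJ H (fun t _ => has_wderiv_cst J (0 : R) t) _ Jr Js.
have Z t : J t -> `|0 : R| <= 0 by rewrite normr0.
move=> /(_ Z); rewrite subrr normr0 normr_le0 subr_eq0 => /eqP.
exact.
Qed.

Lemma parallel_inner_has_wderiv E s : parallel g J gamma E -> J s ->
  has_wderiv J (fun t => bil (G (x t)) w (E c t)) s
    (dA s * (bil ('D_w G (x s)) w (E c s) - 2^-1 * bil ('D_(E c s) G (x s)) w w)).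
Proof.
move=> pE Js; have [cs xs] := gammaJ Js.
have := has_wderiv_bil (metric_along_has_wderiv Js) (has_wderiv_cst J w s)
    (parallel_has_wderiv pE Js).
congr has_wderiv.
have -> : bil (G (x s)) 0 (E c s) = 0 by rewrite /bil !mul0mx mxE.
rewrite addr0 bilNr -Gx// christoffel_lower//; last exact: unitG.
rewrite xs -/(x s) derive_dir_scale; last exact: Ux.
have bs a B (y z : 'rV[R]_n) : bil (a *: B) y z = a * bil B y z.
  by rewrite /bil -scalemxAr -scalemxAl mxE.
move: ('D_w G (x s)) ('D_(E c s) G (x s)) => Dw DE.
by rewrite !bs bilZr bilZl; lra.
Qed.

Variables (E : 'I_n -> chart R n M -> R -> 'rV[R]_n) (V : 'I_n -> R -> R) (t0 : R).
Hypotheses (Jt0 : J t0) (pE : forall i, parallel g J gamma (E i)).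
Hypothesis unitE : \matrix_(i < n) E i c t0 \in unitmx.
Hypothesis velE : forall s, J s -> velocity c J gamma s = \sum_i V i s *: E i c s.

Let gram : 'M[R]_n := \matrix_(i, j) bil (G (x t0)) (E i c t0) (E j c t0).
Let inner (s : R) : 'rV[R]_n := \row_j bil (G (x s)) w (E j c s).

Lemma gram_unit : gram \in unitmx.
Proof.
have -> : gram = (\matrix_(i < n) E i c t0) *m G (x t0) *m (\matrix_(i < n) E i c t0)^T.
  apply/matrixP => i j; rewrite [LHS]mxE.
  set F := \matrix_i E i c t0.
  have rF k : E k c t0 = row k F by apply/rowP => l; rewrite !mxE.
  rewrite /bil !rF -row_mul mxE [RHS]mxE; apply: eq_bigr => k _.
  by rewrite !mxE.
rewrite !unitmx_mul unitmx_tr unitE/= andbT -Gx//; exact: unitG.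
Qed.

(** The equation [velocity = sum_i V_i E_i], paired with the [E_j] and solved for
    the [V_i] by means of the constant Gram matrix. *)
Lemma frame_components s : J s -> \row_i V i s = dA s *: (inner s *m invmx gram).
Proof.
move=> Js; suff -> : dA s *: (inner s *m invmx gram) = (\row_i V i s *m gram) *m invmx gram.
  by rewrite mulmxK// gram_unit.
rewrite scalemxAl; congr (_ *m _); apply/rowP => j.
have L : dA s * bil (G (x s)) w (E j c s) = \sum_i V i s * bil (G (x s)) (E i c s) (E j c s).
  rewrite -bilZl -velocity_line// velE// /bil !mulmx_suml summxE.
  by apply: eq_bigr => i _; rewrite -!scalemxAl [LHS]mxE.
rewrite [LHS]mxE [inner s _ _]mxE L [RHS]mxE; apply: eq_bigr => i _.
rewrite [(\row__ _) _ _]mxE [gram _ _]mxE; congr (_ * _).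
exact: parallel_gram_const.
Qed.

Lemma frame_componentE s i : J s -> V i s = dA s * (inner s *m invmx gram) 0 i.
Proof.
move=> Js; transitivity ((\row_i V i s) 0 i); first by rewrite mxE.
by rewrite frame_components// mxE.
Qed.

Lemma frame_components_continuous i : {within J, continuous dA} ->
  {within J, continuous (V i)}.
Proof.
move=> cA.
have C : {within J, continuous
    (fun s => dA s * \sum_j bil (G (x s)) w (E j c s) * invmx gram j i)}.
  apply/within_continuousP => s Js; apply: cvgM.
    exact: (iffLR (within_continuousP _ _) cA).
  apply: cvg_big_sum => j; apply: cvgM; last exact: cvg_cst.
  exact: (has_wderiv_cvg (parallel_inner_has_wderiv (pE j) Js)).
apply: subspace_eq_continuous C => s; rewrite inE => Js.
rewrite /from_subspace frame_componentE// [in RHS]mxE; congr (_ * _).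
by apply: eq_bigr => j _; rewrite [inner _ _ _]mxE.
Qed.

(** The generalized affine speed of the curve is at most a multiple of the square root
    of [- g(gamma', gamma')], even though the latter tends to zero where the
    curve leaves the Lorentzian part. *)
Lemma frame_speed_bound (k C d : R) : 0 < k -> 0 <= C ->
  (forall s, J s -> 0 < A s < d) ->
  (forall s, J s -> k * A s <= - bil (G (x s)) w w) ->
  (forall s u, J s ->
    (bil ('D_w G (x s)) w u - 2^-1 * bil ('D_u G (x s)) w w
       + 2^-1 * bil ('D_w G (x s)) w w / - bil (G (x s)) w w * bil (G (x s)) w u) ^+ 2
    <= C * (bil (G (x s)) u u + bil (G (x s)) w u ^+ 2 / - bil (G (x s)) w w)) ->
  (forall s, J s -> 0 <= dA s) \/ (forall s, J s -> dA s <= 0) ->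
  exists2 B, 0 < B & forall s, J s ->
    \sum_i V i s ^+ 2 <= B * (dA s ^+ 2 * - bil (G (x s)) w w).
Proof.
move=> k0 C0 Ad NA est sgn.
pose N s := - bil (G (x s)) w w.
have N0 s : J s -> 0 < N s.
  by move=> Js; apply: lt_le_trans (NA s Js); rewrite mulr_gt0//; case/andP: (Ad s Js).
have hN s : J s -> has_wderiv J N s (- (dA s * bil ('D_w G (x s)) w w)).
  move=> Js; have := has_wderiv_bil (metric_along_has_wderiv Js)
    (has_wderiv_cst J w s) (has_wderiv_cst J w s).
  have -> : bil (G (x s)) 0 w = 0 by rewrite /bil !mul0mx mxE.
  have -> : bil (G (x s)) w 0 = 0 by rewrite /bil trmx0 mulmx0 mxE.
  have -> : bil (dA s *: 'D_w G (x s)) w w = dA s * bil ('D_w G (x s)) w w.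
    by rewrite /bil -scalemxAr -scalemxAl mxE.
  rewrite !addr0 => H; have := has_wderivM (has_wderiv_cst J (-1 : R) s) H.
  rewrite mul0r add0r mulN1r; apply: eq_has_wderiv => //.
  by move=> t _; rewrite mulN1r.
have fb j : exists B, forall s, J s -> bil (G (x s)) w (E j c s) ^+ 2 <= B * N s.
  apply: (@quotient_bounded _ J _ N A dA
    (fun s => bil ('D_w G (x s)) w (E j c s) - 2^-1 * bil ('D_(E j c s) G (x s)) w w)
    (fun s => bil ('D_w G (x s)) w w) `|gram j j| C k d) => //.
  - by move=> s Js; apply: is_derive_has_wderiv; exact: hA.
  - by move=> s Js; exact: parallel_inner_has_wderiv.
  - move=> s Js; apply: le_trans (est s (E j c s) Js) _; rewrite ler_wpM2l// lerD2r.
    rewrite (parallel_gram_const (pE j) (pE j) Js Jt0).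
    by apply: le_trans (ler_norm _) _; rewrite [gram _ _]mxE.
have {fb}[b bP] := choice fb.
pose Bs := \sum_j `|b j|.
have Bs0 : 0 <= Bs by exact: sumr_ge0.
have fB s j : J s -> `|inner s 0 j| <= Num.sqrt (Bs * N s).
  move=> Js; rewrite -ler_sqr ?nnegrE ?sqrtr_ge0// real_normK ?num_real//.
  rewrite sqr_sqrtr; last by rewrite mulr_ge0// ltW// N0.
  rewrite [inner _ _ _]mxE (le_trans (bP j s Js))// ler_wpM2r ?(ltW (N0 s Js))//.
  by rewrite (le_trans (ler_norm _))// /Bs (bigD1 j)//= lerDl sumr_ge0.
pose K := n%:R * `|invmx gram|.
have entM i j : `|invmx gram i j| <= `|invmx gram|.
  by rewrite [leRHS]/Num.Def.normr/= mx_normrE (le_bigmax _ _ (i, j)).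
have VB s i : J s -> V i s ^+ 2 <= K ^+ 2 * Bs * (dA s ^+ 2 * N s).
  move=> Js; rewrite frame_componentE// exprMn [leRHS]mulrCA.
  rewrite ler_wpM2l ?sqr_ge0//.
  have NN : 0 <= Bs * N s by rewrite mulr_ge0// ltW// N0.
  rewrite -mulrA -[X in _ <= _ * X]sqr_sqrtr// -exprMn.
  rewrite -[leLHS]real_normK ?num_real// ler_sqr ?nnegrE ?mulr_ge0 ?sqrtr_ge0//.
  rewrite mxE (le_trans (ler_norm_sum _ _ _))//.
  have -> : K * Num.sqrt (Bs * N s) = \sum_(j < n) Num.sqrt (Bs * N s) * `|invmx gram|.
    by rewrite sumr_const card_ord -mulr_natl /K; ring.
  by apply: ler_sum => j _; rewrite normrM ler_pM// fB.
exists (n%:R * (K ^+ 2 * Bs) + 1); first by rewrite ltr_wpDl// !mulr_ge0// sqr_ge0.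
move=> s Js; have DN : 0 <= dA s ^+ 2 * N s by rewrite mulr_ge0 ?sqr_ge0// ltW// N0.
rewrite mulrDl mul1r ler_wpDr//.
have -> : n%:R * (K ^+ 2 * Bs) * (dA s ^+ 2 * N s) =
    \sum_(i < n) K ^+ 2 * Bs * (dA s ^+ 2 * N s).
  by rewrite sumr_const card_ord -[RHS]mulr_natl !mulrA.
by apply: ler_sum => i _; exact: VB.
Qed.

End ParallelFrame.

(** * Reparametrization by the integral of a positive continuous function *)

Section OrientedIntegral.
Context {R : realType}.
Implicit Types (J : set R) (S : R -> R).

Local Notation leb := (@lebesgue_measure R).

Lemma within_integrable J S a b : is_interval J -> {within J, continuous S} ->
  J a -> J b -> leb.-integrable `[a, b] (EFin \o S).
Proof.
move=> iJ cS Ja Jb; apply: continuous_compact_integrable; first exact: segment_compact.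
apply: continuous_subspaceW cS => t /=; rewrite in_itv/=; exact: iJ.
Qed.

Lemma integral_chasles J S p q r : is_interval J -> {within J, continuous S} ->
  J p -> J r -> p <= q -> q <= r ->
  \int[leb]_(s in `[p, r]) S s = \int[leb]_(s in `[p, q]) S s + \int[leb]_(s in `[q, r]) S s.
Proof.
move=> iJ cS Jp Jr pq qr.
have Jq : J q by apply: (iJ p r) => //; rewrite pq.
have := @Rintegral_itvB _ S (BLeft p) (BRight r) q (within_integrable iJ cS Jp Jr).
rewrite !bnd_simp => /(_ pq qr) H.
rewrite -[X in _ = _ + X]Rintegral_itv_obnd_cbnd -?H; first by rewrite addrC subrK.
apply: integrableS (within_integrable iJ cS Jq Jr) => //.
by apply: subset_itvr; rewrite bnd_simp.
Qed.

Lemma oriented_integralB J S t0 s u : is_interval J -> {within J, continuous S} ->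
  J t0 -> J s -> J u -> s <= u ->
  oriented_integral S t0 u - oriented_integral S t0 s = \int[leb]_(v in `[s, u]) S v.
Proof.
move=> iJ cS J0 Js Ju su; rewrite /oriented_integral.
have ch := fun p q r Jp Jr => @integral_chasles J S p q r iJ cS Jp Jr.
have [t0u|ut0] := leP t0 u; have [t0s|st0] := leP t0 s.
- by rewrite (ch t0 s u)// addrC addKr.
- by rewrite opprK addrC -(ch s t0 u)// ltW.
- by have := le_lt_trans su ut0; rewrite ltNge t0s.
- by rewrite opprK (ch s u t0)// ?(ltW ut0)// addrC addrK.
Qed.

Lemma fine_lebesgue_segment (s u : R) : s <= u -> fine (leb `[s, u]) = u - s.
Proof.
move=> su; rewrite lebesgue_measure_itv/= lte_fin.
by case: ltP => // us; apply/esym/eqP; rewrite subr_eq0 eq_le us su.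
Qed.

Lemma integral_le_cst J S s u (b : R) : is_interval J -> {within J, continuous S} ->
  J s -> J u -> s <= u -> (forall v, s <= v <= u -> S v <= b) ->
  \int[leb]_(v in `[s, u]) S v <= b * (u - s).
Proof.
move=> iJ cS Js Ju su Sb.
have -> : b * (u - s) = \int[leb]_(v in `[s, u]) b.
  by rewrite Rintegral_cst// fine_lebesgue_segment.
apply: le_Rintegral; first by [].
- exact: within_integrable iJ cS Js Ju.
- apply: (within_integrable iJ _ Js Ju); apply: continuous_subspaceT.
  by move=> v; exact: cst_continuous.
- by move=> v /=; rewrite in_itv/=; exact: Sb.
Qed.

Lemma integral_ge_cst J S s u (b : R) : is_interval J -> {within J, continuous S} ->
  J s -> J u -> s <= u -> (forall v, s <= v <= u -> b <= S v) ->
  b * (u - s) <= \int[leb]_(v in `[s, u]) S v.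
Proof.
move=> iJ cS Js Ju su Sb.
have -> : b * (u - s) = \int[leb]_(v in `[s, u]) b.
  by rewrite Rintegral_cst// fine_lebesgue_segment.
apply: le_Rintegral; first by [].
- apply: (within_integrable iJ _ Js Ju); apply: continuous_subspaceT.
  by move=> v; exact: cst_continuous.
- exact: within_integrable iJ cS Js Ju.
- by move=> v /=; rewrite in_itv/=; exact: Sb.
Qed.

Lemma oriented_integral_has_wderiv J S t0 s : is_interval J ->
  {within J, continuous S} -> J t0 -> J s ->
  has_wderiv J (oriented_integral S t0) s (S s).
Proof.
move=> iJ cS J0 Js; apply/has_wderivP => e e0.
have /cvgrPdist_le/(_ e e0)/within_nbhsP[d d0 dP] := iffLR (within_continuousP _ _) cS s Js.
exists d => // u ud Ju us.
have near_s v : `|v - s| <= `|u - s| -> J v -> S s - e <= S v <= S s + e.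
  move=> vs Jv; have := dP v (le_lt_trans vs ud) Jv.
  by rewrite ler_distlC => /andP[]; rewrite !lerBlDr => -> ->.
have us0 : u - s != 0 by rewrite subr_eq0.
rewrite ler_distlC [_ *: _]mulrC.
have [su|us'] := leP s u.
  have su0 : 0 < u - s by rewrite lt_def us0 subr_ge0.
  rewrite (oriented_integralB iJ cS)// ler_pdivlMr// ler_pdivrMr//.
  have B v : s <= v <= u -> S s - e <= S v <= S s + e.
    move=> /andP[sv vu]; apply: near_s; last by apply: (iJ s u) => //; rewrite sv.
    by rewrite !ger0_norm ?subr_ge0// lerD2r.
  apply/andP; split.
    by apply: (integral_ge_cst iJ cS) => // v vI; case/andP: (B v vI).
  by apply: (integral_le_cst iJ cS) => // v vI; case/andP: (B v vI).
have us1 := ltW us'; have su0 : 0 < s - u by rewrite subr_gt0.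
rewrite -(opprB s u) -(opprB (oriented_integral S t0 s)) invrN mulrNN.
rewrite (oriented_integralB iJ cS)//.
rewrite ler_pdivlMr// ler_pdivrMr//.
have B v : u <= v <= s -> S s - e <= S v <= S s + e.
  move=> /andP[uv vs]; apply: near_s; last by apply: (iJ u s) => //; rewrite uv.
  by rewrite !ler0_norm ?subr_le0// lerN2 lerD2r.
apply/andP; split.
  by apply: (integral_ge_cst iJ cS) => // v vI; case/andP: (B v vI).
by apply: (integral_le_cst iJ cS) => // v vI; case/andP: (B v vI).
Qed.

End OrientedIntegral.

(** [mu] has positive derivative [S] on the interval [J]. *)
Section Reparametrization.
Context {R : realType}.
Variables (J : set R) (mu S : R -> R) (s0 : R).
Hypotheses (iJ : is_interval J) (nJ : no_isolated J).
Hypothesis dmu : forall s, J s -> has_wderiv J mu s (S s).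
Hypothesis S0 : forall s, J s -> 0 < S s.

Lemma param_increasing r s : J r -> J s -> r < s -> mu r < mu s.
Proof.
move=> Jr Js rs; have [c Jc E] := within_MVT iJ dmu Jr Js rs.
by rewrite -subr_gt0 E mulr_gt0 ?S0// subr_gt0.
Qed.

Lemma param_le r s : J r -> J s -> mu r < mu s -> r < s.
Proof.
move=> Jr Js; apply: contraTT; rewrite -!leNgt le_eqVlt => /predU1P[->//|sr].
by rewrite ltW// param_increasing.
Qed.

Lemma param_inj : set_inj J mu.
Proof.
move=> r s /set_mem Jr /set_mem Js E.
by have [/(param_increasing Jr Js)|/(param_increasing Js Jr)|//] := ltgtP r s;
  rewrite E ltxx.
Qed.

(** The inverse of [mu] on [mu @` J]; its values elsewhere are irrelevant. *)
Definition inverse_param (u : R) : R := xget s0 [set s | J s /\ mu s = u].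

Local Notation nu := inverse_param.

Lemma inverse_paramP u : (mu @` J) u -> J (nu u) /\ mu (nu u) = u.
Proof.
move=> [s Js <-]; rewrite /inverse_param.
by case: xgetP => [r _ []//|/(_ s)]; case.
Qed.

Lemma inverse_paramK s : J s -> nu (mu s) = s.
Proof.
move=> Js; have [|J1 E] := @inverse_paramP (mu s); first by exists s.
by apply: param_inj; rewrite ?inE.
Qed.

(** Monotonicity is enough; no continuity of [mu] is used. *)
Lemma inverse_param_near s e : J s -> 0 < e -> exists2 d, 0 < d &
  forall u, (mu @` J) u -> `|u - mu s| < d -> `|nu u - s| < e.
Proof.
move=> Js e0.
have [d1 d10 P1] : exists2 d, 0 < d & forall r, J r -> mu r < mu s + d -> r < s + e.
  have [Jse|nJse] := pselect (J (s + e)).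
    exists (mu (s + e) - mu s).
      by rewrite subr_gt0 param_increasing// ltrDl.
    by move=> r Jr; rewrite addrC subrK; exact: param_le.
  exists 1 => // r Jr _; rewrite ltNge; apply/negP => ser; apply: nJse.
  by apply: (iJ Js Jr); rewrite ser lerDl ltW.
have [d2 d20 P2] : exists2 d, 0 < d & forall r, J r -> mu s - d < mu r -> s - e < r.
  have [Jse|nJse] := pselect (J (s - e)).
    exists (mu s - mu (s - e)).
      by rewrite subr_gt0 param_increasing// ltrBlDr ltrDl.
    by move=> r Jr; rewrite opprB addrC subrK; exact: param_le.
  exists 1 => // r Jr _; rewrite ltNge; apply/negP => ser; apply: nJse.
  by apply: (iJ Jr Js); rewrite ser lerBlDr lerDl ltW.
exists (Num.min d1 d2); first by rewrite lt_min d10.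
move=> u uJ; have [Jn <-] := inverse_paramP uJ; rewrite inverse_paramK//.
rewrite lt_min !ltr_distl => /andP[/andP[_ h1] /andP[h2 _]].
by rewrite P1// P2.
Qed.

Lemma inverse_param_cvg s : J s ->
  nu @ within (mu @` J) (nbhs (mu s)) --> within J (nbhs s).
Proof.
move=> Js P /within_nbhsP[e e0 eP]; apply/within_nbhsP.
have [d d0 dP] := inverse_param_near Js e0; exists d => // u ud uJ.
by apply: eP; [exact: dP|have [] := inverse_paramP uJ].
Qed.

Lemma inverse_param_dnbhs s : J s ->
  nu @ within (mu @` J) (mu s)^' --> within J s^'.
Proof.
move=> Js P /within_dnbhsP[e e0 eP]; apply/within_dnbhsP.
have [d d0 dP] := inverse_param_near Js e0; exists d => // u ud uJ us.
apply: eP; [exact: dP|by have [] := inverse_paramP uJ|].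
by apply: contra us => /eqP <-; have [_ ->] := inverse_paramP uJ.
Qed.

Lemma param_image_no_isolated : no_isolated (mu @` J).
Proof.
apply/no_isolatedP => _ d [s Js <-] d0.
have /cvgrPdist_lt/(_ d d0)/within_nbhsP[e e0 eP] := has_wderiv_cvg (dmu Js).
have [r [re Jr rs]] := iffLR (no_isolatedP _) nJ s e Js e0.
exists (mu r); split; [by rewrite distrC; exact: eP|by exists r|].
by apply: contra rs => /eqP /(param_inj (mem_set Jr) (mem_set Js)) ->.
Qed.

Lemma reparam_has_wderiv {W : normedModType R} (f : R -> W) s l : J s ->
  has_wderiv J f s l -> has_wderiv (mu @` J) (f \o nu) (mu s) ((S s)^-1 *: l).
Proof.
move=> Js df.
have Q : (fun r => (diff_quot mu s r)^-1 *: diff_quot f s r) @ within J s^' -->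
    (S s)^-1 *: l.
  have H : (fun r => (diff_quot mu s r)^-1) @ within J s^' --> (S s)^-1.
    by apply: cvgV; [rewrite gt_eqF// S0|exact: dmu].
  exact: cvgZ H df.
have QN := cvg_comp _ _ (inverse_param_dnbhs Js) Q.
apply: cvg_trans QN; apply: near_eq_cvg; apply/within_dnbhsP.
exists 1 => // u _ uJ us; have [Jr mr] := inverse_paramP uJ.
rewrite /diff_quot /= inverse_paramK// mr invfM invrK [X in X *: _]mulrC.
rewrite [(u - mu s)^-1 * _]mulrC scalerA mulrAC mulfV ?mul1r//.
by rewrite subr_eq0; apply: contra us => /eqP <-; rewrite mr.
Qed.

Lemma reparam_continuous {T : topologicalType} (f : R -> T) :
  {within J, continuous f} -> {within mu @` J, continuous (f \o nu)}.
Proof.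
move=> /within_continuousP cf; apply/within_continuousP => _ [s Js <-].
rewrite /= inverse_paramK//; apply: cvg_comp (inverse_param_cvg Js) _.
exact: cf.
Qed.

End Reparametrization.

(** * Charts, signature and the radical direction *)

Section Charts.
Context {R : realType} {n : nat} {T : topologicalType} (c : chart R n T).

Lemma coord_cont_at p : cdom c p -> {for p, continuous (coord c)}.
Proof.
move=> cp; have := @coord_cont _ _ _ c; rewrite continuous_open_subspace; last exact: cdom_open.
by apply; rewrite inE.
Qed.

Lemma cinv_cont_at x : (coord c @` cdom c) x -> {for x, continuous (cinv c)}.
Proof.
move=> Ux; have := @cinv_cont _ _ _ c; rewrite continuous_open_subspace; last exact: cimg_open.
by apply; rewrite inE.
Qed.

Lemma cinv_dom x : (coord c @` cdom c) x -> cdom c (cinv c x) /\ coord c (cinv c x) = x.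
Proof. by move=> [p cp <-]; rewrite coordK. Qed.

Lemma cinv_preimage_open (B : set T) : open B ->
  open (coord c @` cdom c `&` cinv c @^-1` B).
Proof.
move=> oB; rewrite openE => x [Ux Bx]; rewrite /interior; apply: filterI.
  by apply: open_nbhs_nbhs; split=> //; exact: cimg_open.
by apply: (cinv_cont_at Ux); exact: open_nbhs_nbhs.
Qed.

Lemma chart_overlapE (B : set T) :
  coord c @` (cdom c `&` B) = coord c @` cdom c `&` cinv c @^-1` B.
Proof.
apply/seteqP; split=> x.
  by move=> [p [cp Bp] <-]; split; [exists p|rewrite /= coordK].
by move=> [[p cp <-]]; rewrite /= coordK// => Bp; exists p.
Qed.

End Charts.

Section Signature.
Context {R : realType} {n : nat} {M : smoothManifold R n} (g : symTensor M).
Implicit Types (p : M) (c : chart R n M) (MR : set M).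

(* the normal form with k entries -1 *)
Let sig k : 'M[R]_n := diag_mx (\row_(i < n) (if (i < k)%N then -1 else 1)).

Lemma det_sig0 : \det (sig 0) = 1.
Proof. by rewrite det_diag big1// => i _; rewrite mxE. Qed.

Lemma det_sig1 : (0 < n)%N -> \det (sig 1) = -1.
Proof.
move=> n0; rewrite det_diag (bigD1 (Ordinal n0))//= mxE/= big1 ?mulr1//.
move=> i; rewrite mxE ltnS leqn0 => i0; rewrite ifF//; apply/negbTE.
by apply: contra i0 => /eqP i0; apply/eqP/val_inj.
Qed.

Lemma signature_det k p c : signature_at g k p -> charts_at p c ->
  exists2 a, 0 < a & a * \det (gcomp g c p) = \det (sig k).
Proof.
move=> sg /sg[P uP E]; exists (\det P ^+ 2).
  by rewrite exprn_even_gt0//=; move: uP; rewrite unitmxE unitfE.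
by rewrite /sig -E !det_mulmx det_tr; ring.
Qed.

Lemma riemannian_det p c : riemannian_at g p -> charts_at p c ->
  0 < \det (gcomp g c p).
Proof.
move=> rp cp; have [a a0] := signature_det (k := 0) rp cp.
by rewrite det_sig0 => E; rewrite -(pmulr_rgt0 _ a0) E.
Qed.

Lemma riemannian_psd p c u : riemannian_at g p -> charts_at p c ->
  0 <= bil (gcomp g c p) u u.
Proof.
move=> rp cp; have [P uP E] := rp c cp.
rewrite -(mulmxKV uP u) -bil_congr E /bil mul_mx_diag mxE sumr_ge0// => i _.
by rewrite !mxE mulr1 -expr2 sqr_ge0.
Qed.

Lemma lorentzian_det p c : (0 < n)%N -> lorentzian_at g p -> charts_at p c ->
  \det (gcomp g c p) < 0.
Proof.
move=> n0 lp cp; have [a a0] := signature_det (k := 1) lp cp.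
by rewrite det_sig1// => E; rewrite -(pmulr_rlt0 _ a0) E ltrN10.
Qed.

Lemma degenerate_det p c : degenerate_at g p -> charts_at p c ->
  \det (gcomp g c p) = 0.
Proof.
move=> dp cp; have [u u0 ru] := dp c cp; apply/eqP/det0P; exists u => //.
apply/rowP => i; have := ru 'e_i.
by rewrite /gval trmx_delta -colE !mxE.
Qed.

Variable MR : set M.
Hypothesis hg : signature_type_changing g MR.
Hypothesis n0 : (0 < n)%N.

Lemma det_pos_riemannian p c : charts_at p c -> 0 < \det (gcomp g c p) ->
  riemannian_at g p.
Proof.
move=> cp dp; have [_ _ hR hL] := hg.
have [MRp|nMR] := pselect (MR p); first exact: hR.
have nH : ~ hypersurface g p.
  by move=> Hp; move: dp; rewrite (degenerate_det Hp cp) ltxx.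
by have := lorentzian_det n0 (hL p nH nMR) cp; rewrite ltNge (ltW dp).
Qed.

Lemma det_neg_lorentzian p c : charts_at p c -> \det (gcomp g c p) < 0 ->
  lorentzian_part g MR p.
Proof.
move=> cp dp; have [_ _ hR hL] := hg; split.
  by move=> Hp; move: dp; rewrite (degenerate_det Hp cp) ltxx.
by move=> /hR rp; have := riemannian_det rp cp; rewrite ltNge (ltW dp).
Qed.

Lemma lorentzian_part_det p c : charts_at p c -> lorentzian_part g MR p ->
  \det (gcomp g c p) < 0.
Proof.
move=> cp [nH nMR]; have [_ _ hR hL] := hg.
exact: lorentzian_det (hL p nH nMR) cp.
Qed.

End Signature.

Lemma interval_no_isolated {R : realType} (J : set R) (p q : R) :
  is_interval J -> J p -> J q -> p < q -> no_isolated J.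
Proof.
move=> iJ Jp Jq pq; apply/no_isolatedP => t d Jt d0.
have [tq|qt] := ltP t q.
  pose s := t + Num.min (d / 2) (q - t).
  have m0 : 0 < Num.min (d / 2) (q - t) by rewrite lt_min divr_gt0// subr_gt0.
  exists s; split.
  - rewrite /s addrAC subrr add0r gtr0_norm// gt_min; apply/orP; left; lra.
  - apply: (iJ t q) => //; rewrite /s lerDl ltW//= -lerBrDl ge_min lexx orbT//.
  - by rewrite /s -subr_eq0 addrAC subrr add0r gt_eqF.
pose s := t - Num.min (d / 2) (t - p).
have m0 : 0 < Num.min (d / 2) (t - p).
  by rewrite lt_min divr_gt0// subr_gt0 (lt_le_trans pq).
exists s; split.
- by rewrite /s addrAC subrr add0r normrN gtr0_norm// gt_min; apply/orP; left; lra.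
- apply: (iJ p t) => //; rewrite /s lerBlDr lerDl (ltW m0) andbT lerBrDr -lerBrDl.
  by rewrite ge_min lexx orbT.
- by rewrite /s -subr_eq0 addrAC subrr add0r oppr_eq0 gt_eqF.
Qed.

Section RadicalDirection.
Context {R : realType} {n : nat} {M : smoothManifold R n} (g : symTensor M).
Variables (c : chart R n M) (q : M).
Hypotheses (hq : hypersurface g q) (cq : charts_at q c).

Let D (x : 'rV[R]_n) : R := \det (gcomp g c (cinv c x)).

Lemma differentiable_chart_det p : cdom c p -> differentiable D (coord c p).
Proof.
move=> cp; have [ac _] := cq; apply: differentiable_det => i j.
have := C1_differentiable (@chart_img_open _ _ _ c) _ (chart_metric_C1 g ac) (x := coord c p).
move=> /(_ (ex_intro2 _ _ p cp erefl)) dG.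
apply: (@differentiable_comp _ _ _ _ (fun x => gcomp g c (cinv c x))
  (fun N : 'M[R]_n => N i j)) => //.
exact: differentiable_coord.
Qed.

(** The determinant of the metric vanishes along curves in the hypersurface. *)
Lemma tangent_det_derive u : tangent_space (hypersurface g) q c u ->
  'D_u D (coord c q) = 0.
Proof.
move=> [d [sigma [d0 ssig sq sH vel]]]; have [ac cdq] := cq.
set I := `]- d, d[%classic in ssig sH vel.
have [csig /(_ c ac)[_ [dsig _]]] := ssig 1%N.
pose K := I `&` sigma @^-1` cdom c.
have I0 : I 0 by rewrite /I/= in_itv/= oppr_lt0 d0.
have nI : nbhs (0 : R) I by apply: near_in_itvoo; rewrite in_itv/= oppr_lt0 d0.
have nK : nbhs (0 : R) K.
  have := iffLR (within_continuousP _ _) csig 0 I0; rewrite sq.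
  move=> /(_ (cdom c)) /(_ _)/within_nbhsP[].
    by apply: open_nbhs_nbhs; split=> //; exact: cdom_open.
  move=> e e0 eP; apply: filterI => //; move: nI => /nbhs_ballP[e' /= e'0 e'P].
  apply/nbhs_ballP; exists (Num.min e e'); first by rewrite /= lt_min e0.
  move=> s; rewrite -ball_normE /= sub0r normrN lt_min => /andP[se se'].
  apply: eP; first by rewrite subr0.
  by apply: e'P; rewrite -ball_normE /= sub0r normrN.
have K0 : K 0 by exact: nbhs_singleton.
have der : is_derive (0 : R) (1 : R) (coord c \o sigma) u.
  have L := has_wderiv_is_derive nK (wderivable_has_wderiv (dsig 0 K0)).
  rewrite -vel /velocity.
  suff -> : wderive I (coord c \o sigma) 0 = wderive K (coord c \o sigma) 0 by [].
  apply: has_wderiv_wderive => //; last exact: is_derive_has_wderiv.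
  apply: (@interval_no_isolated _ _ 0 (d / 2)) => //.
  - exact: interval_is_interval.
  - by rewrite /I/= in_itv/=; lra.
  - by rewrite divr_gt0.
have := is_derive_comp_diff der (F := D); rewrite /= sq.
move=> /(_ (differentiable_chart_det cdq)) derD.
have : is_derive (0 : R) (1 : R) (fun s => D (coord c (sigma s))) 0.
  have C := @is_derive_cst R R R 0 0 1.
  apply: near_eq_is_derive C.
  apply: filterS nK => s [Is cs]; rewrite /D coordK//.
  by apply/esym/degenerate_det; [apply: sH; exists s|split].
by move=> [_ E]; rewrite -E; case: derD => _ ->.
Qed.

(** The differential of the determinant kills the tangent space of the
    hypersurface; since the radical is transverse to it, some vector of the radical
    is not killed. *)
Lemma radical_direction : transverse_type_change g -> transverse_radical g ->
  exists w, w *m gcomp g c q = 0 /\ 'D_w D (coord c q) < 0.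
Proof.
move=> htype hrad; have [ac cdq] := cq.
have dD := differentiable_chart_det cdq.
have [v dv] := htype q c hq cq.
have [w [u [rw tu vE]]] := hrad q c hq cq v.
have wg : w *m gcomp g c q = 0.
  apply/rowP => i; have := rw 'e_i.
  by rewrite /gval trmx_delta -colE !mxE.
have dw : 'D_w D (coord c q) != 0.
  by move: dv; rewrite vE linearD/= -!deriveE// (tangent_det_derive tu) addr0.
have [dw0|dw0|dw0] := ltgtP ('D_w D (coord c q)) 0.
- by exists w.
- exists (- w); rewrite mulNmx wg oppr0; split=> //.
  by rewrite deriveE// linearN/= -deriveE// oppr_lt0.
- by rewrite dw0 eqxx in dw.
Qed.

End RadicalDirection.

(** * Planar curves of a chart as curves of the manifold *)

Section PlanarCurve.
Context {R : realType} {n : nat} {M : smoothManifold R n}.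
Variable c0 : chart R n M.
Hypothesis ac0 : atlas c0.
Variables (x0 w e : 'rV[R]_n) (a b : R -> R).
Hypotheses (sa : smooth_fun a) (sb : smooth_fun b).

Let x (s : R) : 'rV[R]_n := x0 + a s *: w + b s *: e.
Let U : set 'rV[R]_n := coord c0 @` cdom c0.
Let gamma (s : R) : M := cinv c0 (x s).

Variable J : set R.
Hypothesis JU : forall s, J s -> U (x s).

Lemma transition_differentiable c y : atlas c -> U y -> cdom c (cinv c0 y) ->
  differentiable (transition c0 c) y.
Proof.
move=> ac Uy cy; have [H _] := atlas_compatible ac0 ac.
apply: (C1_differentiable _ _ (H 1%N)); rewrite chart_overlapE//.
by apply: cinv_preimage_open; exact: cdom_open.
Qed.

Lemma planar_curve_continuous_at s : J s -> {for s, continuous gamma}.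
Proof.
move=> Js; apply: (@continuous_comp _ _ _ x (cinv c0)).
  exact: planar_continuous.
by apply: cinv_cont_at; exact: JU.
Qed.

Lemma planar_curve_continuous : {within J, continuous gamma}.
Proof.
apply/within_continuousP => s Js.
by apply: cvg_within_filter; exact: planar_curve_continuous_at.
Qed.

Lemma planar_coord_is_derive c s a' b' : J s -> charts_at (gamma s) c ->
  is_derive s (1 : R) a a' -> is_derive s (1 : R) b b' ->
  is_derive s (1 : R) (coord c \o gamma)
    ((a' *: w + b' *: e) *m trans_jac c0 c (gamma s)).
Proof.
move=> Js [ac cs] da db; have Ux := JU Js.
have dF := transition_differentiable ac Ux cs.
have [_ xE] := cinv_dom Ux.
have -> : trans_jac c0 c (gamma s) = jacobian (transition c0 c) (x s).
  by rewrite /trans_jac /gamma xE.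
rewrite -(deriveEjacobian _ dF).
exact: is_derive_comp_diff (is_derive_planar x0 w e da db) dF.
Qed.

Lemma planar_curve_differentiable : differentiable_curve J gamma.
Proof.
split; first exact: planar_curve_continuous.
move=> s c Js cs.
have [a' da _] := smooth_fun_derive sa; have [b' db _] := smooth_fun_derive sb.
apply: has_wderiv_wderivable; apply: is_derive_has_wderiv.
exact: planar_coord_is_derive.
Qed.

Lemma planar_curve_velocity c s a' b' : no_isolated J -> J s ->
  charts_at (gamma s) c ->
  is_derive s (1 : R) a a' -> is_derive s (1 : R) b b' ->
  velocity c J gamma s = (a' *: w + b' *: e) *m trans_jac c0 c (gamma s).
Proof.
move=> nJ Js cs da db; apply: has_wderiv_wderive => //.
by apply: is_derive_has_wderiv; exact: planar_coord_is_derive.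
Qed.

Lemma planar_curve_smooth : no_isolated J -> smooth_curve J gamma.
Proof.
move=> nJ k; split; first exact: planar_curve_continuous.
move=> c ac; have [H _] := atlas_compatible ac0 ac.
set K := J `&` gamma @^-1` cdom c.
have oU' : open (coord c0 @` (cdom c0 `&` cdom c)).
  by rewrite chart_overlapE; apply: cinv_preimage_open; exact: cdom_open.
have KU s : K s -> (coord c0 @` (cdom c0 `&` cdom c)) (x s).
  by move=> [Js cs]; rewrite chart_overlapE; split=> //; exact: JU.
apply: (Ck_within_planar (x0 := x0) (w := w) (e := e) sa sb oU' _ KU (H k)).
apply/no_isolatedP => s d [Js cs] d0.
have : nbhs s (gamma @^-1` cdom c).
  apply: (planar_curve_continuous_at Js).
  by apply: open_nbhs_nbhs; split=> //; exact: cdom_open.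
move=> /nbhs_ballP[d' /= d'0 dP].
have m0 : 0 < Num.min d d' by rewrite lt_min d0.
have [r [rs Jr rn]] := iffLR (no_isolatedP _) nJ s _ Js m0.
move: rs; rewrite lt_min => /andP[rd rd'].
exists r; split=> //; split=> //.
by apply: dP; rewrite -ball_normE /= distrC.
Qed.

End PlanarCurve.

Lemma gval_trans {R : realType} {n : nat} {M : smoothManifold R n} (g : symTensor M)
    (c c' : chart R n M) p v : charts_at p c -> charts_at p c' ->
  gval g c' p (v *m trans_jac c c' p) (v *m trans_jac c c' p) = gval g c p v v.
Proof.
move=> cp cp'; rewrite /gval (gcomp_trans g cp cp') trmx_mul.
by rewrite !mulmxA.
Qed.

(** * The profile of the loop *)

Section LoopProfile.
Context {R : realType}.

Lemma flat_gt0 m (s : R) : 0 < s -> 0 < flat m s.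
Proof. by move=> s0; rewrite /flat s0 mulr_gt0 ?exprn_gt0 ?invr_gt0 ?expR_gt0. Qed.

Lemma flat_le0 m (s : R) : s <= 0 -> flat m s = 0.
Proof. by move=> s0; rewrite /flat ltNge s0. Qed.

Lemma flat_mono (s t : R) : s <= t -> flat 0 s <= flat 0 t.
Proof.
move=> st; have [s0|s0] := ltP 0 s; last first.
  rewrite (flat_le0 _ s0); have [t0|t0] := ltP 0 t; last by rewrite flat_le0.
  exact/ltW/flat_gt0.
have t0 := lt_le_trans s0 st.
by rewrite /flat s0 t0 !expr0 !mul1r ler_expR lerN2 lef_pV2.
Qed.

Variables (t1 d r : R).
Hypotheses (t10 : t1 < 0) (d0 : 0 < d).

(** Coordinate along the radical line: equal to [t1] on [-1, 1], increasing in
    [|s|] beyond, and equal to [d] at [-2] and [2], where [s ^+ 2 - 1 = 3]. *)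
Definition height (s : R) : R := t1 + (d - t1) / flat 0 3 * flat 0 (s ^+ 2 - 1).

(** The derivative of [height]. *)
Definition dheight (s : R) : R :=
  (d - t1) / flat 0 3 * (flat 2 (s ^+ 2 - 1) * (2 * s)).

(** Angle along the circle: it vanishes outside [-1, 1] and takes the value
    [2 * pi] at [0]. *)
Definition angle (s : R) : R := 2 * pi * expR 1 * flat 0 (1 - s ^+ 2).

(** The derivative of [angle]. *)
Definition dangle (s : R) : R :=
  2 * pi * expR 1 * (flat 2 (1 - s ^+ 2) * (- (2 * s))).

(** Components of the loop along [w] and along the transverse axis [e].  Both are
    even: for [s] in [-1, 1] the loop goes once round a circle of radius [r] that
    meets the radical line at [t1], and back again. *)
Definition loop_a (s : R) : R := height s + r * (cos (angle s) - 1).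
Definition loop_b (s : R) : R := r * sin (angle s).

Let K0 : 0 < (d - t1) / flat 0 3.
Proof. by rewrite divr_gt0 ?flat_gt0// subr_gt0 (lt_trans t10). Qed.

Let smooth_sq : smooth_fun (fun s : R => s ^+ 2).
Proof.
have -> : (fun s : R => s ^+ 2) = (fun s => s * s) by apply/funext => s; rewrite expr2.
by apply: smooth_funM; exact: smooth_fun_id.
Qed.

Lemma smooth_height : smooth_fun height.
Proof.
apply: smooth_funD; first exact: smooth_fun_cst.
apply: smooth_funM; first exact: smooth_fun_cst.
apply: (smooth_fun_comp (p := flat 0) (q := fun s => s ^+ 2 + -1)).
  exact: smooth_flat.
by apply: smooth_funD => //; exact: smooth_fun_cst.
Qed.

Lemma smooth_angle : smooth_fun angle.
Proof.
apply: smooth_funM; first exact: smooth_fun_cst.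
have -> : (fun s : R => flat 0 (1 - s ^+ 2)) = (fun s => flat 0 (1 + -1 * s ^+ 2)).
  by apply/funext => s; rewrite mulN1r.
apply: (smooth_fun_comp (p := flat 0) (q := fun s => 1 + -1 * s ^+ 2)).
  exact: smooth_flat.
apply: smooth_funD; first exact: smooth_fun_cst.
by apply: smooth_funM => //; exact: smooth_fun_cst.
Qed.

Lemma smooth_loop_a : smooth_fun loop_a.
Proof.
apply: smooth_funD; first exact: smooth_height.
apply: smooth_funM; first exact: smooth_fun_cst.
apply: (smooth_funD (p := fun s => cos (angle s)) (q := fun=> -1)); last exact: smooth_fun_cst.
by apply: smooth_fun_comp; [have [] := @smooth_fun_cos_sin R|exact: smooth_angle].
Qed.

Lemma smooth_loop_b : smooth_fun loop_b.
Proof.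
apply: smooth_funM; first exact: smooth_fun_cst.
by apply: smooth_fun_comp; [have [] := @smooth_fun_cos_sin R|exact: smooth_angle].
Qed.

Let sq_derive (s : R) : is_derive s (1 : R) (fun s : R => s ^+ 2) (2 * s).
Proof.
have := is_deriveX 2 (is_derive_id s (1 : R)).
rewrite (_ : id ^+ 2 = (fun s : R => s ^+ 2)); last by rewrite exprfctE.
by rewrite [_ *: _]mulr1 expr1.
Qed.

Let flat0_derive (s : R) : is_derive s (1 : R) (flat 0) (flat 2 s).
Proof. by apply: is_derive_eq; first exact: flat_derive; rewrite oppr0 mul0r add0r. Qed.

Let scale_derive (k s l : R) (f : R -> R) : is_derive s (1 : R) f l ->
  is_derive s (1 : R) (fun t => k * f t) (k * l).
Proof.
move=> df; have := is_deriveM (is_derive_cst k s (1 : R)) df.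
by rewrite scaler0 addr0.
Qed.

Lemma height_derive (s : R) : is_derive s (1 : R) height (dheight s).
Proof.
have d1 : is_derive s (1 : R) (fun s : R => s ^+ 2 - 1) (2 * s).
  have := is_deriveD (sq_derive s) (is_derive_cst (-1 : R) s (1 : R)).
  by rewrite addr0.
have d2 := @is_derive1_comp _ (flat 0) (fun s : R => s ^+ 2 - 1) _ _ _ (flat0_derive _) d1.
have := is_deriveD (is_derive_cst t1 s (1 : R)) (scale_derive ((d - t1) / flat 0 3) d2).
by rewrite add0r.
Qed.

Lemma angle_derive (s : R) : is_derive s (1 : R) angle (dangle s).
Proof.
have d1 : is_derive s (1 : R) (fun s : R => 1 - s ^+ 2) (- (2 * s)).
  have := is_deriveB (is_derive_cst (1 : R) s (1 : R)) (sq_derive s).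
  by rewrite sub0r.
have d2 := @is_derive1_comp _ (flat 0) (fun s : R => 1 - s ^+ 2) _ _ _ (flat0_derive _) d1.
exact: scale_derive d2.
Qed.

Lemma heightN s : height (- s) = height s.
Proof. by rewrite /height sqrrN. Qed.

Lemma angleN s : angle (- s) = angle s.
Proof. by rewrite /angle sqrrN. Qed.

Lemma height2 : height 2 = d.
Proof.
rewrite /height (_ : 2 ^+ 2 - 1 = 3 :> R); last by rewrite expr2; lra.
by rewrite divfK ?gt_eqF ?flat_gt0//; lra.
Qed.

Lemma height_mono s t : s ^+ 2 <= t ^+ 2 -> height s <= height t.
Proof.
move=> st; rewrite /height lerD2l ler_wpM2l ?(ltW K0)//.
by apply: flat_mono; rewrite lerD2r.
Qed.

Lemma height_in s : s ^+ 2 <= 1 -> height s = t1.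
Proof. by move=> s1; rewrite /height (@flat_le0 0 (_ - _)) ?mulr0 ?addr0// subr_le0. Qed.

Lemma height_bounds s : -2 <= s <= 2 -> t1 <= height s <= d.
Proof.
move=> /andP[s1 s2]; apply/andP; split; last by rewrite -height2 height_mono//; nra.
rewrite /height lerDl mulr_ge0 ?(ltW K0)//.
have [s3|s3] := ltP 0 (s ^+ 2 - 1); first exact/ltW/flat_gt0.
by rewrite flat_le0.
Qed.

Lemma height_pos_sq s : 0 < height s -> 1 < s ^+ 2.
Proof.
move=> hs; rewrite ltNge; apply/negP => s1.
by move: hs; rewrite height_in// ltNge ltW.
Qed.

Lemma angle_out s : 1 <= s ^+ 2 -> angle s = 0.
Proof. by move=> s1; rewrite /angle flat_le0 ?mulr0// subr_le0. Qed.

Lemma angle0 : angle 0 = 2 * pi.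
Proof.
rewrite /angle expr0n subr0 /flat ltr01 expr0 mul1r invr1 -mulrA.
by rewrite -expRD subrr expR0 mulr1.
Qed.

Lemma loop_a_out (s : R) : 1 <= s ^+ 2 -> loop_a s = height s.
Proof. by move=> s1; rewrite /loop_a angle_out// cos0 subrr mulr0 addr0. Qed.

Lemma loop_b_out (s : R) : 1 <= s ^+ 2 -> loop_b s = 0.
Proof. by move=> s1; rewrite /loop_b angle_out// sin0 mulr0. Qed.

Lemma loop_a_derive (s : R) : 1 <= s ^+ 2 -> is_derive s (1 : R) loop_a (dheight s).
Proof.
move=> s1.
have d1 := @is_derive1_comp _ cos angle _ _ _ (is_derive_cos _) (angle_derive s).
have d2 := is_deriveD d1 (is_derive_cst (-1 : R) s (1 : R)).
have := is_deriveD (height_derive s) (scale_derive r d2).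
by rewrite angle_out// sin0 oppr0 mul0r addr0 mulr0 addr0.
Qed.

Lemma loop_b_derive (s : R) : 1 <= s ^+ 2 -> is_derive s (1 : R) loop_b 0.
Proof.
move=> s1.
have d1 := @is_derive1_comp _ sin angle _ _ _ (is_derive_sin _) (angle_derive s).
have := scale_derive r d1.
by rewrite /dangle (@flat_le0 2) ?subr_le0// mul0r !mulr0.
Qed.

Lemma dheight_gt0 (s : R) : 1 < s ^+ 2 -> 0 < s -> 0 < dheight s.
Proof.
move=> s1 s0; rewrite /dheight mulr_gt0// mulr_gt0 ?mulr_gt0//.
by rewrite flat_gt0// subr_gt0.
Qed.

Lemma dheightN s : dheight (- s) = - dheight s.
Proof. by rewrite /dheight sqrrN !mulrN. Qed.

Lemma dheight_continuous : continuous dheight.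
Proof.
have [q hq sq] := smooth_fun_derive smooth_height.
suff -> : dheight = q by exact: smooth_fun_continuous.
apply/funext => s; rewrite -(@derive_val _ _ _ _ _ _ _ (height_derive s)).
by rewrite derive_val.
Qed.

Lemma height_pos_point : exists2 p, 1 < p < 2 & 0 < height p.
Proof.
have h2 : \forall s \near (2 : R), 0 < height s.
  have := smooth_fun_continuous smooth_height (x := 2).
  by move=> /cvgr_gt; apply; rewrite height2.
have /nbhs_ballP[e /= e0 eP] := h2.
pose p : R := 2 - Num.min (2^-1) (e / 2).
have m0 : 0 < Num.min (2^-1 : R) (e / 2) by rewrite lt_min invr_gt0 ltr0n divr_gt0.
have m1 : Num.min (2^-1 : R) (e / 2) <= 2^-1 by rewrite ge_min lexx.
have m2 : Num.min (2^-1 : R) (e / 2) <= e / 2 by rewrite ge_min lexx orbT.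
exists p; first by rewrite /p; lra.
apply: eP; rewrite -ball_normE /= /p opprB addrC subrK gtr0_norm//; lra.
Qed.

(** Every point of the unit circle is reached by the angle. *)
Lemma angle_onto (X Y : R) : X ^+ 2 + Y ^+ 2 = 1 ->
  exists s, [/\ 0 <= s, s <= 1, cos (angle s) = X & sin (angle s) = Y].
Proof.
move=> XY.
have X1 : -1 <= X <= 1 by nra.
have [th [th0 th2 cth sth]] : exists th, [/\ 0 <= th, th <= 2 * pi, cos th = X & sin th = Y].
  have c0 := acos_ge0 X1; have cpi := acos_lepi X1.
  have sq : Num.sqrt (1 - X ^+ 2) = `|Y|.
    by rewrite (_ : 1 - X ^+ 2 = Y ^+ 2) ?sqrtr_sqr//; lra.
  have [Y0|Y0] := leP 0 Y.
    exists (acos X); split=> //; first by lra.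
      by rewrite acosK// in_itv.
    by rewrite sin_acos// sq ger0_norm.
  exists (2 * pi - acos X); split; [by lra|by lra| |].
    rewrite (mulr_natl pi 2) cosB cos2pi sin2pi mul1r mul0r addr0.
    by rewrite acosK// in_itv.
  rewrite (mulr_natl pi 2) sinB cos2pi sin2pi mul0r mul1r sub0r sin_acos// sq.
  by rewrite ler0_norm ?opprK// ltW.
have cA : {within `[0, 1], continuous angle}.
  by apply: continuous_subspaceT; exact: smooth_fun_continuous smooth_angle.
have [||s] := @IVT R angle 0 1 th _ cA.
- by [].
- by rewrite angle0 (@angle_out 1) ?expr1n// ge_min le_max th0 th2 !orbT.
rewrite in_itv/= => /andP[s0 s1] E.
by exists s; rewrite E.
Qed.

End LoopProfile.

(** * The loop *)

Section LoopComponent.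
Context {R : realType}.
Variables (t1 d : R).
Hypotheses (t10 : t1 < 0) (d0 : 0 < d).

Let T : set R := [set s | -2 <= s <= 2 /\ 0 < height t1 d s].

(** [T] is the set of parameters where the loop is Lorentzian; each component is a
    nondegenerate interval on one side of [0], as it reaches an end point of
    [-2, 2]. *)
Lemma loop_component t J : T t -> J = connected_component T t ->
  [/\ is_interval J, no_isolated J, J `<=` T
    & (forall s, J s -> 0 < s) \/ (forall s, J s -> s < 0)].
Proof.
move=> Tt JE.
have iJ : is_interval J by rewrite JE; apply/connected_intervalP/component_connected.
have JT : J `<=` T by rewrite JE; exact: connected_component_sub.
have Jt : J t by rewrite JE; exact: connected_component_refl.
have nJ0 s : J s -> s != 0.
  move=> /JT[_ /height_pos_sq-/(_ t10)]; apply: contraTneq => ->.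
  by rewrite expr0n/= ltr10.
have sgn : (forall s, J s -> 0 < s) \/ (forall s, J s -> s < 0).
  have [t0|t0|t0] := ltgtP t 0.
  - right=> s Js; rewrite ltNge; apply/negP => s0.
    have J0 : J 0 by apply: (iJ t s) => //; rewrite (ltW t0).
    by have := nJ0 0 J0; rewrite eqxx.
  - left=> s Js; rewrite ltNge; apply/negP => s0.
    have J0 : J 0 by apply: (iJ s t) => //; rewrite s0 ltW.
    by have := nJ0 0 J0; rewrite eqxx.
  - by have := nJ0 t Jt; rewrite t0 eqxx.
(* J contains every interval of T through t *)
have grow (v : R) (B : set R) : is_interval B -> B t -> B `<=` T -> B v -> J v.
  move=> iB Bt BT Bv; rewrite JE; apply: (connected_component_max Bt BT) => //.
  exact/connected_intervalP.
have comp2 v : J v -> J = connected_component T v.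
  by move=> Jv; rewrite JE; apply: same_connected_component; rewrite -JE.
have [p /andP[p1 p2] hp] := height_pos_point t1 d0.
have Tup (s v : R) : T s -> 0 < s -> s <= v <= 2 -> T v.
  move=> [/andP[sl sr] hs] s0 /andP[sv v2]; split; first by rewrite v2 andbT; lra.
  by apply: lt_le_trans hs _; apply: height_mono => //; nra.
have Tdown (s v : R) : T s -> s < 0 -> -2 <= v <= s -> T v.
  move=> [/andP[sl sr] hs] s0 /andP[v2 vs]; split; first by rewrite v2/=; lra.
  by apply: lt_le_trans hs _; apply: height_mono => //; nra.
have nJ : no_isolated J.
  case: sgn => sgn.
    have J2 : J 2.
      apply: (grow _ `[t, 2]%classic); [exact: interval_is_interval| | |].
      - by have [/andP[_ t2] _] := Tt; rewrite /= in_itv/= lexx.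
      - by move=> v; rewrite /= in_itv/=; apply: Tup => //; exact: sgn.
      - by have [/andP[_ t2] _] := Tt; rewrite /= in_itv/= lexx andbT.
    apply: (@interval_no_isolated _ _ p 2) => //.
    rewrite (comp2 _ J2).
    apply: (@connected_component_max _ T `[p, 2]%classic).
    - by rewrite /= in_itv/= lexx (ltW p2).
    - move=> v; rewrite /= in_itv/=; apply: Tup; last by lra.
      by split=> //; lra.
    - exact/connected_intervalP/interval_is_interval.
    - by rewrite /= in_itv/= lexx (ltW p2).
  have J2 : J (-2).
    apply: (grow _ `[-2, t]%classic); [exact: interval_is_interval| | |].
    - by have [/andP[t2 _] _] := Tt; rewrite /= in_itv/= lexx andbT.
    - by move=> v; rewrite /= in_itv/=; apply: Tdown => //; exact: sgn.
    - by have [/andP[t2 _] _] := Tt; rewrite /= in_itv/= lexx.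
  apply: (@interval_no_isolated _ _ (-2) (- p)) => //; last by lra.
  rewrite (comp2 _ J2).
  apply: (@connected_component_max _ T `[-2, - p]%classic).
  - by rewrite /= in_itv/= lexx/=; lra.
  - move=> v; rewrite /= in_itv/=; apply: Tdown; last by lra.
    by split; [lra|rewrite heightN].
  - exact/connected_intervalP/interval_is_interval.
  - by rewrite /= in_itv/= lexx andbT; lra.
by [].
Qed.

End LoopComponent.

(** [x] is the loop in the chart [c0]; the metric has nonnegative determinant where
    [height] is nonpositive, and satisfies [accel_estimate] where it is positive. *)
Section Loop.
Context {R : realType} {n : nat} {M : smoothManifold R n} (g : symTensor M).
Variables (MR : set M) (c0 : chart R n M) (x0 w e : 'rV[R]_n) (t1 d d1 r k C : R).
Hypotheses (hg : signature_type_changing g MR) (n0 : (0 < n)%N) (ac0 : atlas c0).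
Hypotheses (t10 : t1 < 0) (d0 : 0 < d) (dd1 : d < d1) (w0 : w != 0).
Hypotheses (k0 : 0 < k) (C0 : 0 <= C).

Let U : set 'rV[R]_n := coord c0 @` cdom c0.
Let G : 'rV[R]_n -> 'M[R]_n := gcomp g c0 \o cinv c0.
Let A : R -> R := height t1 d.
Let dA : R -> R := dheight t1 d.
Let x (s : R) : 'rV[R]_n := x0 + loop_a t1 d r s *: w + loop_b r s *: e.
Let gamma (s : R) : M := cinv c0 (x s).
Let I : set R := `[-2, 2]%classic.

Hypothesis IU : forall s, I s -> U (x s).
Hypothesis det_out : forall t, t1 <= t <= 0 -> 0 <= \det (G (x0 + t *: w)).
Hypothesis det_in : forall s, s ^+ 2 <= 1 -> 0 <= \det (G (x s)).
Hypothesis est : forall t, 0 < t < d1 ->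
  let h := G (x0 + t *: w) in let N := - bil h w w in
  [/\ U (x0 + t *: w), \det h < 0, k * t <= N & forall u,
    (bil ('D_w G (x0 + t *: w)) w u - 2^-1 * bil ('D_u G (x0 + t *: w)) w w
       + 2^-1 * bil ('D_w G (x0 + t *: w)) w w / N * bil h w u) ^+ 2
    <= C * (bil h u u + bil h w u ^+ 2 / N)].

Lemma loop_intervalE s : I s = (-2 <= s <= 2) :> Prop.
Proof. by rewrite /I/= in_itv. Qed.

Lemma loop_line s : 1 <= s ^+ 2 -> x s = x0 + A s *: w.
Proof. by move=> s1; rewrite /x loop_a_out// loop_b_out// scale0r addr0. Qed.

Lemma loop_dom s : I s -> cdom c0 (gamma s) /\ coord c0 (gamma s) = x s.
Proof. by move=> /IU /cinv_dom. Qed.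

Lemma loop_height_lt s : I s -> 0 < A s -> 0 < A s < d1.
Proof.
rewrite loop_intervalE => Is ->/=; apply: le_lt_trans dd1.
by have /andP[] := height_bounds t10 d0 Is.
Qed.

Lemma loop_lorentzian s : I s -> lorentzian_part g MR (gamma s) <-> 0 < A s.
Proof.
move=> Is; have [cs xs] := loop_dom Is.
have chs : charts_at (gamma s) c0 by [].
split=> [L|As].
  rewrite ltNge; apply/negP => A0.
  have := lorentzian_part_det hg n0 chs L.
  rewrite -(chart_metricE g cs) xs ltNge => /negP; apply.
  have [s1|s1] := leP (s ^+ 2) 1; first exact: det_in.
  rewrite (loop_line (ltW s1)); apply: det_out; rewrite A0 andbT.
  by move: Is; rewrite loop_intervalE => /(height_bounds t10 d0)/andP[].
apply: (det_neg_lorentzian hg chs); rewrite -(chart_metricE g cs) xs.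
rewrite (loop_line (ltW (height_pos_sq t10 As))).
by have [] := est (loop_height_lt Is As).
Qed.

Lemma loop_no_isolated : no_isolated I.
Proof.
apply: (@interval_no_isolated _ _ (-2) 2); first exact: interval_is_interval.
- by rewrite loop_intervalE; lra.
- by rewrite loop_intervalE; lra.
- lra.
Qed.

Lemma loop_differentiable J : J `<=` I -> differentiable_curve J gamma.
Proof.
move=> JI; apply: planar_curve_differentiable => //.
- exact: smooth_loop_a.
- exact: smooth_loop_b.
- by move=> s /JI; exact: IU.
Qed.

Lemma loop_smooth : smooth_curve I gamma.
Proof.
apply: planar_curve_smooth => //; [exact: smooth_loop_a|exact: smooth_loop_b|].
exact: loop_no_isolated.
Qed.

Lemma loop_end_timelike s : I s -> 1 < s ^+ 2 -> 0 < A s -> s != 0 ->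
  timelike_velocity g I gamma s.
Proof.
move=> Is s1 As sn0 c cs; have [cs0 xs] := loop_dom Is.
have chs : charts_at (gamma s) c0 by [].
have s1' := ltW s1.
rewrite (planar_curve_velocity ac0 IU
  loop_no_isolated Is cs (loop_a_derive t1 d r s1') (loop_b_derive r s1')).
rewrite scale0r addr0 gval_trans// /gval -/(bil _ _ _) bilZl bilZr.
rewrite -(chart_metricE g cs0) xs loop_line//.
have [_ _ kN _] := est (loop_height_lt Is As).
rewrite mulrA -expr2 pmulr_rlt0; last first.
  rewrite exprn_even_gt0//=; have [s0|s0|s0] := ltgtP s 0.
  - rewrite -[s]opprK dheightN oppr_eq0 gt_eqF// dheight_gt0 ?sqrrN ?oppr_gt0//.
  - by rewrite gt_eqF// dheight_gt0.
  - by rewrite s0 eqxx in sn0.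
by rewrite -oppr_gt0; apply: lt_le_trans kN; rewrite mulr_gt0.
Qed.

(** The uniform bound on [g(gamma', gamma')] for every generalized affine
    parameter. *)
Lemma loop_reparam t J mu : (I `&` gamma @^-1` lorentzian_part g MR) t ->
  J = connected_component (I `&` gamma @^-1` lorentzian_part g MR) t ->
  gen_affine_parameter g J gamma mu ->
  exists2 gamma', reparametrization J gamma mu gamma' &
    differentiable_curve (mu @` J) gamma' /\
    exists2 eps, 0 < eps &
      forall u c, (mu @` J) u -> charts_at (gamma' u) c ->
        gval g c (gamma' u) (velocity c (mu @` J) gamma' u)
                            (velocity c (mu @` J) gamma' u) < - eps.
Proof.
have TE : I `&` gamma @^-1` lorentzian_part g MR =
    [set s | -2 <= s <= 2 /\ 0 < height t1 d s].
  apply/seteqP; split=> s.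
    by move=> [Is Ls]; split; [rewrite -loop_intervalE|exact/(loop_lorentzian Is)].
  by move=> [Is As]; rewrite -loop_intervalE in Is; split=> //; exact/(loop_lorentzian Is).
rewrite TE => Tt JE [t0 [E [V [[_ Jt0] pE uE vE muE]]]].
have [iJ nJ JT sgnJ] := loop_component t10 d0 Tt JE.
have JI s : J s -> I s by move=> /JT[+ _]; rewrite loop_intervalE.
have JA s : J s -> 0 < A s < d1.
  by move=> Js; have [_ As] := JT s Js; exact: loop_height_lt (JI s Js) As.
have Jsq s : J s -> 1 < s ^+ 2 by move=> /JT[_ /(height_pos_sq t10)].
have gJ s : J s -> cdom c0 (gamma s) /\ coord c0 (gamma s) = x0 + A s *: w.
  by move=> Js; rewrite -loop_line ?(ltW (Jsq s Js))//; exact/loop_dom/JI.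
have chJ s : J s -> charts_at (gamma s) c0 by move=> /gJ[].
have hA s : J s -> is_derive s (1 : R) A (dA s) by move=> _; exact: height_derive.
have uG s : J s -> gcomp g c0 (gamma s) \in unitmx.
  move=> Js; have [cs xs] := gJ s Js; have [_ dG _ _] := est (JA s Js).
  by rewrite unitmxE unitfE -(chart_metricE g cs) xs lt_eqF.
have dpos s : J s -> 0 < s -> 0 < dA s.
  by move=> Js s0; apply: dheight_gt0 => //; exact: Jsq.
have dneg s : J s -> s < 0 -> dA s < 0.
  move=> Js s0; rewrite -[s]opprK /dA dheightN oppr_lt0.
  by apply: dheight_gt0; rewrite ?sqrrN ?oppr_gt0//; exact: Jsq.
have dAn s : J s -> dA s != 0.
  move=> Js; case: sgnJ => H; first by rewrite gt_eqF// (dpos s Js)// H.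
  by rewrite lt_eqF// (dneg s Js)// H.
have dAs : (forall s, J s -> 0 <= dA s) \/ (forall s, J s -> dA s <= 0).
  case: sgnJ => H; [left|right] => s Js; first by rewrite ltW// (dpos s Js)// H.
  by rewrite ltW// (dneg s Js)// H.
have vE0 s : J s -> velocity c0 J gamma s = \sum_i V i s *: E i c0 s.
  by move=> Js; exact: vE (chJ s Js).
have uE0 := uE c0 (chJ t0 Jt0).
have N0 s : J s -> 0 < - bil (G (x0 + A s *: w)) w w.
  move=> Js; have [_ _ kN _] := est (JA s Js).
  by apply: lt_le_trans kN; rewrite mulr_gt0//; case/andP: (JA s Js).
have [B B0 VB] := frame_speed_bound ac0 iJ nJ hA gJ uG Jt0 pE uE0 vE0 k0 C0 JA
  (fun s Js => let: And4 _ _ h _ := est (JA s Js) in h)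
  (fun s u Js => let: And4 _ _ _ h := est (JA s Js) in h u) dAs.
have cV i : {within J, continuous (V i)}.
  apply: (frame_components_continuous ac0 iJ nJ hA gJ uG Jt0 pE uE0 vE0).
  by apply: continuous_subspaceT; exact: dheight_continuous.
pose Q s := \sum_i V i s ^+ 2.
have Q0 s : J s -> 0 < Q s.
  move=> Js; rewrite lt_def sumr_ge0 ?andbT; last by move=> i _; exact: sqr_ge0.
  apply/negP => /eqP/psumr_eq0P Q0.
  have : dA s *: w == 0.
    rewrite -(velocity_line nJ hA gJ Js) vE0// big1// => i _.
    have /eqP : V i s ^+ 2 = 0 by apply: Q0 => // j _; exact: sqr_ge0.
    by rewrite sqrf_eq0 => /eqP ->; rewrite scale0r.
  by rewrite scaler_eq0 (negbTE (dAn s Js)) (negbTE w0).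
pose S s := Num.sqrt (Q s).
have S0 s : J s -> 0 < S s by move=> /Q0; rewrite sqrtr_gt0.
have cS : {within J, continuous S}.
  apply/within_continuousP => s Js.
  apply: (@cvg_comp _ _ _ Q Num.sqrt _ (nbhs (Q s))); last exact: sqrt_continuous.
  apply: cvg_big_sum => i; apply: (@cvg_comp _ _ _ (V i) (fun y => y ^+ 2) _ (nbhs (V i s))).
    exact: (iffLR (within_continuousP _ _) (cV i)).
  exact: exprn_continuous.
have dmu s : J s -> has_wderiv J mu s (S s).
  move=> Js; apply: eq_has_wderiv (oriented_integral_has_wderiv iJ cS Jt0 Js) => //.
  by move=> u Ju; rewrite muE.
pose nu := inverse_param J mu t0.
have nuK s : J s -> nu (mu s) = s by exact: (inverse_paramK t0 iJ dmu S0).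
have nJmu : no_isolated (mu @` J) by exact: param_image_no_isolated iJ nJ dmu S0.
have [cg dg] := loop_differentiable JI.
have hvel s c : J s -> charts_at (gamma s) c ->
    has_wderiv (mu @` J) (coord c \o (gamma \o nu)) (mu s)
      ((S s)^-1 *: velocity c J gamma s).
  move=> Js cs.
  apply: (@reparam_has_wderiv _ _ _ _ t0 iJ dmu S0 _ (coord c \o gamma)) => //.
  exact/wderivable_has_wderiv/dg.
exists (gamma \o nu).
  split; first exact: param_inj iJ dmu S0.
  by move=> s Js; rewrite /= nuK.
split.
  split; first by have := @reparam_continuous _ J mu S t0 iJ dmu S0 _ gamma cg.
  move=> _ c [s Js <-]; rewrite [(_ \o _) _]/= nuK// => cs.
  exact: has_wderiv_wderivable (hvel s c Js cs).
exists ((2 * B)^-1); first by rewrite invr_gt0 mulr_gt0.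
move=> _ c [s Js <-]; rewrite [(_ \o _) _]/= nuK// => cs.
have vel : velocity c (mu @` J) (gamma \o nu) (mu s) = (S s)^-1 *: velocity c J gamma s.
  by apply: has_wderiv_wderive; [exact: nJmu|exists s|exact: hvel].
have vT : velocity c J gamma s *m trans_jac c c0 (gamma s) = dA s *: w.
  rewrite -(velocity_line nJ hA gJ Js) vE0// (vE s c Js cs) mulmx_suml.
  apply: eq_bigr => i _; rewrite -scalemxAl; congr (_ *: _).
  by have [fE _] := pE i; rewrite (fE s c c0 Js cs (chJ s Js)).
rewrite vel -(gval_trans g _ cs (chJ s Js)) -scalemxAl vT scalerA /gval -/(bil _ _ _).
have [cs0 xs] := gJ s Js.
rewrite bilZl bilZr -(chart_metricE g cs0) xs.
set b := bil _ w w.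
have b0 : 0 < - b by exact: N0.
have S2 : S s ^+ 2 = Q s by rewrite sqr_sqrtr// ltW// Q0.
have Qs := Q0 s Js.
have QB : Q s <= B * (dA s ^+ 2 * - b) by exact: VB.
have -> : (S s)^-1 * dA s * ((S s)^-1 * dA s * b) = - ((dA s ^+ 2 * - b) / Q s).
  by rewrite -S2; field; rewrite gt_eqF// S0.
rewrite ltrN2; apply: (@lt_le_trans _ _ B^-1).
  by rewrite ltf_pV2 ?posrE ?mulr_gt0//; lra.
by rewrite ler_pdivlMr// mulrC ler_pdivrMr// mulrC.
Qed.

End Loop.

(** * The circle in the image of the loop *)

Section Circle.
Context {R : realType} {n : nat} {M : smoothManifold R n}.
Variables (c0 : chart R n M) (x0 w : 'rV[R]_n) (i j : 'I_n) (t1 r : R).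
Hypotheses (wi : w 0 i != 0) (ij : i != j) (r0 : 0 < r).

(** The affine plane through [x0] spanned by [w] and the [j]-th axis, parametrized
    so that the circle of the loop is the image of the unit circle. *)
Definition planar_circle (Z : R * R) : 'rV[R]_n :=
  x0 + (t1 + r * (Z.1 - 1)) *: w + (r * Z.2) *: 'e_j.

Hypothesis circleU : forall Z, circle Z -> (coord c0 @` cdom c0) (planar_circle Z).

(* the inverse parametrization of the plane; it needs w 0 i != 0 *)
Let f (p : M) : R * R :=
  ((((coord c0 p - x0) 0 i) / w 0 i - t1) / r + 1,
   ((coord c0 p - x0) 0 j - (coord c0 p - x0) 0 i / w 0 i * w 0 j) / r).

Let fK Z : circle Z -> f (cinv c0 (planar_circle Z)) = Z.
Proof.
move=> cZ; have [_ E] := cinv_dom (circleU cZ).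
have rn : r != 0 by rewrite gt_eqF.
have Ei : (planar_circle Z - x0) 0 i = (t1 + r * (Z.1 - 1)) * w 0 i.
  by rewrite /planar_circle !mxE eqxx (negbTE ij) /=; ring.
have Ej : (planar_circle Z - x0) 0 j = (t1 + r * (Z.1 - 1)) * w 0 j + r * Z.2.
  by rewrite /planar_circle !mxE !eqxx /=; ring.
rewrite /f E Ei Ej; case: Z {cZ E Ei Ej} => X Y /=; congr pair; field; first by rewrite rn wi.
by rewrite rn wi.
Qed.

Lemma circle_homeomorphic :
  homeomorphic_sets ((fun Z => cinv c0 (planar_circle Z)) @` @circle R) (@circle R).
Proof.
exists f, (fun Z => cinv c0 (planar_circle Z)); split.
- split; apply/subspace_continuousP.
    move=> _ [Z cZ <-]; apply: cvg_within_filter.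
    have [cp _] := cinv_dom (circleU cZ).
    set p := cinv c0 _ in cp *.
    have ent k : (fun p => (coord c0 p - x0) 0 k) @ nbhs p --> (coord c0 p - x0) 0 k.
      have : (fun p => coord c0 p - x0) @ nbhs p --> coord c0 p - x0.
        by apply: cvgB; [exact: coord_cont_at|exact: cvg_cst].
      by move/cvg_mxP; apply.
    have ratio : (fun p => (coord c0 p - x0) 0 i / w 0 i) @ nbhs p -->
        (coord c0 p - x0) 0 i / w 0 i.
      by apply: cvgM; [exact: ent|exact: cvg_cst].
    have H1 : (fun p => (f p).1) @ nbhs p --> (f p).1.
      apply: cvgD; last exact: cvg_cst.
      apply: cvgM; last exact: cvg_cst.
      by apply: cvgB; [exact: ratio|exact: cvg_cst].
    have H2 : (fun p => (f p).2) @ nbhs p --> (f p).2.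
      apply: cvgM; last exact: cvg_cst.
      apply: cvgB; first exact: ent.
      by apply: cvgM; [exact: ratio|exact: cvg_cst].
    exact: cvg_pair H1 H2.
  move=> Z cZ; apply: cvg_within_filter.
  apply: (@cvg_comp _ _ _ planar_circle (cinv c0) _ (nbhs (planar_circle Z))); last first.
    exact: cinv_cont_at (circleU cZ).
  have H1 : (fun Z : R * R => t1 + r * (Z.1 - 1)) @ nbhs Z --> t1 + r * (Z.1 - 1).
    apply: cvgD; first exact: cvg_cst.
    apply: cvgM; first exact: cvg_cst.
    by apply: cvgB; [exact: cvg_fst|exact: cvg_cst].
  have H2 : (fun Z : R * R => r * Z.2) @ nbhs Z --> r * Z.2.
    by apply: cvgM; [exact: cvg_cst|exact: cvg_snd].
  exact: cvgD (cvgD (cvg_cst x0) (cvgZ H1 (cvg_cst w))) (cvgZ H2 (cvg_cst _)).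
- by move=> _ [_ [Z cZ <-] <-]; rewrite fK.
- by move=> _ [Z cZ <-]; exists Z.
- by move=> _ [Z cZ <-]; rewrite fK.
- by move=> Z cZ; rewrite fK.
Qed.

End Circle.

(** * Pseudo-timelike loops near the hypersurface *)

Unset Implicit Arguments.

Theorem theorem2 (R : realType) (n : nat) (hn : (2 <= n)%N)
    (M : smoothManifold R n) (g : symTensor M) (MR : set M)
    (hg : signature_type_changing g MR)
    (htype : transverse_type_change g)
    (hrad : transverse_radical g)
    (q : M) (hq : hypersurface g q) (V : set M) (hV : nbhs q V) :
  exists (a b : R) (gamma : R -> M),
    pseudo_timelike_loop g (lorentzian_part g MR) a b gamma /\
    gamma @` `[a, b] `<=` V.
Proof.
have n0 : (0 < n)%N by exact: leq_trans hn.
have [c0 ac0 cq] := atlas_cover q.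
have chq : charts_at q c0 by [].
have [w [radw detw]] := radical_direction hq chq htype hrad.
have w0 : w != 0 by apply: contraTneq detw => ->; rewrite derive0 ltxx.
have /rV0Pn[i wi] := w0.
have [j ij] : exists j : 'I_n, i != j.
  have [j ji] : exists j, j \in [set~ i]%SET.
    by apply/set0Pn; rewrite -card_gt0 cardsC1 card_ord -ltnS prednK.
  by exists j; rewrite eq_sym; move: ji; rewrite !inE.
pose x0 := coord c0 q.
pose U : set 'rV[R]_n := coord c0 @` cdom c0.
pose G : 'rV[R]_n -> 'M[R]_n := gcomp g c0 \o cinv c0.
have oU : open U := @cimg_open _ _ _ c0.
have Ux0 : U x0 by exists q.
have CG : Ck_on 1 U G := chart_metric_C1 g ac0.
have symG : forall x, U x -> (G x)^T = G x by exact: chart_metric_sym.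
have Gx0 : G x0 = gcomp g c0 q := chart_metricE g cq.
have radw' : w *m G x0 = 0 by rewrite Gx0.
have psdG x : U x -> 0 < \det (G x) -> forall u, 0 <= bil (G x) u u.
  move=> Ux dG u; have [cp _] := cinv_dom Ux.
  have chp : charts_at (cinv c0 x) c0 by [].
  exact: riemannian_psd (det_pos_riemannian hg n0 chp dG) chp.
have [d1 [k [C [d10 k0 C0 est]]]] :=
  accel_estimate oU CG Ux0 symG radw' detw psdG.
(* the open set of coordinates of points of V *)
pose O : set 'rV[R]_n := U `&` cinv c0 @^-1` (V°).
have oO : open O by apply: cinv_preimage_open; exact: open_interior.
have Ox0 : O x0 by split=> //=; rewrite /x0 coordK.
have [ep ep0 epP] : exists2 ep : R, 0 < ep & forall t, `|t| < ep -> O (x0 + t *: w).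
  have : nbhs (0 : R) [set t | O (x0 + t *: w)].
    apply: (line_continuous (x0 := x0) (w := w)) => /=.
    by rewrite scale0r addr0; exact: open_nbhs_nbhs.
  move=> /nbhs_ballP[ep /= ep0 epP]; exists ep => // t tep.
  by apply: epP; rewrite -ball_normE /= sub0r normrN.
have [el el0 elP] : exists2 el : R, 0 < el &
    forall t, - el < t < 0 -> 0 < \det (G (x0 + t *: w)).
  have := near_det_left oU CG Ux0 radw' detw.
  move=> /nbhs_ballP[el /= el0 elP]; exists el => // t /andP[te t0].
  have [] // := elP t _ t0.
  by rewrite -ball_normE /= sub0r normrN ltr0_norm// ltrNl.
(* the Lorentzian end of the line, within reach of the estimate and inside V *)
pose d := Num.min d1 ep / 2.
have d0 : 0 < d by rewrite divr_gt0// lt_min d10.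
have dd : d < d1 /\ d < ep.
  have m1 : Num.min d1 ep <= d1 by rewrite ge_min lexx.
  have m2 : Num.min d1 ep <= ep by rewrite ge_min lexx orbT.
  by rewrite /d; split; lra.
(* the Riemannian end of the line, where the circle is attached *)
pose t1 := - (Num.min el ep / 2).
have t10 : t1 < 0 by rewrite oppr_lt0 divr_gt0// lt_min el0.
have tt1 : - el < t1 /\ - ep < t1.
  have m1 : Num.min el ep <= el by rewrite ge_min lexx.
  have m2 : Num.min el ep <= ep by rewrite ge_min lexx orbT.
  by rewrite /t1; split; lra.
pose x1 := x0 + t1 *: w.
have Ox1 : O x1 by apply: epP; rewrite ltr0_norm// ltrNl; have [] := tt1.
have [rho rho0 rhoP] : exists2 rho : R, 0 < rho &
    forall y, `|y - x1| < rho -> O y /\ 0 < \det (G y).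
  have dG : {for x1, continuous (fun y => \det (G y))}.
    apply: differentiable_continuous; apply: differentiable_det => k' l'.
    by apply: (differentiable_metric_entry oU CG); have [] := Ox1.
  have : \forall y \near x1, O y /\ 0 < \det (G y).
    near=> y; split; near: y; first exact: open_nbhs_nbhs.
    apply: (cvgr_gt _ dG); apply: elP; rewrite t10 andbT.
    by have [] := tt1.
  move=> /nbhs_ballP[rho /= rho0 rhoP]; exists rho => // y yr.
  by apply: rhoP; rewrite -ball_normE /= distrC.
(* a radius for which the circle lies in the ball of radius rho around x1 *)
pose Z0 := 2 * `|w| + `|'e_j : 'rV[R]_n| + 1.
have Z00 : 0 < Z0 by rewrite ltr_wpDl// addr_ge0// mulr_ge0.
pose r := rho / Z0.
have r0 : 0 < r by rewrite divr_gt0.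
have circ (X Y : R) : X ^+ 2 + Y ^+ 2 = 1 ->
    let y := x0 + (t1 + r * (X - 1)) *: w + (r * Y) *: 'e_j in
    O y /\ 0 < \det (G y).
  move=> XY y; apply: rhoP.
  have -> : y - x1 = (r * (X - 1)) *: w + (r * Y) *: 'e_j.
    by rewrite /y /x1 scalerDl; apply/rowP => l; rewrite !mxE; ring.
  have X2 : `|X - 1| <= 2 by rewrite ler_norml; nra.
  have Y1 : `|Y| <= 1 by rewrite ler_norml; nra.
  have rE : rho = r * Z0 by rewrite /r divfK// gt_eqF.
  apply: le_lt_trans (ler_normD _ _) _.
  rewrite normrZ normrM (gtr0_norm r0) (normrZ (r * Y)) normrM (gtr0_norm r0).
  have := ler_wpM2r (normr_ge0 w) X2.
  have := ler_wpM2r (normr_ge0 ('e_j : 'rV[R]_n)) Y1.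
  rewrite rE -(mulrA r `|X - 1|) -(mulrA r `|Y|) -mulrDr ltr_pM2l// /Z0; lra.
pose x s : 'rV[R]_n := x0 + loop_a t1 d r s *: w + loop_b r s *: 'e_j.
have cs1 s : cos (angle s) ^+ 2 + sin (angle s) ^+ 2 = 1 :> R by exact: cos2Dsin2.
have xin s : s ^+ 2 <= 1 -> O (x s) /\ 0 < \det (G (x s)).
  by move=> s1; rewrite /x /loop_a height_in//; exact: circ.
have IE s : `[-2, 2]%classic s = (-2 <= s <= 2) :> Prop by rewrite /= in_itv.
have xO s : `[-2, 2]%classic s -> O (x s).
  move=> Is; have [s1|s1] := leP (s ^+ 2) 1; first by have [] := xin s s1.
  rewrite /x loop_a_out ?ltW// loop_b_out ?ltW// scale0r addr0; apply: epP.
  rewrite IE in Is; have /andP[h1 h2] := height_bounds t10 d0 Is.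
  by rewrite ltr_norml; have [_ d2] := dd; have [_ d3] := tt1; lra.
have IU s : `[-2, 2]%classic s -> U (x s) by move=> /xO[].
have det_out t : t1 <= t <= 0 -> 0 <= \det (G (x0 + t *: w)).
  move=> /andP[t1t]; rewrite le_eqVlt => /predU1P[->|t0].
    by rewrite scale0r addr0 Gx0 (degenerate_det hq chq).
  by apply/ltW/elP; rewrite t0 andbT; have [h _] := tt1; lra.
have det_in s : s ^+ 2 <= 1 -> 0 <= \det (G (x s)) by move=> /xin[_ /ltW].
have [dd1 _] := dd.
have I2 : `[-2, 2]%classic (2 : R) by rewrite IE; lra.
have In2 : `[-2, 2]%classic (-2 : R) by rewrite IE; lra.
have h2 : 0 < height t1 d 2 by rewrite height2.
have sq2 : 1 < 2 ^+ 2 :> R by rewrite expr2; lra.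
exists (-2), 2, (fun s => cinv c0 (x s)); split; last first.
  by move=> _ [s Is <-]; have [_ /interior_subset] := xO s Is.
have Loop := loop_lorentzian hg n0 ac0 t10 d0 dd1 IU det_out det_in est.
have TL := loop_end_timelike ac0 t10 d0 dd1 k0 IU est.
split.
- split.
  + lra.
  + exact: (loop_differentiable ac0 IU).
  + exists (cinv c0 (x 2)); split; first by exists 2.
    by apply/(Loop 2 I2).
  + move=> t J mu.
    exact: (loop_reparam hg n0 ac0 t10 d0 dd1 w0 k0 C0 IU det_out det_in est).
- exact: (loop_smooth ac0 IU).
- exists ((fun Z => cinv c0 (planar_circle x0 w j t1 r Z)) @` @circle R).
    move=> _ [[X Y] XY <-].
    have [s [s0 s1 cX sY]] := angle_onto XY.
    exists s; first by rewrite /= in_itv/=; lra.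
    by rewrite /x /loop_a /loop_b cX sY height_in//; nra.
  apply: (circle_homeomorphic wi ij r0) => -[X Y] XY.
  by have [[]] := circ X Y XY.
- exists 2, (-2); split.
  + by rewrite !in_itv/=; split; lra.
  + by rewrite eq_sym lt_eqF//; lra.
  + by rewrite /x /loop_a /loop_b heightN angleN.
  + by apply: (TL 2 I2 sq2 h2); rewrite gt_eqF.
  + by apply: (TL (-2) In2); rewrite ?sqrrN ?heightN// oppr_eq0 gt_eqF.
Unshelve. all: by end_near. Qed.
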